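(* Let $0<\lambda\le\Lambda$, let $F\colon\mathrm{Sym}(n)\to\mathbb{R}$ be $(\lambda,\Lambda)$-elliptic, let $q\ge0$, $f\in L^\infty(B_1)$, and let $u_q$ be a normalized viscosity solution (that is, $-1\le u_q\le 1$) of $$|Du_q|^q\,F(D^2u_q)=f\quad\text{in } B_1 .$$ Then there exists a constant $C$, depending only on $n,\lambda,\Lambda$ and $\|f\|_{L^\infty(B_1)}$, but independent of $q$, such that $$\|Du_q\|_{L^\infty(B_{1/2})}\le C .$$
   Context: $B_r\subset\mathbb{R}^n$ is the open ball of radius $r$ centered at the origin; $\mathrm{Sym}(n)$ is the space of real symmetric $n\times n$ matrices. Pucci operators: $\mathcal{M}^+(M)=\sup_{\lambda I_n\le A\le\Lambda I_n}\mathrm{Trace}(AM)$, $\mathcal{M}^-(M)=\inf_{\lambda I_n\le A\le\Lambda I_n}\mathrm{Trace}(AM)$. $F$ is $(\lambda,\Lambda)$-elliptic if $\mathcal{M}^-(M-N)\le F(M)-F(N)\le\mathcal{M}^+(M-N)$ for all $M,N\in\mathrm{Sym}(n)$. Viscosity solutions are continuous functions satisfying, with pointwise evaluation of $f$: whenever $\varphi\in C^2$ and $u-\varphi$ has a local maximum (resp. minimum) at $x_0$, $|D\varphi(x_0)|^qF(D^2\varphi(x_0))\ge f(x_0)$ (resp. $\le f(x_0)$). *)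

(* Defs.v *)
(* Points of R^n are row vectors ['rV[R]_n].  The library topology on them is
   the one of the max norm, i.e. the usual one; lengths and balls below are
   Euclidean. *)
From HB Require Import structures.
From mathcomp Require Import all_boot all_order all_algebra.
From mathcomp Require Import all_classical all_reals all_analysis.

Set Implicit Arguments.
Unset Strict Implicit.
Unset Printing Implicit Defensive.

Import Order.TTheory GRing.Theory Num.Theory.
Import numFieldNormedType.Exports.

Local Open Scope classical_set_scope.
Local Open Scope ring_scope.

Section euclidean.
Context {R : realType} {n : nat}.
Implicit Types (x v : 'rV[R]_n) (u : 'rV[R]_n -> R).

Definition enorm x : R := Num.sqrt (\sum_(i < n) x 0 i ^+ 2).

Definition eball (r : R) : set 'rV[R]_n := [set x | enorm x < r].

Definition evec (i : 'I_n) : 'rV[R]_n := delta_mx 0 i.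

Definition grad u x : 'rV[R]_n := \row_i 'D_(evec i) u x.

Definition hessian u x : 'M[R]_n :=
  \matrix_(i, j) 'D_(evec i) ('D_(evec j) u) x.

(* On an open [U]: all partial derivatives of order <= k exist in [U] and are
   continuous there. *)
Fixpoint C_ (k : nat) (U : set 'rV[R]_n) u : Prop :=
  {in U, continuous u} /\
  if k is k'.+1 then
    forall i, (forall x, U x -> derivable u x (evec i)) /\
              C_ k' U ('D_(evec i) u)
  else True.

End euclidean.

Section pucci.
Context {R : realType} {n : nat}.
Implicit Types (A B M N : 'M[R]_n) (F : 'M[R]_n -> R).

Definition symmx M : Prop := M^T = M.

Definition loewner_le A B : Prop :=
  forall v : 'rV[R]_n, (v *m A *m v^T) 0 0 <= (v *m B *m v^T) 0 0.

Definition pucci_range (lambda Lambda : R) M : set R :=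
  [set \tr (A *m M) | A in [set A | [/\ symmx A,
     loewner_le lambda%:M A & loewner_le A Lambda%:M]]].

Definition pucci_sup (lambda Lambda : R) M : R := sup (pucci_range lambda Lambda M).

Definition pucci_inf (lambda Lambda : R) M : R := inf (pucci_range lambda Lambda M).

(* An operator on Sym(n) is a function on all square matrices of which only the
   values on symmetric ones matter; Hessians of C^2 functions are symmetric. *)
Definition elliptic (lambda Lambda : R) F : Prop :=
  forall M N, symmx M -> symmx N ->
    pucci_inf lambda Lambda (M - N) <= F M - F N <= pucci_sup lambda Lambda (M - N).

End pucci.

Section viscosity.
Context {R : realType} {n : nat}.
Variables (F : 'M[R]_n -> R) (q : R) (f : 'rV[R]_n -> R) (U : set 'rV[R]_n).
Implicit Types (u phi : 'rV[R]_n -> R) (x : 'rV[R]_n).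

(* [powR] satisfies 0 `^ 0 = 1, and 0 `^ q = 0 for q > 0. *)
Definition degenerate_op phi x : R :=
  enorm (grad phi x) `^ q * F (hessian phi x).

Definition visc_subsolution u : Prop :=
  forall phi x0, U x0 -> C_ 2 U phi ->
    (\forall x \near x0, u x - phi x <= u x0 - phi x0) ->
    f x0 <= degenerate_op phi x0.

Definition visc_supersolution u : Prop :=
  forall phi x0, U x0 -> C_ 2 U phi ->
    (\forall x \near x0, u x0 - phi x0 <= u x - phi x) ->
    degenerate_op phi x0 <= f x0.

Definition visc_solution u : Prop :=
  [/\ {in U, continuous u}, visc_subsolution u & visc_supersolution u].

End viscosity.

(* Product sigma-algebra on R^n, as for [n.-tuple] in the library. *)
Section rV_measurable.
Context {R : realType} {n : nat}.

Definition rV_coord (i : 'I_n) (x : 'rV[R]_n) : measurableTypeR R := x 0 i.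

Let rV_set0 : g_sigma_preimage rV_coord set0.
Proof. exact: sigma_algebra0. Qed.

Let rV_setC A : g_sigma_preimage rV_coord A -> g_sigma_preimage rV_coord (~` A).
Proof. exact: sigma_algebraC. Qed.

Let rV_bigcup (A : (set 'rV[R]_n)^nat) :
  (forall i, g_sigma_preimage rV_coord (A i)) ->
  g_sigma_preimage rV_coord (\bigcup_i A i).
Proof. exact: sigma_algebra_bigcup. Qed.

HB.instance Definition _ := @isMeasurable.Build default_measure_display
  'rV[R]_n (g_sigma_preimage rV_coord) rV_set0 rV_setC rV_bigcup.

Lemma measurable_rV_coord i : measurable_fun [set: 'rV[R]_n] (rV_coord i).
Proof.
move=> _ Y mY; rewrite setTI; apply: sub_sigma_algebra => /=.
rewrite -bigcup_seq/=; exists i => /=; first by rewrite mem_index_enum.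
by exists Y => //; rewrite setTI.
Qed.

Lemma measurable_fun_rV d (T : measurableType d) (h : T -> 'rV[R]_n) :
  (forall i, measurable_fun [set: T] (rV_coord i \o h)) ->
  measurable_fun [set: T] h.
Proof.
move=> mh.
suff sub : g_sigma_preimage (fun i => rV_coord i \o h) `<=` measurable.
  move=> _ A mA; rewrite setTI; apply: sub.
  by rewrite g_sigma_preimage_comp; exists A => //; rewrite setTI.
apply: smallest_sub; first exact: sigma_algebra_measurable.
rewrite -bigcup_seq/= => A [i _ [B mB <-]].
exact: mh.
Qed.

End rV_measurable.

Section rV_cons.
Context {R : realType} {n : nat}.

Definition rV_cons (p : measurableTypeR R * 'rV[R]_n) : 'rV[R]_n.+1 :=
  row_mx ((p.1)%:M : 'M[R]_1) p.2.

Definition rV_uncons (x : 'rV[R]_n.+1) : measurableTypeR R * 'rV[R]_n :=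
  (x 0 0, @rsubmx R 1 1 n x).

Lemma rV_consK : cancel rV_cons rV_uncons.
Proof.
move=> [a v]; rewrite /rV_uncons/rV_cons/=; congr pair; last exact: row_mxKr.
transitivity (row_mx (a%:M : 'M[R]_1) v 0 (lshift n (0 : 'I_1))).
  by congr (row_mx _ _ _ _); exact/val_inj.
by rewrite row_mxEl mxE eqxx mulr1n.
Qed.

Lemma measurable_rV_cons : measurable_fun setT rV_cons.
Proof.
apply: measurable_fun_rV => i.
case: (@splitP 1 n i) => j ij.
  rewrite (_ : rV_coord i \o rV_cons = fst)//; apply/funext => -[a v].
  transitivity (row_mx (a%:M : 'M[R]_1) v 0 (lshift n j)).
    by congr (row_mx _ _ _ _); exact/val_inj.
  by rewrite row_mxEl [j]ord1 mxE eqxx mulr1n.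
rewrite (_ : rV_coord i \o rV_cons = rV_coord j \o snd).
  by apply: measurableT_comp => //; exact: measurable_rV_coord.
apply/funext => -[a v].
transitivity (row_mx (a%:M : 'M[R]_1) v 0 (rshift 1 j)).
  by congr (row_mx _ _ _ _); exact/val_inj.
by rewrite row_mxEr.
Qed.

Lemma measurable_rV_uncons : measurable_fun setT rV_uncons.
Proof.
apply/measurable_fun_pairP; split.
  exact: (@measurable_rV_coord R n.+1 0).
apply: measurable_fun_rV => i.
rewrite (_ : _ \o _ = rV_coord (rshift 1 i : 'I_n.+1)).
  exact: measurable_rV_coord.
by apply/funext => x /=; rewrite /rV_coord mxE.
Qed.

End rV_cons.

(* The Lebesgue measure on R^(n+1) is the product of the ones on R and R^n. *)
Section lebesgue_rV_succ.
Context {R : realType} {n : nat}.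
Variable mu : {sigma_finite_measure set 'rV[R]_n -> \bar R}.
Local Open Scope ereal_scope.

Let leb1 : {sigma_finite_measure set (measurableTypeR R) -> \bar R} :=
  @lebesgue_measure R.

Definition lebesgue_rV_succ : set 'rV[R]_n.+1 -> \bar R :=
  pushforward (leb1 \x mu) rV_cons.

Let preim A : measurable A -> measurable (@rV_cons R n @^-1` A).
Proof. by move=> mA; rewrite -[X in measurable X]setTI; exact: measurable_rV_cons. Qed.

Let succ0 : lebesgue_rV_succ set0 = 0.
Proof. by rewrite /lebesgue_rV_succ/pushforward preimage_set0 measure0. Qed.

Let succ_ge0 A : 0 <= lebesgue_rV_succ A.
Proof. exact: (measure_ge0 (leb1 \x mu) (rV_cons @^-1` A)). Qed.

Let succ_sigma_additive : semi_sigma_additive lebesgue_rV_succ.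
Proof.
move=> A mA tA mUA; rewrite /lebesgue_rV_succ/pushforward preimage_bigcup.
apply: measure_semi_sigma_additive.
- by move=> k; exact: preim.
- apply/trivIsetP => /= i j _ _ ij; rewrite -preimage_setI.
  by move/trivIsetP : tA => /(_ _ _ _ _ ij) ->//; rewrite preimage_set0.
- by rewrite -preimage_bigcup; exact: preim.
Qed.

HB.instance Definition _ := isMeasure.Build _ _ _ lebesgue_rV_succ
  succ0 succ_ge0 succ_sigma_additive.

Let succ_sigma_finite : sigma_finite setT lebesgue_rV_succ.
Proof.
have /sigma_finiteP[A [TA ndA Aoo]] := sigma_finiteT leb1.
have /sigma_finiteP[B [TB ndB Boo]] := sigma_finiteT mu.
exists (fun k => @rV_uncons R n @^-1` (A k `*` B k)).
  rewrite -preimage_bigcup (_ : \bigcup_k (A k `*` B k) = setT) ?preimage_setT//.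
  apply/seteqP; split => // -[a v] _.
  have [i _ Aia] : (\bigcup_i A i) a by rewrite -TA.
  have [j _ Bjv] : (\bigcup_i B i) v by rewrite -TB.
  exists (maxn i j) => //; split => /=.
    by move: a Aia; exact/subsetPset/ndA/leq_maxl.
  by move: v Bjv; exact/subsetPset/ndB/leq_maxr.
move=> k; have [mA finA] := Aoo k; have [mB finB] := Boo k; split.
  rewrite -[X in measurable X]setTI; apply: measurable_rV_uncons => //.
  exact: measurableX.
rewrite /lebesgue_rV_succ/pushforward -comp_preimage.
rewrite (_ : _ \o _ = id); last by apply/funext => p /=; rewrite rV_consK.
by rewrite preimage_id product_measure1E// lte_mul_pinfty// ge0_fin_numE.
Qed.

HB.instance Definition _ := Measure_isSigmaFinite.Build _ _ _ lebesgue_rV_succ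
  succ_sigma_finite.

End lebesgue_rV_succ.

Fixpoint lebesgue_rV (R : realType) (n : nat) :
    {sigma_finite_measure set 'rV[R]_n -> \bar R} :=
  match n with
  | 0 => @dirac _ 'rV[R]_0 0 R
  | n'.+1 => lebesgue_rV_succ (lebesgue_rV R n')
  end.

Section function_spaces.
Context {R : realType} {n : nat}.
Implicit Types (U : set 'rV[R]_n) (u h : 'rV[R]_n -> R) (g : 'rV[R]_n -> 'rV[R]_n).
Local Notation mu := (lebesgue_rV R n).

(* [measurable_fun] refers to the Borel sigma-algebra, which is not complete. *)
Definition lebesgue_measurable U h : Prop :=
  exists2 h' : 'rV[R]_n -> R, measurable_fun U h' &
    {ae mu, forall x, U x -> h x = h' x}.

Definition Linfty_norm U h : \bar R := 'N[mu]_(+oo)[EFin \o (h \_ U)]%E.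

Definition test_function U (psi : 'rV[R]_n -> R) : Prop :=
  (forall k, C_ k setT psi) /\
  exists K, [/\ compact K, K `<=` U & forall x, ~ K x -> psi x = 0].

Definition weak_gradient U u g : Prop :=
  forall i,
    [/\ measurable_fun U (fun x => g x 0 i),
        forall K, compact K -> K `<=` U ->
          mu.-integrable K (EFin \o (fun x => g x 0 i)) &
        forall psi, test_function U psi ->
          \int[mu]_(x in U) (u x * 'D_(evec i) psi x) =
          - \int[mu]_(x in U) (g x 0 i * psi x)].

(* ||Du||_{L^oo(U)} <= C, for the distributional gradient Du of u in U. *)
Definition grad_Linfty_le U u (C : R) : Prop :=
  exists2 g, weak_gradient U u g &
    (Linfty_norm U (fun x => enorm (g x)) <= C%:E)%E.

End function_spaces.

(* Main.v *)
Require Import Defs.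
From HB Require Import structures.
From mathcomp Require Import all_boot all_order all_algebra.
From mathcomp Require Import all_classical all_reals all_analysis.
From mathcomp Require Import measurable_realfun ess_sup_inf ring lra.

(** Uniformity in [q] comes from using the equation only where the gradient [p] has length
    at least one.  There [- K <= |p|^q F] implies [- K <= F] for every [q >= 0], since the
    factor can only decrease a negative number ([powR_mul_lb]).  The gradients that matter in
    the doubling method of Ishii and Lions are long, so that method applies.

    Fix [x0] in the half ball and suppose that
    [u x - u y - L (|x - y| - |x - y|^2) - 128 |x - x0|^2] has a positive maximum for points
    near [x0].  The two points are distinct, the gradients at them have length of order [L],
    and the theorem on sums provides symmetric matrices [X], [Y] with [- K <= F X] and
    [- K <= - F (- Y)], up to small multiples of the identity, such that [X + Y] is bounded
    above and at most [const - 8 L] in the direction of [x - y].  Ellipticity gives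
    [- 2 K <= const - 8 L lambda], which fails for the constant [lip_bound]
    ([doubling_le0]); hence [u] is Lipschitz on the half ball ([lipschitz_half_ball]).

    Viscosity inequalities are pointwise whereas [f] is bounded only almost everywhere, so
    the theorem on sums must produce contact points outside a null set.  To this end [u] is
    replaced on a compact ball by its Lasry-Lions regularisation [w], of class C^{1,1} with
    gradient [Dw].  By Rademacher's theorem ([rademacher]) applied to [Dw], [w] has a second
    order expansion almost everywhere ([c11_peano_ae]).  Where [w] is touched from above by a
    parabola that is not too open, its expansion at [x] yields quadratic test functions for
    [u] at [T x = x + t Dw x] ([reg_contact]).  The points that [T] sends into the bad null
    set form a null set, because [T] is locally expanding where [1 + t X] is positive
    definite ([expanding_preimage_negligible]).  If [1 + t X] were degenerate, [u] would
    admit at [T x] test functions with bounded gradient and [F] arbitrarily negative, against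
    the finiteness of [f] at [T x].  So almost every contact point with a long gradient
    satisfies the second order inequality ([good_points]).  Finally, tilting the doubled
    function by all small linear functions shows that the contact points are mapped onto a
    neighbourhood of the origin by the Lipschitz map of gradient defects; they are therefore
    not contained in a null set ([avoid_null_pair], [theorem_on_sums]).

    A Lipschitz function is a weak primitive of its almost everywhere defined directional
    derivatives: difference quotients of [u * psi] integrate to zero by translation
    invariance and converge dominatedly ([lipschitz_ibp]), which bounds the weak gradient
    ([grad_Linfty_le_lipschitz]). *)

Set Implicit Arguments.
Unset Strict Implicit.
Unset Printing Implicit Defensive.

Import Order.TTheory GRing.Theory Num.Theory.
Import numFieldNormedType.Exports.

Local Open Scope classical_set_scope.
Local Open Scope ring_scope.

(** * Cubes of the max norm *)

Section max_norm.
Context {R : realType} {n : nat}.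
Implicit Types (x y c : 'rV[R]_n) (r : R).

Lemma coord_le_norm x i : `|x 0 i| <= `|x|.
Proof.
rewrite [leRHS]/Num.Def.normr/= mx_normrE.
by apply: (le_trans _ (le_bigmax _ _ (0, i))).
Qed.

Lemma norm_rV_le x r : 0 <= r -> (forall i, `|x 0 i| <= r) -> `|x| <= r.
Proof.
move=> r0 xr; rewrite [leLHS]/Num.Def.normr/= mx_normrE.
by apply/bigmax_leP; split => // -[i j] _ /=; rewrite (ord1 i).
Qed.

Lemma norm_rV_lt x r : 0 < r -> (forall i, `|x 0 i| < r) -> `|x| < r.
Proof.
move=> r0 xr; rewrite [ltLHS]/Num.Def.normr/= mx_normrE.
by apply/bigmax_ltP; split => // -[i j] _ /=; rewrite (ord1 i).
Qed.

Definition cube c (r : R) : set 'rV[R]_n := [set x | forall i, `|x 0 i - c 0 i| < r].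

Lemma cubeP c r x : 0 < r -> cube c r x <-> `|x - c| < r.
Proof.
move=> r0; split=> [xr|xr i].
  by apply: norm_rV_lt => // i; rewrite !mxE.
by apply: le_lt_trans xr; have := coord_le_norm (x - c) i; rewrite !mxE.
Qed.

Lemma cube_open c r : 0 < r -> open (cube c r).
Proof.
move=> r0; rewrite (_ : cube c r = ball c r); first exact: ball_open.
apply/seteqP; split => x; first by move/(cubeP _ _ r0); rewrite -ball_normE/= distrC.
by rewrite -ball_normE/= distrC => /(cubeP _ _ r0).
Qed.

End max_norm.

Section rV_cons_coord.
Context {R : realType} {n : nat}.

Lemma rV_cons0 (p : measurableTypeR R * 'rV[R]_n) : rV_cons p 0 ord0 = p.1.
Proof.
transitivity (row_mx ((p.1)%:M : 'M[R]_1) p.2 0 (lshift n (0 : 'I_1))).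
  by congr (row_mx _ _ _ _); exact/val_inj.
by rewrite row_mxEl mxE eqxx mulr1n.
Qed.

Lemma rV_consS (p : measurableTypeR R * 'rV[R]_n) j :
  rV_cons p 0 (lift ord0 j) = p.2 0 j.
Proof.
transitivity (row_mx ((p.1)%:M : 'M[R]_1) p.2 0 (rshift 1 j)).
  by congr (row_mx _ _ _ _); exact/val_inj.
by rewrite row_mxEr.
Qed.

End rV_cons_coord.

Section borel.
Context {R : realType} {n : nat}.
Implicit Types (x y c : 'rV[R]_n) (r : R).

Lemma measurable_cube c r : measurable (cube c r).
Proof.
rewrite (_ : cube c r = \bigcap_(i in [set: 'I_n])
  ([set: 'rV[R]_n] `&` (@rV_coord R n i @^-1` `]c 0 i - r, c 0 i + r[%classic))).
  apply: fin_bigcap_measurable => [|i _]; first exact: finite_finset.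
  exact: measurable_rV_coord.
apply/seteqP; split => x /= xr i.
  by move=> _; split => //=; have := xr i; rewrite /rV_coord in_itv/= ltr_distl.
by have [_ /=] := xr i Logic.I; rewrite /rV_coord in_itv/= ltr_distl.
Qed.

End borel.

Lemma lebesgue_rV_cube (R : realType) (n : nat) (c : 'rV[R]_n) (r : R) : 0 <= r ->
  lebesgue_rV R n (cube c r) = ((2 * r) ^+ n)%:E.
Proof.
elim: n c => [c r0|m IH c r0] /=.
  by rewrite diracE expr0 mem_set// => -[].
rewrite /lebesgue_rV_succ/= /pushforward.
rewrite (_ : _ @^-1` _ = `]c 0 0 - r, c 0 0 + r[%classic `*` cube (\row_j c 0 (lift ord0 j)) r).
  rewrite product_measure1E; [|exact: measurable_itv|exact: measurable_cube].
  pose I : set R := `]c 0 0 - r, c 0 0 + r[%classic.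
  transitivity (lebesgue_measure I *
    ((2 * r) ^+ m)%:E)%E; first by rewrite -(IH (\row_j c 0 (lift ord0 j)) r0).
  rewrite /I lebesgue_measure_itv/= lte_fin.
  case: ifPn => [_|]; first by rewrite -EFinB -EFinM exprS; congr (_ * _)%:E; ring.
  rewrite -leNgt => r0'; have -> : r = 0 by lra.
  by rewrite mul0e exprS mulr0 mul0r.
apply/seteqP; split => -[a v] /=.
  move=> cr; split.
    by have := cr 0; rewrite rV_cons0/= in_itv/= ltr_distl.
  by move=> j; have := cr (lift ord0 j); rewrite rV_consS !mxE.
move=> []; rewrite in_itv/= => /andP[ar1 ar2] vr i.
have [->|[j ->]] : i = 0 \/ exists j, i = lift ord0 j.
  by case: (unliftP ord0 i) => [j ->|->]; [right; exists j|left].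
  by rewrite rV_cons0/= ltr_distl; apply/andP; split; lra.
by rewrite rV_consS; have := vr j; rewrite mxE.
Qed.

Lemma locally_lipschitz_continuous (R : realType) (V : normedModType R) (f : V -> R) (L : R) (x : V) :
  (forall y, `|x - y| <= 1 -> `|f x - f y| <= L * `|x - y|) -> {for x, continuous f}.
Proof.
move=> fL; apply/cvgrPdist_le => e e0.
have L1 : 0 < `|L| + 1 by rewrite ltr_wpDl.
apply/nbhs_normP; exists (Num.min 1 (e / (`|L| + 1))) => /=.
  by rewrite lt_min ltr01 divr_gt0.
move=> y /=; rewrite lt_min => /andP[/ltW xy1 xy]; apply: le_trans (fL y xy1) _.
apply: (@le_trans _ _ ((`|L| + 1) * `|x - y|)).
  by rewrite ler_wpM2r// ler_wpDr// ler_norm.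
by rewrite mulrC -ler_pdivlMr// ltW.
Qed.

Lemma lipschitz_continuous (R : realType) (V : normedModType R) (f : V -> R) (L : R) :
  (forall x y, `|f x - f y| <= L * `|x - y|) -> continuous f.
Proof. by move=> fL x; apply: (@locally_lipschitz_continuous R V f L) => y _. Qed.

Lemma norm_rVZ (R : realType) (n : nat) (a : R) (x : 'rV[R]_n) : `|a *: x| = `|a| * `|x|.
Proof. exact: normrZ. Qed.

(** * Dyadic cells and open sets *)

Section dyadic.
Context {R : realType} {n : nat}.
Implicit Types (x y c : 'rV[R]_n) (k j : nat) (m : 'rV[int]_n).
Local Notation mu := (lebesgue_rV R n).

Definition dyad k x : 'rV[int]_n := \row_i Num.floor (2 ^+ k * x 0 i).

(** Half-open cells [2^-k (m + [0,1)^n)]: those of one generation partition the space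
    and those of the next one refine them. *)
Definition dcell k m : set 'rV[R]_n := [set x | dyad k x = m].

Definition dcenter k m : 'rV[R]_n := \row_i (((m 0 i)%:~R + 2^-1) / 2 ^+ k).

Lemma dcellP k m x :
  dcell k m x <-> forall i, (m 0 i)%:~R <= 2 ^+ k * x 0 i < (m 0 i + 1)%:~R.
Proof.
split=> [<- i|xm]; first by rewrite mxE floor_itv.
by apply/rowP => i; rewrite mxE; apply/eqP; rewrite floor_eq xm.
Qed.

Lemma measurable_dcell k m : measurable (dcell k m).
Proof.
rewrite (_ : dcell k m = \bigcap_(i in [set: 'I_n])
  ([set: 'rV[R]_n] `&` (@rV_coord R n i @^-1`
     `[(m 0 i)%:~R / 2 ^+ k, (m 0 i + 1)%:~R / 2 ^+ k[%classic))).
  apply: fin_bigcap_measurable => [|i _]; first exact: finite_finset.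
  exact: measurable_rV_coord.
apply/seteqP; split => x.
  move=> /dcellP xm i _; split => //=; rewrite /rV_coord in_itv/=.
  by rewrite ler_pdivrMr ?exprn_gt0// ltr_pdivlMr ?exprn_gt0// mulrC.
move=> xm; apply/dcellP => i; have [_ /=] := xm i Logic.I.
by rewrite /rV_coord in_itv/= ler_pdivrMr ?exprn_gt0// ltr_pdivlMr ?exprn_gt0// mulrC.
Qed.

Lemma dcell_sub_cube k m : dcell k m `<=` cube (dcenter k m) (2 ^- k).
Proof.
move=> x /dcellP xm i; rewrite mxE; have /andP[m1 m2] := xm i.
have k0 : (0:R) < 2 ^+ k by rewrite exprn_gt0.
rewrite -(ltr_pM2l k0) mulfV ?gt_eqF// -{1}(gtr0_norm k0) -normrM mulrBr.
rewrite mulrCA divff ?gt_eqF// mulr1 ltr_norml; rewrite intrD in m2.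
by apply/andP; split; lra.
Qed.

Lemma cube_sub_dcell k m : cube (dcenter k m) (2^-1 * 2 ^- k) `<=` dcell k m.
Proof.
move=> x xm; apply/dcellP => i; have := xm i; rewrite mxE.
have k0 : (0:R) < 2 ^+ k by rewrite exprn_gt0.
rewrite -(ltr_pM2l k0) (mulrCA (2 ^+ k)) mulfV ?gt_eqF// -{1}(gtr0_norm k0) -normrM mulrBr.
rewrite mulrCA divff ?gt_eqF// mulr1 ltr_norml intrD => /andP[m1 m2].
by apply/andP; split; lra.
Qed.

Lemma dcell_sub_cube_pt k x : dcell k (dyad k x) `<=` cube x (2 ^- k).
Proof.
move=> y /dcellP ym i.
have /dcellP /(_ i) /andP[x1 x2] : dcell k (dyad k x) x by [].
have /andP[y1 y2] := ym i.
have k0 : (0:R) < 2 ^+ k by rewrite exprn_gt0.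
rewrite -(ltr_pM2l k0) mulfV ?gt_eqF// -{1}(gtr0_norm k0) -normrM mulrBr.
rewrite ltr_norml; rewrite intrD in x2 y2.
by apply/andP; split; lra.
Qed.

Lemma dyadS k x y : dyad k.+1 x = dyad k.+1 y -> dyad k x = dyad k y.
Proof.
have H u v : dyad k.+1 u = dyad k.+1 v -> forall i,
    Num.floor (2 ^+ k * u 0 i) <= Num.floor (2 ^+ k * v 0 i).
  move=> /rowP uv i; have := uv i; rewrite !mxE => uvi.
  rewrite floor_ge_int -(@ler_pM2l _ 2)//; apply: (@le_trans _ _ (Num.floor (2 ^+ k.+1 * v 0 i))%:~R); last first.
    by rewrite mulrA -exprS floor_le.
  have -> : 2 * (Num.floor (2 ^+ k * u 0 i))%:~R = (2 * Num.floor (2 ^+ k * u 0 i))%:~R :> R by rewrite intrM.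
  rewrite ler_int -uvi floor_ge_int intrM exprS -mulrA ler_pM2l//.
  exact: floor_le.
move=> xy; apply/rowP => i; rewrite !mxE; apply/eqP; rewrite eq_le !H//.
Qed.

Lemma dyad_le j k x y : (j <= k)%N -> dyad k x = dyad k y -> dyad j x = dyad j y.
Proof.
move=> /subnK <-; elim: (k - j)%N => [//|d IH].
by rewrite addSn => /dyadS.
Qed.

(** The cells of a Whitney type decomposition: those contained in [G] none of
    whose ancestors is. *)
Definition maxcell (G : set 'rV[R]_n) (p : nat * 'rV[int]_n) : set 'rV[R]_n :=
  if `[< dcell p.1 p.2 `<=` G /\
         forall j x, (j < p.1)%N -> dcell p.1 p.2 x -> ~ (dcell j (dyad j x) `<=` G) >]
  then dcell p.1 p.2 else set0.

Lemma measurable_maxcell G p : measurable (maxcell G p).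
Proof. by rewrite /maxcell; case: asboolP => _; [exact: measurable_dcell|]. Qed.

Lemma maxcell_sub G p : maxcell G p `<=` G.
Proof. by rewrite /maxcell; case: asboolP => [[]//|_ ? []]. Qed.

Lemma maxcell_inj G p p' x : maxcell G p x -> maxcell G p' x -> p = p'.
Proof.
have H (q q' : nat * 'rV[int]_n) : maxcell G q x -> maxcell G q' x -> ~ (q.1 < q'.1)%N.
  rewrite /maxcell; case: asboolP => // -[qG _] qx; case: asboolP => // -[q'G nq'] q'x lt.
  by apply: (nq' _ _ lt q'x); move: qx; rewrite /dcell/= => ->.
move=> px p'x; have := H _ _ px p'x; have := H _ _ p'x px.
move=> /negP; rewrite -leqNgt => h1 /negP; rewrite -leqNgt => h2.
have e1 : p.1 = p'.1 by apply/eqP; rewrite eqn_leq h1 h2.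
move: px p'x; rewrite /maxcell; case: asboolP => // _ + ; case: asboolP => // _.
rewrite /dcell/= e1 => e2; rewrite e2 => e3.
by rewrite (surjective_pairing p) (surjective_pairing p') e1 e3.
Qed.

Lemma maxcell_bigcup G : open G -> \bigcup_p maxcell G p = G.
Proof.
move=> oG; apply/seteqP; split => [x [p _ /maxcell_sub//]|x Gx].
have /nbhs_ballP[e /= e0 eG] : nbhs x G by exact: open_nbhs_nbhs.
have [k0 k0e] : exists k, dcell k (dyad k x) `<=` G.
  have [k ke] : exists k : nat, (2 ^- k : R) < e.
    have [k ke] : exists k : nat, e^-1 < k%:R :> R.
      by exists (Num.truncn e^-1).+1; rewrite truncnS_gt.
    exists k; rewrite -(@ltf_pV2 _ e) ?posrE ?invr_gt0 ?exprn_gt0// invrK (lt_le_trans ke)//.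
    by rewrite -natrX ler_nat ltnW// ltn_expl.
  exists k => y /dcell_sub_cube_pt/(cubeP _ _ _)/= xy; apply: eG; rewrite -ball_normE/= distrC.
  by apply: lt_trans ke; apply: xy; rewrite invr_gt0 exprn_gt0.
pose P k := `[< dcell k (dyad k x) `<=` G >].
have exP : exists k, P k by exists k0; apply/asboolP.
exists (ex_minn exP, dyad (ex_minn exP) x) => //.
case: ex_minnP => k /asboolP Pk kmin.
rewrite /maxcell; case: asboolP => // /contra_notP; apply; split => //= j y jk yk.
move=> yj; have : P j.
  by apply/asboolP; rewrite (dyad_le (ltnW jk) (esym yk)).
by move/kmin; rewrite leqNgt jk.
Qed.

Lemma open_measurable_rV (G : set 'rV[R]_n) : open G -> measurable G.
Proof.
move=> oG; rewrite -(maxcell_bigcup oG).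
by apply: countable_bigcupT_measurable => // p; exact: measurable_maxcell.
Qed.

(** The maximal dyadic cells of [G] are disjoint, and each contains a cube of half the
    radius of the cube that covers it; hence the radii are controlled by [mu G]. *)
Lemma open_cube_cover (G : set 'rV[R]_n) (e : R) : (0 < n)%N -> open G ->
  (mu G <= e%:E)%E ->
  exists (c : nat -> 'rV[R]_n) (r : nat -> R),
    [/\ forall k, 0 <= r k, G `<=` \bigcup_k cube (c k) (r k) &
        forall N, \sum_(k < N) r k ^+ n <= e].
Proof.
move=> n0 oG mGe.
pose pinv j : option (nat * 'rV[int]_n) := pickle_inv j.
have pinvE j p : pinv j = Some p -> pickle p = j.
  by move=> jp; have := @pickle_invK (nat * 'rV[int]_n)%type j; rewrite -/(pinv j) jp.
pose B (j : nat) : set 'rV[R]_n := oapp (maxcell G) set0 (pinv j).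
have mB j : measurable (B j).
  by rewrite /B; case: (pinv j) => [p|]/=; [exact: measurable_maxcell|].
have tB : trivIset setT B.
  apply/trivIsetP => i j _ _ ij; apply/seteqP; split => // x [].
  rewrite /B; case Ei : (pinv i) => [p|]//=; case Ej : (pinv j) => [p'|]//= px p'x.
  move: ij; rewrite -(pinvE _ _ Ei) -(pinvE _ _ Ej) (maxcell_inj px p'x).
  by rewrite eqxx.
pose c j := oapp (fun p => dcenter p.1 p.2) 0 (pinv j).
pose r j : R := oapp (fun p => if `[< maxcell G p = set0 >] then 0 else 2 ^- p.1) 0 (pinv j).
have r0 j : 0 <= r j.
  by rewrite /r; case: (pinv j) => [p|]//=; case: asboolP => // _; rewrite invr_ge0 exprn_ge0.
exists c, r; split => //.
  rewrite -{1}(maxcell_bigcup oG) => x [p _ px]; exists (pickle p) => //.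
  rewrite /c /r (pickleK_inv p : pinv _ = _)/=; case: asboolP => [p0|_].
    by move: px; rewrite p0.
  by move: px; rewrite /maxcell; case: asboolP => // _; exact: dcell_sub_cube.
move=> N; rewrite -lee_fin -sumEFin; apply: le_trans mGe.
apply: (@le_trans _ _ (\sum_(k < N) mu (B k))%E).
  apply: lee_sum => k _; rewrite /r /B; case: (pinv k) => [p|]/=; last first.
    by rewrite expr0n eqn0Ngt n0 ?measure0.
  case: asboolP => [->|]; first by rewrite measure0 expr0n eqn0Ngt n0.
  rewrite /maxcell; case: asboolP => // _ _.
  have -> : (2:R) ^- p.1 ^+ n = (2 * (2^-1 * 2 ^- p.1)) ^+ n.
    by rewrite mulrA mulfV ?mul1r// pnatr_eq0.
  rewrite -(lebesgue_rV_cube (dcenter p.1 p.2)); last first.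
    by rewrite mulr_ge0// invr_ge0// exprn_ge0.
  apply: le_measure; rewrite ?inE; [exact: measurable_cube|exact: measurable_dcell|].
  exact: cube_sub_dcell.
rewrite -measure_bigsetU_ord//; last first.
  by move=> i j _ _ ij; apply: val_inj; exact: (tB (val i) (val j)).
apply: le_measure; rewrite ?inE.
- by apply: bigsetU_measurable.
- exact: open_measurable_rV.
- rewrite -(bigcup_mkord N B).
  by move=> x [k _]; rewrite /B; case: (pinv k) => [p|]//= /maxcell_sub.
Qed.

End dyadic.

Lemma measurable_closed_rV (R : realType) (n : nat) (F : set 'rV[R]_n) :
  closed F -> measurable F.
Proof.
move=> cF; rewrite -(setCK F); apply: measurableC; apply: open_measurable_rV.
exact: closed_openC.
Qed.

Lemma closed_norm_le (R : realType) (n : nat) (g : 'rV[R]_n -> R) (c : R) :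
  continuous g -> closed [set x | `|g x| <= c].
Proof.
move=> cg; have cn : continuous (fun x => `|g x|).
  by move=> x; exact: (continuous_comp (cg x) (@norm_continuous _ R (g x))).
by apply: (closed_comp _ (@closed_le R c)) => x _; exact: cn.
Qed.

(** * Null sets and cube covers *)

Section regularity.
Context {R : realType} {n : nat}.
Local Notation mu := (lebesgue_rV R n).
Variable q : R.
Let Q : set 'rV[R]_n := cube 0 q.

(** The approximation is only asked inside the bounded cube [Q], where all measures are
    finite; the sets having this property then form a sigma-algebra. *)
Definition regular (A : set 'rV[R]_n) := forall e : R, 0 < e ->
  exists F G, [/\ closed F, open G, F `<=` A, A `<=` G &
                  (mu ((G `\` F) `&` Q) <= e%:E)%E].

Let mo (G : set 'rV[R]_n) : open G -> measurable G := @open_measurable_rV R n G.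

Let mc (F : set 'rV[R]_n) : closed F -> measurable F := @measurable_closed_rV R n F.

Let muQ : (mu Q < +oo)%E.
Proof.
have [q0|q0] := leP 0 q; first by rewrite lebesgue_rV_cube// ltry.
apply: (@le_lt_trans _ _ (mu (@cube R n 0 `|q|))).
  apply: le_measure; rewrite ?inE; [exact: measurable_cube..|].
  by move=> x xq i; apply: lt_le_trans (xq i) _; exact: ler_norm.
by rewrite lebesgue_rV_cube// ltry.
Qed.

Let mQ : measurable Q. Proof. exact: measurable_cube. Qed.

Lemma regularC A : regular A -> regular (~` A).
Proof.
move=> rA e e0; have [F [G [cF oG FA AG GFe]]] := rA e e0.
exists (~` G), (~` F); split.
- exact: open_closedC.
- exact: closed_openC.
- exact: subsetC.
- exact: subsetC.
- by rewrite setDE setCK setIC (setIC (~` F)) -setDE setIC.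
Qed.

Lemma regular_bigcup (A : (set 'rV[R]_n)^nat) :
  (forall k, regular (A k)) -> regular (\bigcup_k A k).
Proof.
move=> rA e e0.
have e20 : 0 < e / 2 by rewrite divr_gt0.
have ek0 k : 0 < e / 2 / (2 ^ k.+1)%:R by rewrite divr_gt0// ltr0n expn_gt0.
have [F /choice [G FG]] := choice (fun k => rA k _ (ek0 k)).
have cF k : closed (F k) by have [] := FG k.
have oG k : open (G k) by have [] := FG k.
pose F' N := \bigcup_(k < N) F k.
pose D N := (\bigcup_k F k `\` F' N) `&` Q.
have mF' N : measurable (F' N) by apply: bigcup_measurable => k _; exact: mc.
have mUF : measurable (\bigcup_k F k) by apply: bigcup_measurable => k _; exact: mc.
have mD N : measurable (D N) by apply: measurableI => //; exact: measurableD.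
have Dcvg : mu \o D @ \oo --> mu (\bigcap_N D N).
  apply: nonincreasing_cvg_mu => //.
  - apply: le_lt_trans muQ; apply: le_measure; rewrite ?inE//; exact: subIsetr.
  - exact: bigcap_measurable.
  - move=> i j ij; apply/subsetPset; apply: setSI; apply: setDS.
    by move=> x [k /= ki Fk]; exists k => //=; exact: leq_trans ij.
have D0 : \bigcap_N D N = set0.
  apply/seteqP; split => // x xD.
  have [[[k _ Fk] _] _] := xD 0%N Logic.I.
  by have [[_ +] _] := xD k.+1 Logic.I; apply; exists k => /=.
rewrite D0 measure0 in Dcvg.
have [N DN] : exists N, (mu (D N) < (e / 2)%:E)%E.
  have : nbhs (0%E : \bar R) [set y | (y < (e / 2)%:E)%E].
    by apply: open_nbhs_nbhs; split; [exact: open_ereal_lt_ereal|rewrite /= lte_fin].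
  by move=> /Dcvg[N _ /(_ N (leqnn N))]; exists N.
exists (F' N), (\bigcup_k G k); split.
- by rewrite /F' bigcup_mkord; apply: closed_bigsetU => k _; exact: cF.
- exact: bigcup_open.
- by move=> x [k _ Fk]; exists k => //; have [_ _ + _ _] := FG k; apply.
- by move=> x [k _ Ak]; exists k => //; have [_ _ _ + _] := FG k; apply.
apply: (@le_trans _ _ (mu (\bigcup_k ((G k `\` F k) `&` Q) `|` D N))).
  apply: le_measure; rewrite ?inE.
  - apply: measurableI => //; apply: measurableD => //.
    by apply: bigcup_measurable => k _; exact: mo.
  - apply: measurableU => //; apply: bigcup_measurable => k _.
    by apply: measurableI => //; apply: measurableD; [exact: mo|exact: mc].
  - move=> x [[[k _ Gk] nF] Qx]; have [xF|xF] := pselect ((\bigcup_k F k) x).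
      by right.
    by left; exists k => //; split => //; split => // Fk; apply: xF; exists k.
apply: (le_trans (measureU2 _ _ _)) => //.
  apply: bigcup_measurable => k _.
  by apply: measurableI => //; apply: measurableD; [exact: mo|exact: mc].
rewrite [e in leRHS]splitr EFinD; apply: leeD; last exact: ltW.
apply: (@le_trans _ _ (\sum_(k <oo) mu ((G k `\` F k) `&` Q)))%E.
  apply: generalized_Boole_inequality => // [k|].
    by apply: measurableI => //; apply: measurableD; [exact: mo|exact: mc].
  apply: bigcup_measurable => k _.
  by apply: measurableI => //; apply: measurableD; [exact: mo|exact: mc].
apply: (le_trans _ (epsilon_trick0 xpredT (ltW e20))).
by apply: lee_nneseries => // k _; have [] := FG k.
Qed.

Lemma regular_halfspace i a : regular [set x : 'rV[R]_n | a < x 0 i].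
Proof.
move=> e e0.
have cf : continuous (fun x : 'rV[R]_n => x 0 i) by exact: coord_continuous.
pose F k := [set x : 'rV[R]_n | a + k.+1%:R^-1 <= x 0 i].
have oG : open [set x : 'rV[R]_n | a < x 0 i].
  by apply: (open_comp (D := [set y | a < y])) => //; exact: open_gt.
have cF k : closed (F k).
  by apply: (closed_comp (D := [set y | a + k.+1%:R^-1 <= y])) => //; exact: closed_ge.
pose D k := ([set x : 'rV[R]_n | a < x 0 i] `\` F k) `&` Q.
have mD N : measurable (D N).
  by apply: measurableI => //; apply: measurableD; [exact: mo|exact: mc].
have Dcvg : mu \o D @ \oo --> mu (\bigcap_N D N).
  apply: nonincreasing_cvg_mu => //.
  - apply: le_lt_trans muQ; apply: le_measure; rewrite ?inE//; exact: subIsetr.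
  - exact: bigcap_measurable.
  - move=> k j ij; apply/subsetPset; apply: setSI; apply: setDS.
    move=> x; rewrite /F /= => /(le_trans _); apply; rewrite lerD2l.
    by rewrite lef_pV2 ?posrE// ler_nat.
have D0 : \bigcap_N D N = set0.
  apply/seteqP; split => // x xD.
  have [[/= ax _] _] := xD 0%N Logic.I.
  have [k axk] := ltr_add_invr ax.
  by have [[_ +] _] := xD k Logic.I; apply; exact: ltW.
rewrite D0 measure0 in Dcvg.
have : nbhs (0%E : \bar R) [set y | (y < e%:E)%E].
  by apply: open_nbhs_nbhs; split; [exact: open_ereal_lt_ereal|rewrite /= lte_fin].
move=> /Dcvg[N _ /(_ N (leqnn N)) DN].
exists (F N), [set x : 'rV[R]_n | a < x 0 i]; split => //; last exact: ltW.
by move=> x; apply: lt_le_trans; rewrite ltrDl.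
Qed.

Lemma measurable_regular A : measurable A -> regular A.
Proof.
have r0 : regular set0.
  move=> e e0; exists set0, set0; split; [exact: closed0|exact: open0|by []|by []|].
  by rewrite set0D set0I measure0 lee_fin ltW.
have sa : sigma_algebra setT regular.
  split => //; last exact: regular_bigcup.
  by move=> B rB; rewrite setTD; exact: regularC.
move=> mA; apply: (smallest_sub sa _ mA).
rewrite -bigcup_seq/= => _ [i _ [Y mY <-]]; rewrite setTI.
suff : [set Y | regular (@rV_coord R n i @^-1` Y)] Y by [].
have {mY} : (@measurable_realfun.RGenOInfty.G R).-sigma.-measurable Y.
  by rewrite -measurable_realfun.RGenOInfty.measurableE.
move: Y; apply: smallest_sub.
  split => [|B rB|B rB] /=; first by rewrite preimage_set0.
    by rewrite setTD preimage_setC; exact: regularC.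
  by rewrite preimage_bigcup; exact: regular_bigcup.
move=> _ [a ->] /=.
rewrite (_ : _ @^-1` _ = [set x : 'rV[R]_n | a < x 0 i]); first exact: regular_halfspace.
by apply/seteqP; split => x /=; rewrite in_itv/= andbT.
Qed.

End regularity.

Section null_sets.
Context {R : realType} {n : nat}.
Local Notation mu := (lebesgue_rV R n).

(** Null sets become a metric notion here, which is what makes their behaviour under
    Lipschitz maps accessible. *)
Lemma negligible_cube_cover (N : set 'rV[R]_n) (e : R) : (0 < n)%N -> 0 < e ->
  mu.-negligible N ->
  exists (c : nat -> 'rV[R]_n) (r : nat -> R),
    [/\ forall k, 0 <= r k, N `<=` \bigcup_k cube (c k) (r k) &
        forall K, \sum_(k < K) r k ^+ n <= e].
Proof.
move=> n0 e0 [A [mA A0 NA]].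
have ek0 k : 0 < e / (2 ^ k.+1)%:R by rewrite divr_gt0// ltr0n expn_gt0.
have [F /choice [G FG]] := choice (fun k => @measurable_regular R n k.+1%:R A mA _ (ek0 k)).
have oQ (k : nat) : open (@cube R n 0 k.+1%:R) by apply: cube_open.
have oG : open (\bigcup_k (G k `&` @cube R n 0 k.+1%:R)).
  apply: bigcup_open => k _; apply: openI => //.
  by have [] := FG k.
have [|c [r [r0 Gcr rs]]] := open_cube_cover (e := e) n0 oG.
  apply: (@le_trans _ _ (\sum_(k <oo) mu (G k `&` @cube R n 0 k.+1%:R)))%E.
    apply: generalized_Boole_inequality => // [k|]; apply: open_measurable_rV => //.
    by apply: openI => //; have [] := FG k.
  apply: (le_trans _ (epsilon_trick0 xpredT (ltW e0))).
  apply: lee_nneseries => // k _; have [cF oGk FA AG FGe] := FG k.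
  apply: le_trans FGe.
  have mF : measurable (F k) by exact: measurable_closed_rV.
  have mQ : measurable (@cube R n 0 k.+1%:R) by exact: measurable_cube.
  have mG : measurable (G k) by exact: open_measurable_rV.
  have F0 : mu (F k) = 0%E.
    apply/eqP; rewrite -measure_le0 -A0; apply: le_measure; rewrite ?inE//.
  rewrite -[leRHS]adde0 -F0.
  apply: le_trans (measureU2 _ _ _) => //; last by apply: measurableI => //; exact: measurableD.
  apply: le_measure; rewrite ?inE.
  - exact: measurableI.
  - by apply: measurableU => //; apply: measurableI => //; exact: measurableD.
  - by move=> x [Gx Qx]; have [Fx|Fx] := pselect (F k x); [right|left].
exists c, r; split => // x Nx; apply: Gcr.
exists (Num.truncn `|x|) => //; split; first by have [_ _ _ AG _] := FG (Num.truncn `|x|); exact/AG/NA.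
by apply/cubeP => //; rewrite subr0 truncnS_gt.
Qed.

Lemma cube_cover_negligible (N : set 'rV[R]_n) : 
  (forall e : R, 0 < e -> exists (c : nat -> 'rV[R]_n) (r : nat -> R),
    [/\ forall k, 0 <= r k, N `<=` \bigcup_k cube (c k) (r k) &
        forall K, \sum_(k < K) r k ^+ n <= e]) ->
  mu.-negligible N.
Proof.
move=> H.
have j0 (j : nat) : (0 : R) < j.+1%:R^-1 by [].
have [c /choice [r cr]] := choice (fun j => H _ (j0 j)).
pose U j := \bigcup_k cube (c j k) (r j k).
have mU j : measurable (U j) by apply: bigcup_measurable => k _; exact: measurable_cube.
have mUj j : (mu (U j) <= (2 ^+ n * j.+1%:R^-1)%:E)%E.
  have [r0 _ rs] := cr j.
  apply: (@le_trans _ _ (\sum_(k <oo) mu (cube (c j k) (r j k))))%E.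
    apply: generalized_Boole_inequality => // [k|]; last exact: mU.
    exact: measurable_cube.
  rewrite (@eq_eseriesr _ _ (fun k => ((2 * r j k) ^+ n)%:E)); last first.
    by move=> k _; rewrite lebesgue_rV_cube.
  apply: lime_le.
    by apply: is_cvg_nneseries => k _ _; rewrite lee_fin exprn_ge0// mulr_ge0.
  apply: nearW => K; rewrite big_mkord sumEFin lee_fin.
  rewrite (eq_bigr (fun k : 'I_K => 2 ^+ n * r j k ^+ n)); last by move=> k _; rewrite exprMn.
  by rewrite -mulr_sumr ler_pM2l ?exprn_gt0// rs.
exists (\bigcap_j U j); split.
- exact: bigcap_measurable.
- apply/eqP; rewrite -measure_le0; apply/lee_addgt0Pr => e e0; rewrite add0e.
  have [j je] : exists j : nat, 2 ^+ n * j.+1%:R^-1 < e.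
    have [j] := @ltr_add_invr R 0 (e / 2 ^+ n) (divr_gt0 e0 (exprn_gt0 _ (ltr0Sn _ _))).
    by rewrite add0r => h; exists j; rewrite mulrC -ltr_pdivlMr ?exprn_gt0.
  apply: (@le_trans _ _ (mu (U j))).
    by apply: le_measure; rewrite ?inE//; [exact: bigcap_measurable|exact: bigcap_inf].
  by apply: le_trans (mUj j) _; rewrite lee_fin ltW.
- by move=> x Nx j _; have [_ + _] := cr j; apply.
Qed.

(** A Lipschitz map sends the part of [N] inside a cube into a cube that is larger by a
    fixed factor. *)
Lemma lipschitz_negligible (N : set 'rV[R]_n) (f : 'rV[R]_n -> 'rV[R]_n) (L : R) :
  (0 < n)%N -> (forall x y, N x -> N y -> `|f x - f y| <= L * `|x - y|) ->
  mu.-negligible N -> mu.-negligible (f @` N).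
Proof.
move=> n0 fL N0; apply: cube_cover_negligible => e e0.
pose M := 2 * `|L| + 1; have M0 : 0 < M by rewrite /M ltr_wpDl// mulr_ge0.
have [|c [r [r0 Ncr rs]]] := negligible_cube_cover (e := e / M ^+ n) n0 _ N0.
  by rewrite divr_gt0// exprn_gt0.
(* [f] is only Lipschitz on [N], so image cubes are centred at images of points of [N]. *)
pose g k := if pselect (exists x, N x /\ cube (c k) (r k) x) is left h then sval (cid h) else 0.
exists (f \o g), (fun k => M * r k); split.
- by move=> k; rewrite mulr_ge0// ltW.
- move=> _ [x Nx <-]; have [k _ kx] := Ncr x Nx; exists k => //=.
  have [Ng kg] : N (g k) /\ cube (c k) (r k) (g k).
    rewrite /g; case: pselect => [h|]; first exact: (svalP (cid h)).
    by case; exists x.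
  have rk0 : 0 < r k.
    by apply: le_lt_trans (kx (Ordinal n0)).
  apply/cubeP; first by rewrite mulr_gt0.
  apply: le_lt_trans (fL _ _ Nx Ng) _.
  move: kx kg => /(cubeP _ _ rk0) kx /(cubeP _ _ rk0) kg.
  have xg : `|x - g k| <= 2 * r k.
    by rewrite -(subrKA (c k)) (le_trans (ler_normD _ _))// [`|c k - _|]distrC; lra.
  apply: (@le_lt_trans _ _ (`|L| * (2 * r k))).
    by rewrite (le_trans (ler_wpM2r (normr_ge0 _) (ler_norm L)))// ler_wpM2l.
  by rewrite /= /M [ltRHS]mulrDl mul1r mulrCA mulrA ltrDl.
- move=> K; rewrite (eq_bigr (fun k : 'I_K => M ^+ n * r k ^+ n)); last by move=> k _; rewrite exprMn.
  by rewrite -mulr_sumr mulrC -ler_pdivlMr ?exprn_gt0// rs.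
Qed.

End null_sets.

(** * Translations and sections *)

Section borel_functions.
Context {R : realType} {n : nat}.

Lemma continuous_measurable_rV (f : 'rV[R]_n -> R) : continuous f ->
  measurable_fun [set: 'rV[R]_n] f.
Proof.
move=> /continuousP cf; apply: (measurability _ (measurable_realfun.RGenOpens.measurableE R)).
move=> _ [_ [a [b ->]] <-]; rewrite setTI.
by apply: open_measurable_rV; apply: cf; exact: interval_open.
Qed.

End borel_functions.

Lemma measurable_translate (R : realType) (n : nat) (v : 'rV[R]_n) :
  measurable_fun [set: 'rV[R]_n] (fun x : 'rV[R]_n => x + v).
Proof.
apply: measurable_fun_rV => i.
rewrite (_ : _ \o _ = fun x : 'rV[R]_n => (rV_coord i x : R) + v 0 i); last first.
  by apply/funext => x; rewrite /rV_coord/= mxE.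
apply: measurable_funD => //; exact: measurable_rV_coord.
Qed.

Lemma lebesgue_measure_translate (R : realType) (a : R) (A : set (measurableTypeR R)) :
  measurable A ->
  lebesgue_measure ((fun x => x + a) @^-1` A) = lebesgue_measure A.
Proof.
move=> mA; have mf : measurable_fun setT (fun x : measurableTypeR R => (x + a : measurableTypeR R)).
  exact: measurable_funD.
apply: esym; apply: (@lebesgue_measure_unique R (pushforward lebesgue_measure (fun x : measurableTypeR R => (x + a : measurableTypeR R)))) => //.
move=> _ [[b c]] _ <-; rewrite /= /pushforward.
rewrite (_ : _ @^-1` _ = `](b - a), (c - a)]%classic); last first.
  by apply/seteqP; split => x /=; rewrite !in_itv/= => /andP[? ?]; apply/andP; split; lra.
rewrite !lebesgue_measure_itv/= !lte_fin.
have -> : (b - a < c - a) = (b < c) by apply/idP/idP; lra.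
by case: ifP => // _; congr (_%:E); ring.
Qed.

Lemma lebesgue_rV_translate (R : realType) (n : nat) (v : 'rV[R]_n) (A : set 'rV[R]_n) :
  measurable A -> lebesgue_rV R n ((fun x => x + v) @^-1` A) = lebesgue_rV R n A.
Proof.
elim: n v A => [v A _|n IH v A mA].
  congr (lebesgue_rV R 0 _); apply/seteqP; split => x /=;
    by rewrite (_ : x + v = x)//; apply/rowP => -[].
rewrite /= /lebesgue_rV_succ /pushforward.
pose v' : 'rV[R]_n := \row_j v 0 (lift ord0 j).
pose S (p : measurableTypeR R * 'rV[R]_n) : measurableTypeR R * 'rV[R]_n := (p.1 + v 0 0, p.2 + v').
have mS : measurable_fun setT S.
  apply/measurable_fun_pairP; split.
    rewrite (_ : _ \o _ = fun p : measurableTypeR R * 'rV[R]_n => (p.1 : R) + v 0 0)//.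
    by apply: (@measurable_funD _ _ R setT (fun p : measurableTypeR R * 'rV[R]_n => p.1 : R) (cst (v 0 0))) => //; exact: measurable_fst.
  rewrite (_ : _ \o _ = (fun x => x + v') \o snd)//.
  by apply: measurableT_comp => //; exact: measurable_translate.
have SE : (@rV_cons R n) @^-1` ((fun x => x + v) @^-1` A) = S @^-1` (@rV_cons R n @^-1` A).
  apply/seteqP; split => p /=; rewrite (_ : rV_cons (S p) = rV_cons p + v)//;
  apply/rowP => i; rewrite [RHS]mxE; case: (unliftP ord0 i) => [j ->|->];
  by rewrite ?rV_cons0 ?rV_consS//= 2!mxE.
have mcA : measurable (@rV_cons R n @^-1` A).
  by rewrite -[X in measurable X]setTI; exact: measurable_rV_cons.
rewrite SE; apply: esym.
pose m0 := @product_measure1 _ _ _ _ R (@lebesgue_measure R) (lebesgue_rV R n).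
apply: (@product_measure_unique _ _ _ _ R (@lebesgue_measure R) (lebesgue_rV R n) (pushforward m0 S)) => //.
move=> B C mB mC.
transitivity (m0 (((fun x => x + v 0 0) @^-1` B) `*` ((fun x => x + v') @^-1` C))) => //.
rewrite /m0 product_measure1E.
- by rewrite IH//; congr (_ * _)%E; exact: lebesgue_measure_translate.
- rewrite -[X in measurable X]setTI; apply: measurable_funD => //.
- by rewrite -[X in measurable X]setTI; exact: measurable_translate.
Qed.

Section sections.
Context {R : realType}.

(** Fubini for null sets, along the first coordinate axis. *)
Lemma null_sections_negligible (n : nat) (A : set 'rV[R]_n.+1) : measurable A ->
  (forall v : 'rV[R]_n, lebesgue_measure [set t : measurableTypeR R | A (rV_cons (t, v))] = 0%E) ->
  (lebesgue_rV R n.+1).-negligible A.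
Proof.
move=> mA A0; apply/negligibleP => //=; rewrite /lebesgue_rV_succ /pushforward.
set B := _ @^-1` _.
have mB : measurable B by rewrite -[X in measurable X]setTI; exact: measurable_rV_cons.
pose m2 := @product_measure2 _ _ _ _ R (@lebesgue_measure R) (lebesgue_rV R n).
transitivity (m2 B).
  apply: product_measure_unique => // ? ? ? ?; exact: product_measure2E.
rewrite /m2 /product_measure2; apply: integral0_eq => v _ /=.
rewrite -[RHS](A0 v); congr (lebesgue_measure _).
by apply/seteqP; split => t /=; rewrite /ysection/= inE.
Qed.

Lemma negligible_addrow (m n : nat) (N : set 'rV[R]_n) :
  (lebesgue_rV R n).-negligible N ->
  (lebesgue_rV R (m + n)).-negligible [set x | N (@rsubmx R 1 m n x)].
Proof.
move=> [A [mA A0 NA]].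
suff [mB B0] : measurable [set x | A (@rsubmx R 1 m n x)] /\
    lebesgue_rV R (m + n) [set x | A (@rsubmx R 1 m n x)] = 0%E.
  by exists [set x | A (@rsubmx R 1 m n x)]; split => // x; exact: NA.
elim: m => [|m [mB B0]].
  have E : [set x | A (@rsubmx R 1 0 n x)] = A.
    apply/seteqP; split => x /=; rewrite (_ : @rsubmx R 1 0 n x = x)//;
    by apply/rowP => i; rewrite mxE; congr (x 0 _); exact: val_inj.
  by rewrite E; split.
set B := [set x | A (@rsubmx R 1 m n x)] in mB B0 *.
set B' := [set x | _].
have E : @rV_cons R (m + n) @^-1` B' = setT `*` B.
  apply/seteqP; split => [[t x]|[t x] [_]]; rewrite /B' /B /=.
    move=> h; split => //; move: h; congr A; apply/rowP => i; rewrite [LHS]mxE [RHS]mxE.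
    by rewrite -(rV_consS (t, x)); congr (rV_cons _ 0 _); exact: val_inj.
  congr A; apply/rowP => i; rewrite [LHS]mxE [RHS]mxE.
  by rewrite -(rV_consS (t, x)); congr (rV_cons _ 0 _); exact: val_inj.
have mB' : measurable B'.
  rewrite (_ : B' = @rV_uncons R (m + n) @^-1` (setT `*` B)).
    rewrite -[X in measurable X]setTI; apply: measurable_rV_uncons => //.
    exact: measurableX.
  rewrite -E; apply/seteqP; split => x /=; rewrite (_ : rV_cons (rV_uncons x) = x)//;
  apply/rowP => i; case: (unliftP ord0 i) => [j ->|->];
  rewrite ?rV_cons0 ?rV_consS//= mxE; congr (x 0 _); exact: val_inj.
split => //.
rewrite [LHS]/= /lebesgue_rV_succ /pushforward E product_measure1E//.
have -> : lebesgue_rV R (m + n) B = 0%E by [].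
by rewrite mule0.
Qed.

End sections.

(** This is how exceptional null sets are avoided at the end: a null set cannot be mapped
    by a Lipschitz map onto a cube. *)
Lemma cube_nonnegligible (R : realType) (n : nat) (c : 'rV[R]_n) (r : R) : 0 < r ->
  ~ (lebesgue_rV R n).-negligible (cube c r).
Proof.
move=> r0 /(measure_negligible (measurable_cube _ _)) m0.
have := lebesgue_rV_cube c (ltW r0); rewrite [X in X = _]m0 => -[] /eqP.
by rewrite eq_sym expf_eq0 mulf_eq0 pnatr_eq0/= gt_eqF// andbF.
Qed.

Lemma lebesgue_rVT_gt0 (R : realType) (n : nat) : (0 < lebesgue_rV R n setT)%E.
Proof.
apply: (@lt_le_trans _ _ (lebesgue_rV R n (cube 0 1))).
  by rewrite lebesgue_rV_cube// lte_fin exprn_gt0// mulr_gt0.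
by apply: le_measure; rewrite ?inE//; exact: measurable_cube.
Qed.

(** * Differentiability of Lipschitz functions of one variable *)

Section lipschitz_derivable.
Context {R : realType}.
Variables (h : R -> R) (L : R).
Hypothesis hL : forall x y, `|h x - h y| <= L * `|x - y|.

Let L0 : 0 <= L.
Proof.
by have := hL 1 0; rewrite subr0 normr1 mulr1; apply: le_trans.
Qed.

Let up (x : R) := L * x + h x.
Let dn (x : R) := L * x - h x.
Let tw (x : R) := 2 * L * x.

Let nondecreasing_lip (s : R) : `|s| <= 1 ->
  {homo (fun x => L * x + s * h x) : x y / x <= y}.
Proof.
move=> s1 x y xy; have := hL x y; rewrite (distrC x y) (@ger0_norm _ (y - x)) ?subr_ge0// => hxy.
have : `|s * (h x - h y)| <= L * (y - x).
  by rewrite normrM -[leRHS]mul1r ler_pM.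
by rewrite ler_norml => /andP[_]; lra.
Qed.

Let continuous_h : continuous h.
Proof. exact: (@lipschitz_continuous R R h L hL). Qed.

Let continuous_lip (s : R) : continuous (fun x => L * x + s * h x).
Proof.
move=> x; apply: cvgD; first by apply: cvgM; [exact: cvg_cst|exact: cvg_id].
by apply: cvgM; [exact: cvg_cst|exact: continuous_h].
Qed.

Let right_cont (f : R -> R) : continuous f -> right_continuous f.
Proof. by move=> cf x; apply: cvg_at_right_filter; exact: cf. Qed.

Let upE : up = (fun x => L * x + 1 * h x). Proof. by apply/funext => x; rewrite mul1r. Qed.
Let dnE : dn = (fun x => L * x + (-1) * h x). Proof. by apply/funext => x; rewrite mulN1r. Qed.
Let twE : tw = (fun x => (L * x + 0 * h x) + (L * x + 0 * h x)).
Proof. by apply/funext => x; rewrite /tw mul0r addr0; ring. Qed.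

Let up_nd : {homo up : x y / x <= y}.
Proof. by rewrite upE; apply: nondecreasing_lip; rewrite normr1. Qed.
Let dn_nd : {homo dn : x y / x <= y}.
Proof. by rewrite dnE; apply: nondecreasing_lip; rewrite normrN1. Qed.
Let tw_nd : {homo tw : x y / x <= y}.
Proof. by move=> x y xy; rewrite /tw ler_wpM2l// mulr_ge0. Qed.
Let up_c : continuous up. Proof. by rewrite upE; exact: continuous_lip. Qed.
Let dn_c : continuous dn. Proof. by rewrite dnE; exact: continuous_lip. Qed.
Let tw_c : continuous tw.
Proof. by rewrite twE => x; apply: cvgD; exact: continuous_lip. Qed.

HB.instance Definition _ := isCumulative.Build R _ R up up_nd (right_cont up_c).
HB.instance Definition _ := isCumulative.Build R _ R dn dn_nd (right_cont dn_c).
HB.instance Definition _ := isCumulative.Build R _ R tw tw_nd (right_cont tw_c).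

Let muU := lebesgue_stieltjes_measure up.
Let muD := lebesgue_stieltjes_measure dn.

Let LSE (f : cumulative R R) (a b : R) : a <= b ->
  lebesgue_stieltjes_measure f (`]a, b]%classic : set R) = (f b - f a)%:E.
Proof.
move=> ab; rewrite /lebesgue_stieltjes_measure /measure_extension.
by rewrite measurable_mu_extE/=; [rewrite wlength_itv_bnd|exists (a, b)].
Qed.

Let LS0 (f : cumulative R R) (a b : R) : b < a ->
  lebesgue_stieltjes_measure f (`]a, b]%classic : set R) = 0%E.
Proof.
by move=> ab; rewrite set_itv_ge ?measure0// bnd_simp -leNgt ltW.
Qed.

Let muUD (A : set (measurableTypeR R)) : measurable A ->
  (muU A + muD A = (2 * L)%:E * lebesgue_measure A)%E.
Proof.
move=> mA.
have L20 : 0 <= 2 * L by rewrite mulr_ge0.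
transitivity (lebesgue_stieltjes_measure tw A).
  rewrite -measure_addE; apply: esym.
  apply: (@lebesgue_stieltjes_measure_unique R tw (measure_add muU muD)) => // _ [[a b] _ <-].
  transitivity (measure_add muU muD (`]a, b]%classic : set R)) => //.
  rewrite measure_addE; have [ab|ba] := leP a b.
    transitivity ((up b - up a)%:E + (dn b - dn a)%:E)%E; last first.
      by congr (_ + _)%E; apply: esym; exact: LSE.
    by rewrite (LSE tw ab) -EFinD; congr (_%:E); rewrite /= /tw /up /dn; ring.
  transitivity (0 + 0 : \bar R)%E; last first.
    by congr (_ + _)%E; apply: esym; exact: LS0.
  by rewrite (LS0 tw ba) adde0.
apply: (@lebesgue_stieltjes_measure_unique R tw (mscale (NngNum L20) (@lebesgue_measure R))) => // _ [[a b] _ <-] /=.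
rewrite /mscale/=; have [ab|ba] := leP a b.
  rewrite (LSE tw ab)/= lebesgue_measure_itv/= lte_fin.
  case: ifPn => [_|]; first by rewrite -EFinB -EFinM /tw; congr (_%:E); ring.
  rewrite -leNgt => ba; have -> : a = b by apply: le_anti; rewrite ab ba.
  by rewrite subrr mule0.
by rewrite (LS0 tw ba) lebesgue_measure_itv/= lte_fin ltNge (ltW ba)/= mule0.
Qed.

(** [L x + h x] and [L x - h x] are nondecreasing with sum [2 L x], so the Stieltjes
    measure of the former is dominated by a multiple of Lebesgue measure; its
    Radon-Nikodym density is the derivative by the fundamental theorem of calculus. *)
Lemma lipschitz_ae_derivable :
  (@lebesgue_measure R).-negligible [set x : measurableTypeR R | ~ derivable h x 1].
Proof.
suff H : forall k : nat, (@lebesgue_measure R).-negligible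
    [set x : measurableTypeR R | `|x : R| < k%:R /\ ~ derivable h x 1].
  apply: (negligibleS _ (negligible_bigcup H)) => x nx.
  by exists (Num.truncn `|x : R|).+1 => //; split => //; exact: truncnS_gt.
move=> k; have [k0|k0] := leqP k 0.
  apply: (negligibleS _ (negligible_set0 _)) => x [].
  by move: k0; rewrite leqn0 => /eqP ->; rewrite ltNge normr_ge0.
pose K : R := k%:R; have K0 : 0 < K by rewrite ltr0n.
pose I : set (measurableTypeR R) := `]- K, K]%classic.
have mI : measurable I by exact: measurable_itv.
have KK : - K <= K by lra.
have fI : (muU I < +oo)%E by rewrite /muU (LSE up KK) ltry.
pose nu := mfrestr mI fI.
have nu_dom : nu `<< (@lebesgue_measure R).
  apply/null_content_dominatesP => A mA A0.
  have mAI : measurable (A `&` I) by exact: measurableI.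
  have AI0 : lebesgue_measure (A `&` I) = 0%E.
    apply/eqP; rewrite -measure_le0 -[leRHS]A0.
    by apply: le_measure; rewrite ?inE//; exact: subIsetl.
  rewrite /nu /mfrestr /mrestr; apply/eqP; rewrite -measure_le0.
  have := muUD mAI; rewrite AI0 mule0 => <-.
  by rewrite leeDl// measure_ge0.
have [f [f0 ffin intf nuE]] := radon_nikodym_sigma_finite nu_dom.
pose g := fine \o f.
have gE : EFin \o g = f by apply/funext => x; rewrite /g /= fineK.
have intg : (@lebesgue_measure R).-integrable setT (EFin \o g) by rewrite gE.
have locg : locally_integrable setT g by apply: open_integrable_locally => //; exact: openT.
have [|A [mA A0 NA]] := FTC1Ny _ locg.
  by move=> y; apply: integrableS intg => //; exact: measurable_itv.
exists A; split => // x [xk nd]; apply: NA => /= -[dF _]; apply: nd.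
pose F (x : R) := (\int[lebesgue_measure]_(t in `]-oo, x]) g t)%R.
have xI : x \in `](- K), K[ by rewrite in_itv/= -ltr_norml.
have FE (y : R) : y \in `](- K), K[ -> F y = up y - up (- K).
  rewrite in_itv/= => /andP[y1 y2].
  rewrite /F /Rintegral; have -> : (fun x => (g x)%:E) = f by rewrite -gE.
  rewrite -nuE; last exact: measurable_itv.
  transitivity (fine (muU (`]-oo, y] `&` `]- K, K]))) => //.
  rewrite (_ : _ `&` _ = `]- K, y]%classic).
    by rewrite /muU (LSE up (ltW y1)).
  apply/seteqP; split => z /=; rewrite !in_itv/=; last first.
    by move=> /andP[z1 z2]; split => //; rewrite z1/= (le_trans z2)// ltW.
  by move=> [-> /andP[-> _]].
have dF' : derivable F x 1 by exact: dF.
have hE : {near (x : R), (fun y => F y + up (- K) - L * y) =1 h}.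
  have : \forall y \near (x : R), y \in `](- K), K[ by exact: near_in_itvoo.
  by apply: filterS => y /FE ->; rewrite /up; ring.
apply: (near_eq_derivable hE); apply: derivableB.
  by apply: derivableD; [exact: dF'|exact: derivable_cst].
by apply: derivableM; [exact: derivable_cst|exact: derivable_id].
Qed.

End lipschitz_derivable.

(** * Directional derivatives of Lipschitz functions *)

Section countable_unions.
Context {R : realType} {n : nat}.
Local Notation mu := (lebesgue_rV R n).

Lemma negligible_countable_bigcup (T : countType) (F : T -> set 'rV[R]_n) :
  (forall t, mu.-negligible (F t)) -> mu.-negligible (\bigcup_t F t).
Proof.
move=> F0; pose G (k : nat) := oapp F set0 (@pickle_inv T k).
apply: (@negligibleS _ _ _ _ (\bigcup_k G k)).
  by move=> x [t _ Ftx]; exists (pickle t) => //; rewrite /G pickleK_inv.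
apply: negligible_bigcup => k; rewrite /G; case: pickle_inv => [t|]//=.
exact: negligible_set0.
Qed.

Lemma negligibleU_rV (A B : set 'rV[R]_n) :
  mu.-negligible A -> mu.-negligible B -> mu.-negligible (A `|` B).
Proof. exact: negligibleU. Qed.

End countable_unions.

Section lines.
Context {R : realType} {m : nat}.
Local Notation n := m.+1.
Local Notation mu := (lebesgue_rV R n).
Variables (v : 'rV[R]_n) (i : 'I_n).
Hypothesis vi0 : v 0 i != 0.

(** A linear automorphism taking the first coordinate axis to the direction [v]. *)
Let T (y : 'rV[R]_n) : 'rV[R]_n :=
  y 0 0 *: v + \row_k (if unlift i k is Some j then y 0 (lift ord0 j) else 0).

Let TE y k : T y 0 k = y 0 0 * v 0 k + (if unlift i k is Some j then y 0 (lift ord0 j) else 0).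
Proof. by rewrite /T !mxE. Qed.

Let T_lip x y : `|T x - T y| <= (`|v| + 1) * `|x - y|.
Proof.
apply: norm_rV_le; first by rewrite mulr_ge0// addr_ge0.
move=> k; have -> : (T x - T y) 0 k = (x 0 0 - y 0 0) * v 0 k +
    (if unlift i k is Some j then x 0 (lift ord0 j) - y 0 (lift ord0 j) else 0).
  rewrite mxE [(- _ : 'rV_n) _ _]mxE !TE; case: unlift => [j|]; ring.
apply: (le_trans (ler_normD _ _)); rewrite [leRHS]mulrDl mul1r; apply: lerD.
  rewrite normrM mulrC; apply: ler_pM => //; first exact: coord_le_norm.
  by have := coord_le_norm (x - y) 0; rewrite !mxE.
case: unlift => [j|]; last by rewrite normr0.
by have := coord_le_norm (x - y) (lift ord0 j); rewrite !mxE.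
Qed.

Let T_surj x : exists y, T y = x.
Proof.
pose y0 := x 0 i / v 0 i.
exists (\row_k (if unlift ord0 k is Some j then x 0 (lift i j) - y0 * v 0 (lift i j) else y0)).
apply/rowP => k; rewrite TE; rewrite !mxE unlift_none.
case: (unliftP i k) => [j ->|->].
  by rewrite mxE liftK; ring.
by rewrite addr0 /y0 divfK.
Qed.

Let T_line (t : R) (w : 'rV[R]_m) : T (rV_cons (t, w)) = T (rV_cons (0, w)) + t *: v.
Proof.
apply/rowP => k; rewrite [RHS]mxE [X in _ = _ + X]mxE !TE !rV_cons0/=.
rewrite mul0r add0r addrC; congr (_ + _).
by case: unlift => // j; rewrite !rV_consS.
Qed.

Let T_cont k : continuous (fun y : 'rV[R]_n => T y 0 k).
Proof.
apply: (@lipschitz_continuous R _ _ (`|v| + 1)) => x y; apply: le_trans (T_lip x y).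
by have := coord_le_norm (T x - T y) k; rewrite mxE [(- _ : 'rV_n) _ _]mxE.
Qed.

Lemma null_lines_negligible_coord (A : set 'rV[R]_n) : measurable A ->
  (forall x, (@lebesgue_measure R).-negligible [set t : measurableTypeR R | A (x + (t : R) *: v)]) ->
  mu.-negligible A.
Proof.
move=> mA A0.
have mT : measurable_fun setT T.
  by apply: measurable_fun_rV => k; exact: (continuous_measurable_rV (@T_cont k)).
have mTA : measurable (T @^-1` A).
  by rewrite -[X in measurable X]setTI; exact: mT.
suff TA0 : mu.-negligible (T @^-1` A).
  apply: (negligibleS _ (@lipschitz_negligible R n (T @^-1` A) T _ isT _ TA0)).
    by move=> x Ax; have [y Ty] := T_surj x; exists y => //=; rewrite Ty.
  by move=> x y _ _; exact: T_lip.
apply: null_sections_negligible => // w.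
have E : [set t : measurableTypeR R | (T @^-1` A) (rV_cons (t, w))] =
    [set t : measurableTypeR R | A (T (rV_cons (0, w)) + (t : R) *: v)].
  by apply/seteqP; split => t /=; rewrite (T_line t w).
apply: measure_negligible; last by rewrite E; exact: A0.
have mB : measurable ((@rV_cons R m) @^-1` (T @^-1` A)).
  by rewrite -[X in measurable X]setTI; exact: measurable_rV_cons.
have := measurable_ysection w mB; rewrite /ysection.
by congr measurable; apply/seteqP; split => t /=; rewrite inE.
Qed.

End lines.

(** Fubini for null sets in an arbitrary direction. *)
Lemma null_lines_negligible (R : realType) (n : nat) (v : 'rV[R]_n) (A : set 'rV[R]_n) :
  v != 0 -> measurable A ->
  (forall x, (@lebesgue_measure R).-negligible [set t : measurableTypeR R | A (x + (t : R) *: v)]) ->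
  (lebesgue_rV R n).-negligible A.
Proof.
case: n v A => [v A|m v A v0]; first by rewrite (_ : v = 0) ?eqxx//; apply/rowP => -[].
have [i vi] : exists i, v 0 i != 0.
  apply: contra_notP (elimN eqP v0) => /forallNP h; apply/rowP => i; rewrite mxE.
  by apply/eqP; apply: contra_notT (h i).
exact: null_lines_negligible_coord vi _.
Qed.

Section directional.
Context {R : realType} {n : nat}.
Implicit Types (f : 'rV[R]_n -> R) (x v : 'rV[R]_n).

(** The condition is free of quotients, so that for fixed increments it is closed in [x]
    and yields Borel sets. *)
Definition ddir f x v d := forall e : R, 0 < e -> exists2 r : R, 0 < r &
  forall s : R, `|s| < r -> `|f (x + s *: v) - f x - d * s| <= e * `|s|.

(** A division free Cauchy criterion for the existence of a directional
    derivative; its inner part is a closed condition on [x]. *)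
Definition dquot f v (j m : nat) : set 'rV[R]_n :=
  [set x | forall s t : R, `|s| < m.+1%:R^-1 -> `|t| < m.+1%:R^-1 ->
     `|t * (f (x + s *: v) - f x) - s * (f (x + t *: v) - f x)| <= `|s| * `|t| / j.+1%:R].

Lemma ddir_dquot f x v d : ddir f x v d -> forall j, exists m, dquot f v j m x.
Proof.
move=> fd j; have e0 : (0 : R) < (2 * j.+1%:R)^-1 by rewrite invr_gt0 mulr_gt0.
have [r r0 fr] := fd _ e0.
have [m mr] := ltr_add_invr r0; rewrite add0r in mr.
exists m => s t sm tm.
have hs := fr s (lt_trans sm mr); have ht := fr t (lt_trans tm mr).
have -> : t * (f (x + s *: v) - f x) - s * (f (x + t *: v) - f x) =
  t * (f (x + s *: v) - f x - d * s) - s * (f (x + t *: v) - f x - d * t) by ring.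
apply: (le_trans (ler_normB _ _)); rewrite !normrM.
have -> : `|s| * `|t| / j.+1%:R = `|t| * ((2 * j.+1%:R)^-1 * `|s|) + `|s| * ((2 * j.+1%:R)^-1 * `|t|).
  by field.
by apply: lerD; apply: ler_wpM2l.
Qed.

(** Along the steps [1 / (k + 1)] the difference quotients form a Cauchy sequence, and
    [dquot] compares every other step with these. *)
Lemma dquot_ddir f x v : (forall j, exists m, dquot f v j m x) -> exists d, ddir f x v d.
Proof.
move=> /choice[M HM].
pose a (k : nat) : R := k.+1%:R^-1.
have a0 k : 0 < a k by rewrite invr_gt0.
have a_lt k m : (m < k)%N -> `|a k| < m.+1%:R^-1.
  by move=> mk; rewrite gtr0_norm// ltf_pV2 ?posrE// ltr_nat.
pose q k := (f (x + a k *: v) - f x) / a k.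
have a_small e : 0 < e -> exists j, a j < e.
  by move=> e0; have [j] := ltr_add_invr e0; rewrite add0r; exists j.
have qs j k s : (M j < k)%N -> `|s| < a (M j) ->
    `|f (x + s *: v) - f x - q k * s| <= a j * `|s|.
  move=> jk sM; have := HM j s (a k) sM (a_lt _ _ jk).
  have -> : a k * (f (x + s *: v) - f x) - s * (f (x + a k *: v) - f x) =
     a k * (f (x + s *: v) - f x - q k * s).
    by rewrite /q; field; rewrite gt_eqF.
  rewrite normrM (gtr0_norm (a0 k)).
  by rewrite (_ : _ * a k / _ = a k * (a j * `|s|)) ?ler_pM2l// /a; ring.
have qq j i k : (M j < i)%N -> (M j < k)%N -> `|q i - q k| <= a j.
  move=> ji jk; have := qs j k (a i) jk (a_lt _ _ ji).
  have -> : f (x + a i *: v) - f x - q k * a i = a i * (q i - q k).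
    by rewrite /q; field; rewrite gt_eqF ?gt_eqF.
  by rewrite normrM [a j * _]mulrC ler_pM2l// gtr0_norm.
clearbody q; move: qs qq a_small; clear HM a_lt; clearbody a => qs qq a_small.
pose S : set R := [set y : R | exists k, forall i, (k < i)%N -> y <= q i].
have Slow j k : (M j < k)%N -> S (q k - a j).
  move=> jk; exists (M j) => i ji; have := qq j i k ji jk.
  by rewrite ler_norml => /andP[+ _]; lra.
have Sup j k : (M j < k)%N -> ubound S (q k + a j).
  move=> jk y [k' yk']; pose i := (maxn k' (M j)).+1.
  have yi : y <= q i by apply: yk'; rewrite ltnS leq_maxl.
  have := qq j i k; rewrite ltnS leq_maxr => /(_ isT jk).
  by rewrite ler_norml => /andP[_]; lra.
have hS : has_sup S.
  split; first by exists (q (M 0%N).+1 - a 0%N); exact: Slow.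
  by exists (q (M 0%N).+1 + a 0%N); exact: Sup.
pose d := sup S.
have dq j k : (M j < k)%N -> `|q k - d| <= a j.
  move=> jk; rewrite ler_norml; apply/andP; split.
    by have := ge_sup hS.1 (Sup j k jk); rewrite -/d; lra.
  by have := ub_le_sup hS.2 (Slow j k jk); rewrite -/d; lra.
exists d => e e0; have [j je] := a_small _ (divr_gt0 e0 (ltr0Sn R 1)).
exists (a (M j)); first exact: a0.
move=> s sM; have h1 := qs j (M j).+1 s (ltnSn _) sM; have h2 := dq j (M j).+1 (ltnSn _).
have -> : f (x + s *: v) - f x - d * s = (f (x + s *: v) - f x - q (M j).+1 * s) + (q (M j).+1 - d) * s.
  by ring.
apply: (le_trans (ler_normD _ _)); rewrite normrM.
have : `|q (M j).+1 - d| * `|s| <= a j * `|s| by rewrite ler_wpM2r.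
have s0 := normr_ge0 s; have : a j * `|s| <= e / 2 * `|s| by rewrite ler_wpM2r// ltW.
lra.
Qed.

Lemma ddir_unique f x v c d : ddir f x v c -> ddir f x v d -> c = d.
Proof.
move=> fc fd; apply/eqP; rewrite -subr_eq0; apply/negPn/negP => cd0.
have e0 : 0 < `|c - d| / 4 by rewrite divr_gt0// normr_gt0.
have [r r0 hr] := fc _ e0; have [r' r'0 hr'] := fd _ e0.
pose s := Num.min r r' / 2.
have s0 : 0 < s by rewrite divr_gt0// lt_min r0.
have sr : `|s| < Num.min r r' by rewrite gtr0_norm// /s ltr_pdivrMr// ltr_pMr ?ltr1n// lt_min r0.
have := hr s; rewrite (lt_le_trans sr) ?ge_min ?lexx// => /(_ isT) h1.
have := hr' s; rewrite (lt_le_trans sr) ?ge_min ?lexx ?orbT// => /(_ isT) h2.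
have : `|(c - d) * s| <= `|c - d| / 4 * `|s| + `|c - d| / 4 * `|s|.
  have -> : (c - d) * s = (f (x + s *: v) - f x - d * s) - (f (x + s *: v) - f x - c * s) by ring.
  by apply: (le_trans (ler_normB _ _)); exact: lerD.
rewrite normrM (gtr0_norm s0); have : 0 < `|c - d| * s by rewrite mulr_gt0// normr_gt0.
lra.
Qed.

End directional.

Section rademacher.
Context {R : realType} {n : nat}.
Local Notation mu := (lebesgue_rV R n).
Variables (f : 'rV[R]_n -> R) (L : R).
Hypothesis fL : forall x y, `|f x - f y| <= L * `|x - y|.
Implicit Types (u v x : 'rV[R]_n).

Let f_cont (s : R) (v : 'rV[R]_n) : continuous (fun x : 'rV[R]_n => f (x + s *: v)).
Proof.
apply: (@lipschitz_continuous R _ _ L) => x y.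
by apply: le_trans (fL _ _) _; rewrite opprD addrACA subrr addr0.
Qed.

Let f_cont0 : continuous f.
Proof. exact: (@lipschitz_continuous R _ _ L). Qed.

Lemma derivable_line_ddir (x v : 'rV[R]_n) (t : R) :
  derivable (fun s : R => f (x + s *: v)) t 1 -> exists d, ddir f (x + t *: v) v d.
Proof.
move=> /cvg_ex[/= l]; move=> /cvgrPdist_le hl; exists l => e e0.
have := hl e e0; rewrite /dnbhs /within /= => /nbhs_normP[r /= r0 hr].
exists r => // s sr; have [->|s0] := eqVneq s 0.
  by rewrite scale0r addr0 subrr mulr0 subr0 !normr0 mulr0.
have := hr s; rewrite /= sub0r normrN sr => /(_ isT s0).
rewrite /shift /= -[s *: 1]/(s * 1) mulr1 => h.
have -> : f (x + t *: v + s *: v) - f (x + t *: v) - l * s =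
   - s * (l - s^-1 * (f (x + (s + t) *: v) - f (x + t *: v))).
  by rewrite scalerDl [s *: v + _]addrC addrA; field.
by rewrite normrM normrN mulrC ler_wpM2r.
Qed.

Lemma measurable_dquot v j m : measurable (dquot f v j m).
Proof.
rewrite (_ : dquot f v j m = \bigcap_(p in [set p : R * R | `|p.1| < m.+1%:R^-1 /\ `|p.2| < m.+1%:R^-1])
   [set x | `|p.2 * (f (x + p.1 *: v) - f x) - p.1 * (f (x + p.2 *: v) - f x)| <= `|p.1| * `|p.2| / j.+1%:R]).
  apply: measurable_closed_rV; apply: closed_bigI => -[s t] _ /=.
  apply: closed_norm_le => x.
  have cq r : {for x, continuous (fun x : 'rV[R]_n => f (x + r *: v) - f x)}.
    exact: continuousB (@f_cont r v x) (@f_cont0 x).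
  exact: continuousB (continuousM (cvg_cst t) (cq s)) (continuousM (cvg_cst s) (cq t)).
apply/seteqP; split => x /=.
  by move=> h [s t] /= [sm tm]; exact: h.
by move=> h s t sm tm; exact: (h (s, t)).
Qed.

(** The set of points without derivative is Borel, and on each line of direction [v] it is
    null by the one-dimensional case. *)
Lemma ddir_ae v : v != 0 -> mu.-negligible [set x | ~ exists d, ddir f x v d].
Proof.
move=> v0.
pose D := \bigcap_j \bigcup_m dquot f v j m.
have mD : measurable D.
  by apply: bigcap_measurable => // j _; apply: bigcup_measurable => m _; exact: measurable_dquot.
apply: (@negligibleS _ _ _ _ (~` D)).
  move=> x /= nx Dx; apply: nx; apply: dquot_ddir => j.
  by have [m _ xm] := Dx j Logic.I; exists m.
apply: (null_lines_negligible v0); first exact: measurableC.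
move=> x.
have hL : forall s t : R, `|f (x + s *: v) - f (x + t *: v)| <= (L * `|v|) * `|s - t|.
  move=> s t; apply: le_trans (fL _ _) _.
  rewrite opprD addrACA subrr add0r -scalerBl norm_rVZ.
  have -> : L * (`|s - t| * `|v|) = L * `|v| * `|s - t| by ring.
  exact: lexx.
apply: negligibleS (lipschitz_ae_derivable hL) => t /= nD dt; apply: nD => j _.
have [d fd] := derivable_line_ddir dt.
by have [m fm] := ddir_dquot fd j; exists m.
Qed.

(** Countably many of these Borel sets cover the points at which the directional
    derivatives fail to be additive. *)
Definition dlin (u v : 'rV[R]_n) (y z w e r : R) : set 'rV[R]_n :=
  [set x | forall s : R, `|s| < r ->
    [/\ `|f (x + s *: u) - f x - y * s| <= e * `|s|,
        `|f (x + s *: v) - f x - z * s| <= e * `|s| &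
        `|f (x + s *: (u + v)) - f x - w * s| <= e * `|s|]].

Lemma measurable_dlin u v y z w e r : measurable (dlin u v y z w e r).
Proof.
have cl (a : 'rV[R]_n) (c s : R) : closed [set x | `|f (x + s *: a) - f x - c * s| <= e * `|s|].
  apply: closed_norm_le => x.
  have h : {for x, continuous (fun x : 'rV[R]_n => f (x + s *: a) - f x)}.
    exact: continuousB (@f_cont s a x) (@f_cont0 x).
  exact: (continuousB h (@cst_continuous _ _ (c * s) x)).
rewrite (_ : dlin u v y z w e r = \bigcap_(s in [set s : R | `|s| < r])
   ([set x | `|f (x + s *: u) - f x - y * s| <= e * `|s|] `&`
   [set x | `|f (x + s *: v) - f x - z * s| <= e * `|s|] `&`
   [set x | `|f (x + s *: (u + v)) - f x - w * s| <= e * `|s|])).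
  by apply: measurable_closed_rV; apply: closed_bigI => s _; do 2 apply: closedI => //.
apply/seteqP; split => x /=.
  by move=> h s sr; have [] := h s sr.
by move=> h s sr; have [[]] := h s sr.
Qed.

(** Two points of [dlin] on a line of direction [u] cannot be close to each
    other: going from [x] to [x + s *: u] and then by [s *: v] compares [w]
    with [y + z]. *)
Lemma dlin_negligible u v y z w e r : u != 0 -> 0 < r -> 3 * e < `|w - y - z| ->
  mu.-negligible (dlin u v y z w e r).
Proof.
move=> u0 r0 eyz; apply: (null_lines_negligible u0); first exact: measurable_dlin.
move=> x; set S := [set t | _].
suff cS : countable S.
  apply/negligibleP; last exact: countable_lebesgue_measure0.
  by apply: countable_measurable cS => t; exact: measurable_set1.
have sep (s t : R) : S s -> S t -> `|t - s| < r -> s = t.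
  rewrite /S /= => Ss St str; apply/eqP; apply: contraTT eyz => st.
  rewrite -leNgt; have ts0 : 0 < `|t - s| by rewrite normr_gt0 subr_eq0 eq_sym.
  have [h1 _ h3] := Ss (t - s) str; have [_ h2 _] := St (t - s) str.
  have E1 : x + s *: u + (t - s) *: u = x + t *: u by rewrite -addrA -scalerDl; congr (x + _ *: u); ring.
  have E2 : x + s *: u + (t - s) *: (u + v) = x + t *: u + (t - s) *: v.
    by rewrite scalerDr addrA E1.
  rewrite E1 in h1; rewrite E2 in h3.
  rewrite -(ler_pM2r ts0) -normrM.
  set A := f (x + t *: u + (t - s) *: v) in h2 h3.
  set B := f (x + t *: u) in h1 h2; set C := f (x + s *: u) in h1 h3.
  have -> : (w - y - z) * (t - s) =
    (B - C - y * (t - s)) + (A - B - z * (t - s)) - (A - C - w * (t - s)) by ring.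
  apply: (le_trans (ler_normB _ _)); apply: le_trans (lerD (ler_normD _ _) (lexx _)) _.
  lra.
apply/countable_injP.
pose g (t : R) : nat := pickle (Num.floor (t / r)).
exists g => s t /set_mem Ss /set_mem St /(pcan_inj pickleK) gst.
apply: sep => //.
have /andP[s1 s2] := floor_itv (s / r); have /andP[t1 t2] := floor_itv (t / r).
rewrite gst in s1 s2; rewrite -(ltr_pM2r (_ : 0 < r^-1)) ?invr_gt0// divff ?gt_eqF//.
rewrite -[X in _ * X < _]gtr0_norm ?invr_gt0// -normrM mulrBl ltr_norml.
rewrite intrD in s2 t2; apply/andP; split; lra.
Qed.

(** Countably many rational approximations of the three derivatives and scales reduce a
    failure of additivity to the sets [dlin]. *)
Lemma ddirD_ae u v : u != 0 ->
  mu.-negligible [set x | exists a b c,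
    [/\ ddir f x u a, ddir f x v b, ddir f x (u + v) c & c <> a + b]].
Proof.
move=> u0.
pose F (p : (rat * rat * rat) * (nat * nat)) : set 'rV[R]_n :=
  let e : R := p.2.1.+1%:R^-1 in
  if `[< 3 * e < `|ratr p.1.2 - ratr p.1.1.1 - ratr p.1.1.2| >] then
    dlin u v (ratr p.1.1.1) (ratr p.1.1.2) (ratr p.1.2) e p.2.2.+1%:R^-1 else set0.
apply: (@negligibleS _ _ _ _ (\bigcup_p F p)); last first.
  apply: negligible_countable_bigcup => p; rewrite /F; case: asboolP => h.
    by apply: dlin_negligible => //; rewrite invr_gt0.
  exact: negligible_set0.
move=> x [a [b [c [fa fb fc cab]]]].
have gap : 0 < `|c - a - b|.
  by rewrite normr_gt0; apply/eqP => h; apply: cab; apply/eqP; rewrite -subr_eq0 opprD addrA h.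
have [k ke] := ltr_add_invr (divr_gt0 gap (ltr0Sn R 5)); rewrite add0r in ke.
pose e : R := k.+1%:R^-1; have e0 : 0 < e by rewrite invr_gt0.
have approx (d : R) (w : 'rV[R]_n) : ddir f x w d -> exists (q : rat) (m : nat),
    `|ratr q - d| < e / 2 /\ forall s : R, `|s| < m.+1%:R^-1 -> `|f (x + s *: w) - f x - ratr q * s| <= e * `|s|.
  move=> fd; have e20 : 0 < e / 2 by rewrite divr_gt0.
  have [r r0 hr] := fd _ e20; have [m mr] := ltr_add_invr r0; rewrite add0r in mr.
  have [q] := @rat_in_itvoo R (d - e / 2) (d + e / 2) ltac:(lra).
  rewrite in_itv/= => qd; exists q, m; split; first by rewrite ltr_distl.
  move=> s sm; have hs := hr s (lt_trans sm mr).
  have -> : f (x + s *: w) - f x - ratr q * s = (f (x + s *: w) - f x - d * s) - (ratr q - d) * s by ring.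
  apply: (le_trans (ler_normB _ _)); rewrite normrM.
  have : `|ratr q - d| * `|s| <= e / 2 * `|s| by rewrite ler_wpM2r// ltW// ltr_distl.
  lra.
have [y [my [yd hy]]] := approx _ _ fa.
have [z [mz [zd hz]]] := approx _ _ fb.
have [w [mw [wd hw]]] := approx _ _ fc.
pose m := maxn my (maxn mz mw).
have mm k' (s : R) : (k' <= m)%N -> `|s| < m.+1%:R^-1 -> `|s| < k'.+1%:R^-1.
  by move=> km sm; apply: lt_le_trans sm _; rewrite lef_pV2 ?posrE// ler_nat.
exists (y, z, w, (k, m)) => //; rewrite /F /= -/e; case: asboolP => [_|[]].
  move=> s sm; split; [apply: hy|apply: hz|apply: hw]; apply: mm sm; rewrite /m.
  - exact: leq_maxl.
  - by rewrite leq_max leq_maxl orbT.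
  - by rewrite !leq_max leqnn !orbT.
have h : `|c - a - b| <= `|ratr w - ratr y - ratr z| + (e / 2 + e / 2 + e / 2).
  have -> : c - a - b = (ratr w - ratr y - ratr z) - ((ratr w - c) - (ratr y - a) - (ratr z - b)) by ring.
  apply: (le_trans (ler_normB _ _)); rewrite lerD2l.
  apply: (le_trans (ler_normB _ _)); apply: lerD; last exact: ltW.
  by apply: (le_trans (ler_normB _ _)); apply: lerD; exact: ltW.
have ke' : e < `|c - a - b| / 6%:R by [].
clearbody e; lra.
Qed.

End rademacher.

(** * Inner product and total differentiability *)

Section dot_product.
Context {R : realType} {n : nat}.
Implicit Types x y z : 'rV[R]_n.

Definition dot x y : R := \sum_i x 0 i * y 0 i.

Lemma dotC x y : dot x y = dot y x.
Proof. by apply: eq_bigr => i _; rewrite mulrC. Qed.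

Lemma dotDl x y z : dot (x + y) z = dot x z + dot y z.
Proof. by rewrite -big_split; apply: eq_bigr => i _; rewrite mxE mulrDl. Qed.

Lemma dotDr x y z : dot x (y + z) = dot x y + dot x z.
Proof. by rewrite dotC dotDl !(dotC x). Qed.

Lemma dotZl (a : R) x y : dot (a *: x) y = a * dot x y.
Proof. by rewrite mulr_sumr; apply: eq_bigr => i _; rewrite mxE mulrA. Qed.

Lemma dotZr (a : R) x y : dot x (a *: y) = a * dot x y.
Proof. by rewrite dotC dotZl dotC. Qed.

Lemma dotNl x y : dot (- x) y = - dot x y.
Proof. by rewrite -scaleN1r dotZl mulN1r. Qed.

Lemma dotNr x y : dot x (- y) = - dot x y.
Proof. by rewrite dotC dotNl dotC. Qed.

Lemma dotBl x y z : dot (x - y) z = dot x z - dot y z.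
Proof. by rewrite dotDl dotNl. Qed.

Lemma dotBr x y z : dot x (y - z) = dot x y - dot x z.
Proof. by rewrite dotDr dotNr. Qed.

Lemma dot0l x : dot 0 x = 0.
Proof. by rewrite /dot big1// => i _; rewrite mxE mul0r. Qed.

Lemma dot0r x : dot x 0 = 0.
Proof. by rewrite dotC dot0l. Qed.

Lemma dotxx_ge0 x : 0 <= dot x x.
Proof. by apply: sumr_ge0 => i _; rewrite -expr2 sqr_ge0. Qed.

Lemma dotxx_eq0 x : dot x x = 0 -> x = 0.
Proof.
move=> /eqP; rewrite psumr_eq0 => [/allP h|i _]; last by rewrite -expr2 sqr_ge0.
apply/rowP => i; rewrite mxE; apply/eqP.
by have := h i (mem_index_enum _); rewrite /= mulf_eq0 orbb.
Qed.

Lemma dot_delta x i : dot x (delta_mx 0 i) = x 0 i.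
Proof.
rewrite /dot (bigD1 i)//= big1 ?addr0 => [|j ji]; first by rewrite mxE !eqxx mulr1.
by rewrite mxE (negbTE ji) andbF mulr0.
Qed.

Lemma dot_le_norm x y : `|dot x y| <= (\sum_i `|x 0 i|) * `|y|.
Proof.
rewrite mulr_suml; apply: (le_trans (ler_norm_sum _ _ _)); apply: ler_sum => i _.
by rewrite normrM ler_wpM2l// coord_le_norm.
Qed.

Lemma dot_le_normM x y : `|dot x y| <= n%:R * `|x| * `|y|.
Proof.
apply: (le_trans (dot_le_norm _ _)); rewrite ler_wpM2r//.
apply: (@le_trans _ _ (\sum_(i < n) `|x|)); first by apply: ler_sum => i _; exact: coord_le_norm.
by rewrite sumr_const card_ord mulr_natl.
Qed.

Lemma normsq_le_dotxx x : `|x| ^+ 2 <= dot x x.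
Proof.
have h i : `|x 0 i| <= Num.sqrt (dot x x).
  rewrite -sqrtr_sqr ler_wsqrtr// /dot (bigD1 i)//= -expr2 lerDl.
  by apply: sumr_ge0 => j _; rewrite -expr2 sqr_ge0.
rewrite -[leRHS]sqr_sqrtr ?dotxx_ge0// ler_pXn2r ?nnegrE ?sqrtr_ge0//.
by apply: norm_rV_le => //; exact: sqrtr_ge0.
Qed.

Lemma dotxx_le_normsq x : dot x x <= n%:R * `|x| ^+ 2.
Proof.
rewrite /dot; apply: (@le_trans _ _ (\sum_(i < n) `|x| ^+ 2)); last first.
  by rewrite sumr_const card_ord mulr_natl.
apply: ler_sum => i _; rewrite -expr2 -real_normK ?num_real//.
by rewrite ler_pXn2r ?nnegrE// coord_le_norm.
Qed.

End dot_product.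

Section frechet.
Context {R : realType} {n : nat}.
Local Notation mu := (lebesgue_rV R n).

Definition frechet (f : 'rV[R]_n -> R) (x a : 'rV[R]_n) :=
  forall e : R, 0 < e -> exists2 r : R, 0 < r &
    forall h, `|h| < r -> `|f (x + h) - f x - dot a h| <= e * `|h|.

Variables (f : 'rV[R]_n -> R) (L : R).
Hypothesis fL : forall x y, `|f x - f y| <= L * `|x - y|.

Let iv (z : 'rV[int]_n) : 'rV[R]_n := map_mx (fun k => k%:~R) z.

Let ivD z z' : iv (z + z') = iv z + iv z'.
Proof. by apply/rowP => i; rewrite !mxE intrD. Qed.

Let additive_linear (d : 'rV[int]_n -> R) :
  (forall z z', d (z + z') = d z + d z') ->
  forall z, d z = dot (\row_i d (delta_mx 0 i)) (iv z).
Proof.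
move=> dD.
have d0 : d 0 = 0 by have := dD 0 0; rewrite addr0 => h; lra.
have dn z k : d (z *+ k) = d z *+ k by elim: k => [|k IH]; rewrite ?mulr0n// !mulrS dD IH.
have dN z : d (- z) = - d z.
  by have := dD z (- z); rewrite subrr d0 => h; lra.
have dz z (k : int) : d (k *: z) = k%:~R * d z.
  have -> : k *: z = z *~ k by rewrite -scaler_int intz.
  case: k => k; first by rewrite -pmulrn dn mulr_natl.
  by rewrite NegzE mulrNz dN -pmulrn dn intrN mulNr mulr_natl.
move=> z; rewrite {1}(row_sum_delta z) (big_morph d dD d0).
by apply: eq_bigr => i _; rewrite dz !mxE mulrC.
Qed.

Let net (N : nat) (k : {ffun 'I_n -> 'I_(2 * N).+1}) : 'rV[int]_n :=
  \row_i ((k i)%:Z - N%:Z).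

(* Integer vectors of max norm at most [N] scaled by [|h| / N] approximate [h]. *)
Let net_approx (N : nat) (h : 'rV[R]_n) : h != 0 -> (0 < N)%N ->
  exists k : {ffun 'I_n -> 'I_(2 * N).+1},
    `|h - (`|h| / N%:R) *: iv (net k)| <= `|h| / N%:R.
Proof.
move=> h0 N0; have nh : 0 < `|h| by rewrite normr_gt0.
have N0' : (0 : R) < N%:R by rewrite ltr0n.
pose w i : R := N%:R * h 0 i / `|h| + N%:R.
have w0 i : 0 <= w i.
  have := coord_le_norm h i; rewrite ler_norml => /andP[h1 _].
  rewrite /w -mulrA -[X in _ + X]mulr1 -mulrDr mulr_ge0 ?ler0n//.
  by rewrite -lerBlDr sub0r ler_pdivlMr// mulN1r.
have w2 i : w i <= (2 * N)%:R.
  have := coord_le_norm h i; rewrite ler_norml => /andP[_ h2].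
  rewrite /w -mulrA natrM -[X in _ + X]mulr1 -mulrDr mulrC ler_wpM2r ?ler0n//.
  by rewrite -lerBrDr ler_pdivrMr//; lra.
have kP i : (Num.truncn (w i) < (2 * N).+1)%N.
  by rewrite ltnS -(ler_nat R) (le_trans _ (w2 i))// truncn_le.
exists [ffun i => Ordinal (kP i)].
apply: norm_rV_le; first by rewrite divr_ge0.
move=> i; rewrite !mxE ffunE/=.
have -> : h 0 i = `|h| / N%:R * (w i - N%:R).
  by rewrite /w addrK; field; rewrite !gt_eqF.
rewrite -mulrBr normrM ger0_norm ?divr_ge0// -[leRHS]mulr1 ler_wpM2l ?divr_ge0//.
have /andP[t1 t2] := truncn_itv (w0 i).
rewrite intrB -!pmulrn ler_norml; rewrite -natr1 in t2.
by apply/andP; split; lra.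
Qed.

(** At almost every point the derivatives in all integer directions exist and are additive,
    hence given by a vector.  Any increment [h] is within [|h| / N] of a multiple of one of
    finitely many integer directions, and the Lipschitz bound absorbs the difference. *)
Theorem rademacher : mu.-negligible [set x | ~ exists a, frechet f x a].
Proof.
pose B1 (z : 'rV[int]_n) := if `[< iv z = 0 >] then set0 else
  [set x | ~ exists d, ddir f x (iv z) d].
pose B2 (z : 'rV[int]_n * 'rV[int]_n) := if `[< iv z.1 = 0 >] then set0 else
  [set x | exists a b c, [/\ ddir f x (iv z.1) a, ddir f x (iv z.2) b,
     ddir f x (iv z.1 + iv z.2) c & c <> a + b]].
have N1 : mu.-negligible (\bigcup_z B1 z).
  apply: negligible_countable_bigcup => z; rewrite /B1; case: asboolP => z0.
    exact: negligible_set0.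
  by apply: (ddir_ae fL); apply/eqP.
have N2 : mu.-negligible (\bigcup_z B2 z).
  apply: negligible_countable_bigcup => z; rewrite /B2; case: asboolP => z0.
    exact: negligible_set0.
  by apply: (ddirD_ae fL); apply/eqP.
apply: negligibleS (negligibleU_rV N1 N2) => x nx.
apply: contra_notP nx => /not_orP[g1 g2].
have dd z : exists d, ddir f x (iv z) d.
  have [z0|z0] := pselect (iv z = 0).
    exists 0 => e e0; exists 1 => // s _; rewrite z0 scaler0 addr0 subrr mul0r subr0 normr0.
    by rewrite mulr_ge0// ltW.
  apply: contra_notP g1 => nd; exists z => //; rewrite /B1; case: asboolP => //.
have [d dP] := choice dd.
have dD z z' : d (z + z') = d z + d z'.
  have [z0|z0] := pselect (iv z = 0).
    have := dP (z + z'); rewrite ivD z0 add0r => h.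
    rewrite (ddir_unique h (dP z')).
    have h0 : ddir f x (iv z) 0.
      rewrite z0 => e e0; exists 1 => // s _; rewrite scaler0 addr0 subrr mul0r subr0 normr0.
      by rewrite mulr_ge0// ltW.
    by rewrite (ddir_unique (dP z) h0) add0r.
  apply: contra_notP g2 => ne; exists (z, z') => //; rewrite /B2; case: asboolP => // _.
  by exists (d z), (d z'), (d (z + z')); split => //; rewrite -ivD.
have dl := additive_linear dD.
set a := (\row_i _) in dl.
exists a => e e0.
pose M := \sum_i `|a 0 i|.
have M0 : 0 <= M by apply: sumr_ge0.
have [N hN] : exists N : nat, (`|L| + 1 + M) / N.+1%:R <= e.
  exists (Num.truncn ((`|L| + 1 + M) / e)); rewrite ler_pdivrMr// mulrC -ler_pdivrMr//.
  by rewrite ltW// truncnS_gt.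
have ex (k : {ffun 'I_n -> 'I_(2 * N.+1).+1}) : exists r : R, 0 < r /\
    forall s, `|s| < r -> `|f (x + s *: iv (net k)) - f x - d (net k) * s| <= `|s|.
  have [r r0 h] := dP (net k) 1 ltr01; exists r; split => // s sr.
  by rewrite -[leRHS]mul1r; exact: h.
have [r hr] := choice ex.
pose rho := \big[Num.min/1]_k r k.
have rho0 : 0 < rho by apply/bigmin_gtP; split => // k _; exact: (hr k).1.
exists rho => // h hrho.
have [->|h0] := eqVneq h 0.
  by rewrite addr0 subrr dot0r subrr normr0 mulr_ge0// ltW.
have [k hk] := net_approx h0 (ltn0Sn N).
set s := `|h| / _ in hk; set z := iv (net k) in hk.
have s0 : 0 <= s by rewrite divr_ge0.
have sr : `|s| < r k.
  apply: lt_le_trans (bigmin_le _ _ _) => //; apply: le_lt_trans hrho.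
  by rewrite ger0_norm// /s ler_pdivrMr// ler_peMr// ler1n.
have b1 := (hr k).2 s sr; rewrite (ger0_norm s0) -/z in b1.
have b2 : `|f (x + h) - f (x + s *: z)| <= `|L| * s.
  apply: le_trans (fL _ _) _; rewrite opprD addrACA subrr add0r.
  apply: (@le_trans _ _ (`|L| * `|h - s *: z|)); first by rewrite ler_wpM2r// ler_norm.
  by rewrite ler_wpM2l.
have b3 : `|d (net k) * s - dot a h| <= M * s.
  rewrite dl mulrC -dotZr -dotBr; apply: le_trans (dot_le_norm _ _) _.
  by rewrite ler_wpM2l// distrC.
have -> : f (x + h) - f x - dot a h = (f (x + h) - f (x + s *: z)) +
  (f (x + s *: z) - f x - d (net k) * s) + (d (net k) * s - dot a h) by ring.
apply: (le_trans (ler_normD _ _)); apply: le_trans (lerD (ler_normD _ _) (lexx _)) _.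
apply: (@le_trans _ _ ((`|L| + 1 + M) * s)); first lra.
by rewrite /s mulrCA mulrC ler_wpM2r.
Qed.

End frechet.

(** * Quadratic forms and second order expansions *)

Section quadratic_forms.
Context {R : realType} {n : nat}.
Implicit Types (X : 'M[R]_n) (h k : 'rV[R]_n).

Definition qf X h : R := (h *m X *m h^T) 0 0.

Lemma mulmx_trE h k : (h *m k^T) 0 0 = dot h k.
Proof. by rewrite !mxE; apply: eq_bigr => i _; rewrite mxE. Qed.

Lemma qfE X h : qf X h = dot (h *m X) h.
Proof. exact: mulmx_trE. Qed.

Lemma qfD X Y h : qf (X + Y) h = qf X h + qf Y h.
Proof. by rewrite !qfE mulmxDr dotDl. Qed.

Lemma qfZ (a : R) X h : qf (a *: X) h = a * qf X h.
Proof. by rewrite !qfE -scalemxAr dotZl. Qed.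

Lemma qfN X h : qf (- X) h = - qf X h.
Proof. by rewrite -scaleN1r qfZ mulN1r. Qed.

Lemma qfB X Y h : qf (X - Y) h = qf X h - qf Y h.
Proof. by rewrite qfD qfN. Qed.

Lemma qf_trmx X h : qf X^T h = qf X h.
Proof.
rewrite /qf -[RHS](_ : ((h *m X *m h^T)^T) 0 0 = _); last by rewrite mxE.
by rewrite !trmx_mul trmxK mulmxA.
Qed.

Lemma qf_scalar (a : R) h : qf a%:M h = a * dot h h.
Proof. by rewrite qfE mul_mx_scalar dotZl. Qed.

Lemma qf_scale X (a : R) h : qf X (a *: h) = a ^+ 2 * qf X h.
Proof. by rewrite !qfE -scalemxAl dotZl dotZr mulrA expr2. Qed.

Lemma dot_mulmx_sym X h k : X^T = X -> dot (h *m X) k = dot h (k *m X).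
Proof.
by move=> sX; rewrite -!mulmx_trE trmx_mul sX mulmxA.
Qed.

Lemma qf_add X h k : X^T = X -> qf X (h + k) = qf X h + 2 * dot (h *m X) k + qf X k.
Proof.
move=> sX; rewrite !qfE mulmxDl !dotDl !dotDr [dot (k *m X) h]dotC -(dot_mulmx_sym _ _ sX).
ring.
Qed.

Lemma qf_bound X h : `|qf X h| <= (\sum_i \sum_j `|X i j|) * dot h h.
Proof.
rewrite qfE /dot mulr_suml; apply: (le_trans (ler_norm_sum _ _ _)).
have E : \sum_i `|(h *m X) 0 i * h 0 i| <= \sum_i \sum_j `|X j i| * dot h h.
  apply: ler_sum => i _; rewrite mxE mulr_suml; apply: (le_trans (ler_norm_sum _ _ _)).
  apply: ler_sum => j _; rewrite mulrAC mulrC normrM ler_wpM2l//.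
  rewrite normrM; apply: (@le_trans _ _ (`|h| * `|h|)).
    by apply: ler_pM => //; exact: coord_le_norm.
  by rewrite -expr2; exact: normsq_le_dotxx.
apply: (le_trans E); rewrite exchange_big/=.
by apply: ler_sum => i _; rewrite -mulr_suml.
Qed.

End quadratic_forms.

Section c11.
Context {R : realType} {n : nat}.
Local Notation mu := (lebesgue_rV R n).
Variables (w : 'rV[R]_n -> R) (p : 'rV[R]_n -> 'rV[R]_n) (C : R).
Hypothesis wp : forall x h, `|w (x + h) - w x - dot (p x) h| <= C * dot h h.

(** Adding the expansions of [w (x + h + k)] at [x] and at [x + h] bounds
    [dot (p x - p (x + h)) k] by squares; then [k] is taken of the length of [h]. *)
Lemma c11_lipschitz x y : `|p x - p y| <= `|C| * (5 * n + 1)%:R * `|x - y|.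
Proof.
have main x' h k : dot (p x' - p (x' + h)) k <= C * (dot (h + k) (h + k) + dot k k + dot h h).
  have := wp x' (h + k); rewrite ler_norml => /andP[h1 _].
  have := wp (x' + h) k; rewrite ler_norml -(addrA x') => /andP[_ h2].
  have := wp x' h; rewrite ler_norml => /andP[_ h3].
  rewrite dotBl; rewrite (dotDr (p x')) in h1; lra.
have main' x' h i (s : R) : s ^+ 2 = 1 -> s * (p x' - p (x' + h)) 0 i * `|h| <=
    `|C| * (5 * n + 1)%:R * `|h| * `|h|.
  move=> s1; have := main x' h (`|h| *: (s *: delta_mx 0 i)).
  set k := `|h| *: _.
  have dk v : dot v k = `|h| * (s * v 0 i) by rewrite !dotZr dot_delta.
  have kk : dot k k = `|h| ^+ 2.
    rewrite dk /k !mxE !eqxx mulr1; have -> : `|h| * (s * (`|h| * s)) = s ^+ 2 * `|h| ^+ 2 by ring.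
    by rewrite s1 mul1r.
  have nk : `|k| <= `|h|.
    by rewrite -(@ler_pXn2r _ 2) ?nnegrE// -kk; exact: normsq_le_dotxx.
  have hh := dotxx_le_normsq h.
  have hk : dot (h + k) (h + k) <= n%:R * (4 * `|h| ^+ 2).
    apply: le_trans (dotxx_le_normsq _) _; rewrite ler_wpM2l//.
    have -> : 4 * `|h| ^+ 2 = (2 * `|h|) ^+ 2 by ring.
    rewrite ler_pXn2r ?nnegrE// ?mulr_ge0//.
    by apply: le_trans (ler_normD _ _) _; lra.
  rewrite dk kk => {}main.
  have -> : s * (p x' - p (x' + h)) 0 i * `|h| = `|h| * (s * (p x' - p (x' + h)) 0 i) by ring.
  apply: (le_trans main); apply: (@le_trans _ _ (`|C| * (dot (h + k) (h + k) + `|h| ^+ 2 + dot h h))).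
    by rewrite ler_wpM2r ?ler_norm// !addr_ge0// ?dotxx_ge0// sqr_ge0.
  rewrite -!mulrA ler_wpM2l// natrD natrM.
  have -> : (5%:R * n%:R + 1) * (`|h| * `|h|) = n%:R * (4 * `|h| ^+ 2) + `|h| ^+ 2 + n%:R * `|h| ^+ 2.
    by ring.
  lra.
pose h := y - x; have yE : y = x + h by rewrite /h addrC subrK.
have xyh : x - y = - h by rewrite opprB.
rewrite xyh normrN yE; clearbody h.
have [->|h0] := eqVneq h 0; first by rewrite addr0 subrr !normr0 mulr0.
apply: norm_rV_le; first by rewrite !mulr_ge0.
move=> i; have nh : 0 < `|h| by rewrite normr_gt0.
rewrite -(ler_pM2r nh) -[X in _ * X <= _]gtr0_norm// -normrM ler_norml.
have h1 := main' x h i 1 (expr1n _ _); have h2 := main' x h i (-1) (sqrr_sign _ 1).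
rewrite mul1r in h1; rewrite mulN1r mulNr in h2.
by rewrite h1 andbT lerNl.
Qed.

End c11.

Section peano.
Context {R : realType} {n : nat}.
Local Notation mu := (lebesgue_rV R n).

(** A mean value inequality with a quadratic error, which disappears when [[0, 1]] is
    subdivided. *)
Lemma telescope_bound (g : R -> R) (E D : R) : 0 <= D ->
  (forall t s : R, 0 <= t -> 0 <= s -> t + s <= 1 -> `|g (t + s) - g t| <= s * E + D * s ^+ 2) ->
  `|g 1 - g 0| <= E.
Proof.
move=> D0 gE; apply/ler_addgt0Pr => e e0.
have [N hN] : exists N : nat, D / N.+1%:R <= e.
  exists (Num.truncn (D / e)); rewrite ler_pdivrMr// mulrC -ler_pdivrMr//.
  by rewrite ltW// truncnS_gt.
pose s : R := N.+1%:R^-1; have s0 : 0 <= s by rewrite invr_ge0.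
have sN : N.+1%:R * s = 1 by rewrite mulfV.
have H k : (k <= N.+1)%N -> `|g (k%:R * s) - g 0| <= k%:R * (s * E + D * s ^+ 2).
  elim: k => [|k IH] kN; first by rewrite !mul0r subrr normr0.
  rewrite -(subrKA (g (k%:R * s))) (le_trans (ler_normD _ _))//.
  rewrite -[in leRHS]natr1 [leRHS]mulrDl mul1r [leRHS]addrC lerD//; last exact/IH/ltnW.
  have -> : k.+1%:R * s = k%:R * s + s by rewrite -natr1 mulrDl mul1r.
  apply: gE => //; first by rewrite mulr_ge0.
  have -> : k%:R * s + s = k.+1%:R * s by rewrite -natr1 mulrDl mul1r.
  by apply: (@le_trans _ _ (N.+1%:R * s)); [rewrite ler_wpM2r// ler_nat|rewrite sN].
have := H N.+1 (leqnn _); rewrite sN => /le_trans; apply.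
rewrite mulrDr mulrA sN mul1r lerD2l.
by have -> : N.+1%:R * (D * s ^+ 2) = D * s * (N.+1%:R * s); [ring|rewrite sN mulr1].
Qed.

(** [w] has the second order Taylor expansion with gradient [p] and Hessian [X]
    at [x]. *)
Definition peano (w : 'rV[R]_n -> R) (x p : 'rV[R]_n) (X : 'M[R]_n) :=
  forall e : R, 0 < e -> exists2 r : R, 0 < r &
    forall h, `|h| < r -> `|w (x + h) - w x - dot p h - qf X h / 2| <= e * dot h h.

(** The gradient map is Lipschitz, hence almost everywhere differentiable; integrating its
    expansion along segments gives the second order expansion of [w], in which only the
    symmetric part of the differential matters. *)
Lemma c11_peano_ae (w : 'rV[R]_n -> R) (p : 'rV[R]_n -> 'rV[R]_n) (C : R) : 0 <= C ->
  (forall x h, `|w (x + h) - w x - dot (p x) h| <= C * dot h h) ->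
  mu.-negligible [set x | ~ exists2 X : 'M[R]_n, X^T = X & peano w x (p x) X].
Proof.
move=> C0 wp; have pL := c11_lipschitz wp; set L := _ * _ in pL.
have piL i x y : `|p x 0 i - p y 0 i| <= L * `|x - y|.
  apply: le_trans (pL x y); have := coord_le_norm (p x - p y) i.
  by rewrite mxE [(- _ : 'rV_n) _ _]mxE.
pose F i := [set x | ~ exists a, frechet (fun y => p y 0 i) x a].
apply: (@negligibleS _ _ _ _ (\bigcup_i F i)); last first.
  by apply: negligible_countable_bigcup => i; apply: rademacher (piL i).
move=> x nX; apply: contra_notP nX => nF.
have exa (i : 'I_n) : exists a, frechet (fun y => p y 0 i) x a.
  by apply: contra_notP nF => ?; exists i.
have [a ha] := choice exa.
pose A : 'M[R]_n := \matrix_(j, i) a i 0 j.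
pose X : 'M[R]_n := 2^-1 *: (A + A^T).
have sX : X^T = X by rewrite /X linearZ/= linearD/= trmxK addrC.
have qX h : qf X h = qf A h by rewrite /X qfZ qfD qf_trmx; field.
have hA h i : (h *m A) 0 i = dot (a i) h.
  by rewrite mxE; apply: eq_bigr => j _; rewrite mxE mulrC.
exists X => // e e0.
have n1 : (0 : R) < n.+1%:R by [].
have exr (i : 'I_n) : exists r, 0 < r /\ forall h, `|h| < r ->
    `|p (x + h) 0 i - p x 0 i - dot (a i) h| <= e / n.+1%:R * `|h|.
  by have [r r0 h] := ha i _ (divr_gt0 e0 n1); exists r.
have [r hr] := choice exr.
pose rho := \big[Num.min/1]_i r i.
have rho0 : 0 < rho by apply/bigmin_gtP; split => // k _; exact: (hr k).1.
exists rho => // h hrho.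
have hi t i : 0 <= t -> t <= 1 -> `|p (x + t *: h) 0 i - p x 0 i - t * dot (a i) h| <= e / n.+1%:R * `|h|.
  move=> t0 t1; have th : `|t *: h| <= `|h| by rewrite norm_rVZ ger0_norm// ler_piMl.
  have := (hr i).2 (t *: h); rewrite dotZr.
  have -> : `|t *: h| < r i.
    by apply: le_lt_trans th _; apply: lt_le_trans hrho _; exact: bigmin_le.
  move=> /(_ isT)/le_trans; apply; rewrite ler_wpM2l// divr_ge0// ltW//.
have err t : 0 <= t -> t <= 1 -> `|dot (p (x + t *: h)) h - dot (p x) h - t * qf A h| <= e * dot h h.
  move=> t0 t1.
  have -> : dot (p (x + t *: h)) h - dot (p x) h - t * qf A h =
     \sum_i (p (x + t *: h) 0 i - p x 0 i - t * dot (a i) h) * h 0 i.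
    rewrite qfE /dot mulr_sumr -!sumrB; apply: eq_bigr => i _.
    by rewrite hA /dot; ring.
  apply: (le_trans (ler_norm_sum _ _ _)).
  apply: (@le_trans _ _ (\sum_(i < n) e / n.+1%:R * `|h| ^+ 2)).
    apply: ler_sum => i _; rewrite normrM expr2 mulrA; apply: ler_pM => //; first exact: hi.
    exact: coord_le_norm.
  rewrite sumr_const card_ord.
  apply: (@le_trans _ _ (e * `|h| ^+ 2)); last first.
    by apply: ler_wpM2l; [exact: ltW|exact: normsq_le_dotxx].
  have -> : (e / n.+1%:R * `|h| ^+ 2) *+ n = (n%:R / n.+1%:R) * (e * `|h| ^+ 2).
    by rewrite -mulr_natl; ring.
  rewrite -[leRHS]mul1r ler_wpM2r//; first by rewrite mulr_ge0 ?sqr_ge0// ltW.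
  by rewrite ler_pdivrMr// mul1r ler_nat.
pose g t := w (x + t *: h) - t * dot (p x) h - t ^+ 2 / 2 * qf A h.
have -> : w (x + h) - w x - dot (p x) h - qf X h / 2 = g 1 - g 0.
  rewrite /g qX scale1r scale0r addr0; ring.
have D0 : 0 <= C * dot h h + `|qf A h| / 2.
  by rewrite addr_ge0// ?mulr_ge0// ?dotxx_ge0// divr_ge0.
apply: (telescope_bound D0) => t s t0 s0 ts.
have t1 : t <= 1 by lra.
have := wp (x + t *: h) (s *: h).
rewrite -(addrA x) -scalerDl !dotZr dotZl => w1.
have -> : g (t + s) - g t = (w (x + (t + s) *: h) - w (x + t *: h) - s * dot (p (x + t *: h)) h)
  + s * (dot (p (x + t *: h)) h - dot (p x) h - t * qf A h) - s ^+ 2 * (qf A h / 2).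
  by rewrite /g; field.
apply: (le_trans (ler_normB _ _)); apply: le_trans (lerD (ler_normD _ _) (lexx _)) _.
have := ler_wpM2l s0 (err t t0 t1); rewrite -{1}(ger0_norm s0) -normrM => w2.
have -> : `|s ^+ 2 * (qf A h / 2)| = s ^+ 2 * (`|qf A h| / 2).
  by rewrite normrM ger0_norm ?sqr_ge0// normrM (ger0_norm (_ : 0 <= 2^-1))// invr_ge0.
lra.
Qed.

End peano.

(** * Lasry-Lions regularisation *)

Lemma continuous_bigsum (R : realType) (V : normedModType R) (I : Type) (r : seq I) (F : I -> V -> R) :
  (forall i, continuous (F i)) -> continuous (fun x => \sum_(i <- r) F i x).
Proof.
move=> cF; elim: r => [|i r IH].
  rewrite (_ : (fun x => _) = cst 0); first exact: cst_continuous.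
  by apply/funext => x; rewrite big_nil.
rewrite (_ : (fun x => _) = (fun x => F i x + \sum_(j <- r) F j x)).
  by move=> x; exact: (continuousD (cF i x) (IH x)).
by apply/funext => x; rewrite big_cons.
Qed.

Lemma within_continuousB (R : realType) (V : normedModType R) (D : set V) (f g : V -> R) :
  {within D, continuous f} -> continuous g -> {within D, continuous (fun y => f y - g y)}.
Proof.
move=> cf cg y; have cg' : {within D, continuous g} by exact: continuous_subspaceT.
exact: (continuousB (cf y) (cg' y)).
Qed.

Section continuity.
Context {R : realType} {n : nat}.
Implicit Types x y z : 'rV[R]_n.

Lemma continuous_coord (i : 'I_n) : continuous (fun x : 'rV[R]_n => x 0 i).
Proof. by move=> x; exact: (@coord_continuous R 1 n 0 i x). Qed.

Lemma continuous_dot z : continuous (fun x => dot z x).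
Proof.
apply: continuous_bigsum => i x.
exact: (continuousM (@cst_continuous _ _ (z 0 i) x) (@continuous_coord i x)).
Qed.

Lemma continuous_dotxx : continuous (fun x : 'rV[R]_n => dot x x).
Proof.
apply: continuous_bigsum => i x.
exact: (continuousM (@continuous_coord i x) (@continuous_coord i x)).
Qed.

Lemma dot_distE x y : dot (x - y) (x - y) = dot x x - 2 * dot x y + dot y y.
Proof. rewrite !dotBl !dotBr (dotC y x); ring. Qed.

Lemma continuous_dist z : continuous (fun x => dot (z - x) (z - x)).
Proof.
rewrite (_ : (fun x => _) = (fun x => dot z z - 2 * dot z x + dot x x)); last first.
  by apply/funext => x; rewrite dot_distE.
move=> x; have h1 : {for x, continuous (fun x => 2 * dot z x)}.
  exact: (continuousM (@cst_continuous _ _ (2 : R) x) (@continuous_dot z x)).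
have h2 : {for x, continuous (fun x => dot z z - 2 * dot z x)}.
  exact: (continuousB (@cst_continuous _ _ (dot z z) x) h1).
exact: (continuousD h2 (@continuous_dotxx x)).
Qed.

Lemma dot_dist0 x : dot (x - x) (x - x) = 0.
Proof. by rewrite subrr dot0l. Qed.

Lemma dot_comb (s : R) x y : dot ((1 - s) *: x + s *: y) ((1 - s) *: x + s *: y) =
  (1 - s) * dot x x + s * dot y y - s * (1 - s) * dot (x - y) (x - y).
Proof. rewrite dot_distE !dotDl !dotDr !dotZl !dotZr (dotC y x); ring. Qed.

Lemma dot_double x y : dot (x + y) (x + y) <= 2 * dot x x + 2 * dot y y.
Proof.
have := dotxx_ge0 (x - y); rewrite dot_distE.
rewrite !dotDl !dotDr (dotC y x); lra.
Qed.

End continuity.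

Section regularisation.
Context {R : realType} {n : nat}.
Variables (D : set 'rV[R]_n) (u : 'rV[R]_n -> R) (t : R).
Hypotheses (D0 : D !=set0) (cD : compact D) (uc : {within D, continuous u}) (t0 : 0 < t).
Implicit Types (x y z h k : 'rV[R]_n).

Let t4 : 0 < 4 * t. Proof. by rewrite mulr_gt0. Qed.
Let t2 : 0 < 2 * t. Proof. by rewrite mulr_gt0. Qed.

Lemma sup_conv_attained x : exists y, D y /\ forall y', D y' ->
  u y' - dot (x - y') (x - y') / (4 * t) <= u y - dot (x - y) (x - y) / (4 * t).
Proof.
have cg : {within D, continuous (fun y => u y - dot (x - y) (x - y) / (4 * t))}.
  have ch : continuous (fun y => dot (x - y) (x - y) / (4 * t)).
    move=> y; exact: (continuousM (@continuous_dist _ _ x y) (@cst_continuous _ _ (4 * t)^-1 y)).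
  exact: within_continuousB.
have [y Dy ymax] := EVT_max_rV D0 cD cg.
by exists y; split=> [|y' Dy']; [exact/set_mem|apply: ymax; exact/mem_set].
Qed.

Definition supc_pt x := projT1 (cid (sup_conv_attained x)).

(** The sup-convolution of [u] on [D], with the maximum point made explicit: second order
    information is transported from one point to the other. *)
Definition supc x : R := u (supc_pt x) - dot (x - supc_pt x) (x - supc_pt x) / (4 * t).

Lemma supc_ptD x : D (supc_pt x).
Proof. by rewrite /supc_pt; case: cid => y []. Qed.

Lemma supc_ge x y : D y -> u y - dot (x - y) (x - y) / (4 * t) <= supc x.
Proof. by rewrite /supc /supc_pt; case: cid => y' [_ h] /=; exact: h. Qed.

Lemma supc_continuous : continuous supc.
Proof.
have [M [_ DM]] := compact_bounded cD.
have {}DM y : D y -> `|y| <= `|M| + 1.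
  by move=> Dy; apply: DM => //; rewrite (le_lt_trans (ler_norm M))// ltrDl.
pose K x := n%:R * (2 * `|x| + 1 + 2 * (`|M| + 1)) / (4 * t).
have main x y z : D z -> `|x - y| <= 1 ->
    `|dot (y - z) (y - z) / (4 * t) - dot (x - z) (x - z) / (4 * t)| <= K x * `|x - y|.
  move=> Dz xy; rewrite -mulrBl normrM (gtr0_norm (_ : 0 < (4 * t)^-1)) ?invr_gt0//.
  have -> : dot (y - z) (y - z) - dot (x - z) (x - z) = dot (y - x) (y + x - 2 *: z).
    rewrite !dot_distE !dotBl !dotBr !dotDr !dotZr (dotC x y); ring.
  rewrite /K mulrAC ler_pM2r ?invr_gt0//.
  apply: le_trans (dot_le_normM _ _) _.
  have -> : n%:R * (2 * `|x| + 1 + 2 * (`|M| + 1)) * `|x - y| =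
     (n%:R * `|y - x|) * (2 * `|x| + 1 + 2 * (`|M| + 1)) by rewrite distrC; ring.
  rewrite ler_wpM2l// (le_trans (ler_normB _ _))//.
  apply: (@le_trans _ _ (`|y| + `|x| + 2 * `|z|)).
    by rewrite norm_rVZ normr_nat lerD2r ler_normD.
  have hz := DM z Dz; have : `|y| <= `|x| + 1.
    by rewrite -(subrKC x y) (le_trans (ler_normD _ _))// lerD2l distrC.
  lra.
have diff x y : `|x - y| <= 1 -> supc y - supc x <= K x * `|x - y|.
  move=> xy; have h1 := supc_ge x (supc_ptD y).
  have := main x y _ (supc_ptD y) xy; rewrite ler_norml => /andP[h2 _].
  by rewrite {1}/supc; lra.
have K0 y : 0 <= K y.
  by rewrite /K divr_ge0 ?(ltW t4)// mulr_ge0// !addr_ge0// mulr_ge0// addr_ge0.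
move=> x; pose K' := n%:R * (2 * (`|x| + 1) + 1 + 2 * (`|M| + 1)) / (4 * t).
have KK' y : `|x - y| <= 1 -> K y <= K'.
  move=> xy; rewrite /K /K' ler_pM2r ?invr_gt0// ler_wpM2l//.
  have : `|y| <= `|x| + 1.
    by rewrite -(subrKC x y) (le_trans (ler_normD _ _))// lerD2l distrC.
  lra.
apply: (@locally_lipschitz_continuous R _ supc K') => y xy.
have yx : `|y - x| <= 1 by rewrite distrC.
have h1 := diff _ _ xy; have h2 := diff _ _ yx; rewrite [`|y - x|]distrC in h2.
have b1 : K x * `|x - y| <= K' * `|x - y|.
  by rewrite ler_wpM2r// KK'// subrr normr0.
have b2 : K y * `|x - y| <= K' * `|x - y| by rewrite ler_wpM2r// KK'.
by rewrite ler_norml; apply/andP; split; lra.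
Qed.

(** Far from [x] the quadratic penalisation, twice as strong as the one in [supc], wins. *)
Lemma inf_conv_attained x : exists z, forall z',
  supc z + dot (x - z) (x - z) / (2 * t) <= supc z' + dot (x - z') (x - z') / (2 * t).
Proof.
have [y Dy] := D0.
pose phi z := supc z + dot (x - z) (x - z) / (2 * t).
pose r2 := 8 * t * (supc x - u y + 3 * dot (x - y) (x - y) / (4 * t)).
have far z : r2 < dot (x - z) (x - z) -> phi x < phi z.
  move=> h; rewrite /phi dot_dist0 mul0r addr0.
  have h1 := supc_ge z Dy.
  have h2 : dot (z - y) (z - y) <= 3 / 2 * dot (x - z) (x - z) + 3 * dot (x - y) (x - y).
    have -> : z - y = (x - y) - (x - z) by apply/rowP => i; rewrite !mxE; ring.
    move: (x - z) (x - y) => a b; have := dotxx_ge0 (a + 2 *: b).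
    rewrite dot_distE dotDl !dotDr !dotZl !dotZr (dotC b a); lra.
  have h3 : supc x - u y + 3 * dot (x - y) (x - y) / (4 * t) < dot (x - z) (x - z) / (8 * t).
    by rewrite ltr_pdivlMr ?mulr_gt0// mulrC.
  have h4 : dot (z - y) (z - y) / (4 * t) <=
      (3 / 2 * dot (x - z) (x - z) + 3 * dot (x - y) (x - y)) / (4 * t).
    by rewrite ler_pM2r ?invr_gt0.
  have E1 : (3 / 2 * dot (x - z) (x - z) + 3 * dot (x - y) (x - y)) / (4 * t) =
     3 * (dot (x - z) (x - z) / (8 * t)) + 3 * dot (x - y) (x - y) / (4 * t).
    by field; rewrite gt_eqF.
  have E2 : dot (x - z) (x - z) / (2 * t) = 4 * (dot (x - z) (x - z) / (8 * t)).
    by field; rewrite gt_eqF.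
  rewrite E2; lra.
pose r := Num.max r2 0 + 1.
have r1 : 1 <= r by rewrite /r lerDr le_max lexx orbT.
pose B : set 'rV[R]_n := [set z | `|x - z| <= r].
have cB : compact B.
  apply: bounded_closed_compact.
    exists (`|x| + r); split; first exact: num_real.
    move=> s hs z /= Bz.
    rewrite ltW// (le_lt_trans _ hs)// -(subKr x z) (le_trans (ler_normB _ _))//.
    by rewrite lerD2l.
  have cn : continuous (fun z : 'rV[R]_n => `|x - z|).
    by move=> z; apply: (@lipschitz_continuous R _ _ 1) => a b; rewrite mul1r;
      apply: le_trans (ler_dist_dist _ _) _; rewrite opprB addrC addrA subrK distrC.
  rewrite (_ : B = (fun z => `|x - z|) @^-1` [set s | s <= r])//.
  by apply: (closed_comp _ (@closed_le R r)) => z _; exact: cn.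
have Bx : B x by rewrite /B /= subrr normr0 (le_trans _ r1).
have cphi : continuous phi.
  move=> z; have h : {for z, continuous (fun z => dot (x - z) (x - z) / (2 * t))}.
    exact: (continuousM (@continuous_dist _ _ x z) (@cst_continuous _ _ (2 * t)^-1 z)).
  exact: (continuousD (supc_continuous (x:=z)) h).
have [z Bz zmin] := EVT_min_rV (ex_intro _ x Bx) cB (continuous_subspaceT cphi).
exists z => z'; rewrite -/(phi z) -/(phi z').
have [Bz'|nB] := pselect (B z'); first by apply: zmin; exact/mem_set.
apply: (@le_trans _ _ (phi x)); first by apply: zmin; exact/mem_set.
apply/ltW/far; apply: (@lt_le_trans _ _ (`|x - z'| ^+ 2)); last exact: normsq_le_dotxx.
move: nB => /negP; rewrite /B /= -ltNge => rz.
apply: (@lt_trans _ _ r); last first.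
  have h1 : 1 <= `|x - z'| := le_trans r1 (ltW rz); apply: lt_le_trans rz _.
  by rewrite expr2 -{1}[`|x - z'|]mulr1 ler_wpM2l.
by rewrite /r ltr_pwDr// le_max lexx.
Qed.

Definition reg_pt x := projT1 (cid (inf_conv_attained x)).

(** The Lasry-Lions regularisation of [u]: an inf-convolution of its
    sup-convolution.  The inf-convolution uses the smaller parameter, so it preserves
    semiconvexity while making the function semiconcave, i.e. of class C^{1,1}. *)
Definition reg x : R := supc (reg_pt x) + dot (x - reg_pt x) (x - reg_pt x) / (2 * t).

Definition regD x : 'rV[R]_n := t^-1 *: (x - reg_pt x).

Lemma reg_le x z : reg x <= supc z + dot (x - z) (x - z) / (2 * t).
Proof. by rewrite /reg /reg_pt; case: cid => z' h /=; exact: h. Qed.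

Lemma reg_le_supc x : reg x <= supc x.
Proof. by apply: le_trans (reg_le x x) _; rewrite dot_dist0 mul0r addr0. Qed.

(** [reg] lies above the sup-convolution of parameter [t]: this follows from
    [|z - y|^2 <= 2 |x - z|^2 + 2 |x - y|^2]. *)
Lemma reg_ge x y : D y -> u y - dot (x - y) (x - y) / (2 * t) <= reg x.
Proof.
move=> Dy; rewrite /reg; have h1 := supc_ge (reg_pt x) Dy.
set z := reg_pt x in h1 *.
have h2 : dot (z - y) (z - y) <= 2 * dot (x - z) (x - z) + 2 * dot (x - y) (x - y).
  have -> : z - y = (x - y) + (z - x) by apply/rowP => i; rewrite !mxE; ring.
  have -> : dot (x - z) (x - z) = dot (z - x) (z - x) by rewrite -(opprB z x) dotNl dotNr opprK.
  by apply: le_trans (dot_double _ _) _; lra.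
have h3 : dot (z - y) (z - y) / (4 * t) <= (2 * dot (x - z) (x - z) + 2 * dot (x - y) (x - y)) / (4 * t).
  by rewrite ler_pM2r ?invr_gt0.
have E : (2 * dot (x - z) (x - z) + 2 * dot (x - y) (x - y)) / (4 * t) =
  dot (x - z) (x - z) / (2 * t) + dot (x - y) (x - y) / (2 * t) by field; rewrite gt_eqF.
lra.
Qed.

Lemma reg_upper x h : reg (x + h) <= reg x + dot (regD x) h + dot h h / (2 * t).
Proof.
apply: le_trans (reg_le (x + h) (reg_pt x)) _; rewrite /reg /regD dotZl.
set z := reg_pt x; rewrite le_eqVlt; apply/orP; left; apply/eqP.
have -> : x + h - z = (x - z) + h by rewrite addrAC.
move: (x - z) => a; rewrite dotDl !dotDr (dotC h a); field; rewrite gt_eqF//.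
Qed.

(** [reg] is an infimum of parabolas of opening [1 / t], hence semiconcave. *)
Lemma reg_concave x k (s : R) : 0 <= s <= 1 ->
  (1 - s) * reg x + s * reg (x + k) - s * (1 - s) * dot k k / (2 * t) <= reg (x + s *: k).
Proof.
move=> /andP[s0 s1]; rewrite {3}/reg; set z := reg_pt _.
have E : x + s *: k - z = (1 - s) *: (x - z) + s *: (x + k - z).
  by apply/rowP => i; rewrite !mxE; ring.
have K : (x - z) - (x + k - z) = - k by apply/rowP => i; rewrite !mxE; ring.
rewrite E dot_comb K dotNl dotNr opprK.
have h1 := ler_wpM2l (_ : 0 <= 1 - s) (reg_le x z).
have h2 := ler_wpM2l s0 (reg_le (x + k) z).
have h3 := h1 ltac:(lra).
have -> : supc z + ((1 - s) * dot (x - z) (x - z) + s * dot (x + k - z) (x + k - z) - s * (1 - s) * dot k k) / (2 * t)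
 = (1 - s) * (supc z + dot (x - z) (x - z) / (2 * t)) + s * (supc z + dot (x + k - z) (x + k - z) / (2 * t))
   - s * (1 - s) * dot k k / (2 * t) by ring.
lra.
Qed.

(** For fixed [y] the quantity [- |z - y|^2 / 4t + |x - z|^2 / 2t + |x|^2 / 2t] is, up to an
    affine term, the square [|z - 2 x|^2 / 4t], hence jointly convex in [x] and [z]. *)
Lemma reg_semiconvex a b (s : R) : 0 <= s <= 1 ->
  reg ((1 - s) *: a + s *: b) <= (1 - s) * reg a + s * reg b + s * (1 - s) * dot (a - b) (a - b) / (2 * t).
Proof.
move=> /andP[s0 s1]; have s1' : 0 <= 1 - s by lra.
set x := (1 - s) *: a + s *: b.
pose za := reg_pt a; pose zb := reg_pt b; pose z := (1 - s) *: za + s *: zb.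
apply: le_trans (reg_le x z) _.
set y := supc_pt z.
have Ha := ler_wpM2l s1' (supc_ge za (supc_ptD z)).
have Hb := ler_wpM2l s0 (supc_ge zb (supc_ptD z)).
rewrite {1}/supc -/y /reg -/za -/zb; rewrite -/y in Ha Hb.
pose Q x z := - (dot (z - y) (z - y) / (4 * t)) + dot (x - z) (x - z) / (2 * t) + dot x x / (2 * t).
have QE x' z' : Q x' z' = (dot (z' - 2 *: x') (z' - 2 *: x') + 2 * dot z' y - dot y y) / (4 * t).
  rewrite /Q !dot_distE !dotZr !dotZl (dotC z' x'); field; rewrite gt_eqF//.
have QC : Q x z <= (1 - s) * Q a za + s * Q b zb.
  rewrite !QE; have -> : z - 2 *: x = (1 - s) *: (za - 2 *: a) + s *: (zb - 2 *: b).
    by apply/rowP => i; rewrite !mxE; ring.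
  rewrite dot_comb.
  have -> : dot z y = (1 - s) * dot za y + s * dot zb y by rewrite dotDl !dotZl.
  set P := dot (_ - _ - _) _; have P0 : 0 <= P by exact: dotxx_ge0.
  rewrite !mulrA -mulrDl ler_pM2r ?invr_gt0//.
  have : 0 <= s * (1 - s) * P by rewrite !mulr_ge0.
  lra.
have xx : dot x x = (1 - s) * dot a a + s * dot b b - s * (1 - s) * dot (a - b) (a - b).
  exact: dot_comb.
rewrite /Q xx in QC.
set q1 := dot (z - y) _ in QC *; set q2 := dot (x - z) _ in QC *.
set q3 := dot (za - y) _ in QC Ha; set q4 := dot (a - za) _ in QC *.
set q5 := dot (zb - y) _ in QC Hb; set q6 := dot (b - zb) _ in QC *.
have e1 : ((1 - s) * dot a a + s * dot b b - s * (1 - s) * dot (a - b) (a - b)) / (2 * t) =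
  (1 - s) * (dot a a / (2 * t)) + s * (dot b b / (2 * t)) - s * (1 - s) * dot (a - b) (a - b) / (2 * t) by ring.
rewrite e1 in QC; lra.
Qed.

(** Semiconvexity on the segment from [x - s *: h] to [x + h] combined with the upper
    parabola of [x] evaluated at [x - s *: h], letting [s] tend to zero. *)
Lemma reg_lower x h : reg x + dot (regD x) h - dot h h / (2 * t) <= reg (x + h).
Proof.
apply/ler_addgt0Pr => e e0.
pose q := dot h h / (2 * t); have q0 : 0 <= q by rewrite divr_ge0 ?dotxx_ge0 ?(ltW t2).
pose s := Num.min 1 (e / (2 * q + 1)).
have s0 : 0 < s by rewrite lt_min ltr01 divr_gt0// ltr_wpDl// mulr_ge0.
have sq : 2 * s * q <= e.
  have : s <= e / (2 * q + 1) by rewrite ge_min lexx orbT.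
  rewrite ler_pdivlMr; last by rewrite ltr_wpDl// mulr_ge0.
  by have := ltW s0; lra.
pose s' := s / (1 + s).
have s1' : 0 < 1 + s by lra.
have s'01 : 0 <= s' <= 1.
  by rewrite /s' divr_ge0 ?(ltW s0) ?(ltW s1')//= ler_pdivrMr// mul1r lerDr.
have := reg_semiconvex (x - s *: h) (x + h) s'01.
have -> : (1 - s') *: (x - s *: h) + s' *: (x + h) = x.
  by apply/rowP => i; rewrite !mxE /s'; field; rewrite gt_eqF.
have -> : x - s *: h - (x + h) = - ((1 + s) *: h) by apply/rowP => i; rewrite !mxE; ring.
rewrite dotNl dotNr opprK dotZl dotZr => h1.
have h2 := reg_upper x (- (s *: h)).
rewrite (dotNr (regD x)) (dotZr s (regD x)) dotNl dotNr opprK (dotZl s h) dotZr in h2.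
have E1 : s' * (1 - s') * ((1 + s) * ((1 + s) * dot h h)) / (2 * t) = s * q.
  by rewrite /s' /q; field; rewrite !gt_eqF.
have E2 : s * (s * dot h h) / (2 * t) = s ^+ 2 * q by rewrite /q; ring.
rewrite E1 in h1; rewrite E2 in h2.
have h3 : (1 + s) * reg x <= reg (x - s *: h) + s * reg (x + h) + (1 + s) * (s * q).
  have -> : reg (x - s *: h) + s * reg (x + h) + (1 + s) * (s * q) =
    (1 + s) * ((1 - s') * reg (x - s *: h) + s' * reg (x + h) + s * q).
    by rewrite /s'; field; rewrite gt_eqF.
  by rewrite ler_pM2l.
have h4 : s * (reg x + dot (regD x) h - q) <= s * (reg (x + h) + 2 * s * q).
  have : s * reg x + s * dot (regD x) h <= s * reg (x + h) + s * q + 2 * s ^+ 2 * q by lra.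
  lra.
have : reg x + dot (regD x) h - q <= reg (x + h) + 2 * s * q by rewrite ler_pM2l in h4.
rewrite -/q; lra.
Qed.

Lemma reg_c11 x h : `|reg (x + h) - reg x - dot (regD x) h| <= (2 * t)^-1 * dot h h.
Proof.
have h1 := reg_upper x h; have h2 := reg_lower x h; rewrite ![dot h h / _]mulrC in h1 h2.
by rewrite ler_norml; apply/andP; split; lra.
Qed.

(** Where [reg] is touched from above by a parabola of opening smaller than
    [1 / t] it coincides with the sup-convolution [sup_y u y - |x - y|^2 / (2 t)],
    the maximum being attained at [x + t *: regD x]. *)
Lemma reg_contact x (c r : R) : c < (2 * t)^-1 -> 0 < r ->
  (forall h, `|h| < r -> reg (x + h) <= reg x + dot (regD x) h + c * dot h h) ->
  D (x + t *: regD x) /\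
  reg x = u (x + t *: regD x) - t / 2 * dot (regD x) (regD x).
Proof.
move=> ct r0 touch.
pose z := reg_pt x; pose y := supc_pt z.
(* [z] and [y] are the points selected by the two convolutions; [reg] is bounded below at
   their midpoint [x1] by the value of its upper parabola, so [x1 <> x] would force [reg] to
   coincide with that parabola on the whole segment from [x] to [x1]. *)
pose x1 := 2^-1 *: (z + y); pose k := x1 - x.
have zE : z = x - t *: regD x by rewrite /regD scalerA mulfV ?gt_eqF// scale1r -/z opprB addrC subrK.
have x1E : x + k = x1 by rewrite /k addrC subrK.
have w1 : supc z + dot (x1 - z) (x1 - z) / (2 * t) <= reg x1.
  apply: le_trans (reg_ge x1 (supc_ptD z)); rewrite {1}/supc -/y.
  have -> : x1 - z = 2^-1 *: (y - z) by apply/rowP => i; rewrite !mxE; field.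
  have -> : x1 - y = 2^-1 *: (z - y) by apply/rowP => i; rewrite !mxE; field.
  rewrite !dotZl !dotZr -(opprB z y) dotNl dotNr opprK.
  by rewrite le_eqVlt; apply/orP; left; apply/eqP; field; rewrite gt_eqF.
have k0 : k = 0.
  clearbody k x1.
  apply: dotxx_eq0; apply/eqP; rewrite eq_le dotxx_ge0 andbT leNgt; apply/negP => kk.
  have nk : 0 < `|k| + 1 by rewrite ltr_wpDl.
  pose s := Num.min 1 (r / (`|k| + 1)).
  have s0 : 0 < s by rewrite lt_min ltr01 divr_gt0.
  have s01 : 0 <= s <= 1 by rewrite ltW//= ge_min lexx.
  have sk : `|s *: k| < r.
    rewrite norm_rVZ gtr0_norm//.
    have : s <= r / (`|k| + 1) by rewrite ge_min lexx orbT.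
    rewrite ler_pdivlMr// => /(lt_le_trans _); apply.
    by rewrite ltr_pM2l// ltrDl.
  have h1 := reg_concave x k s01; rewrite x1E in h1.
  have h2 := touch _ sk; rewrite (dotZr s (regD x)) (dotZl s k) (dotZr s k) in h2.
  have h3 := ler_wpM2l (ltW s0) w1.
  have E : dot (x1 - z) (x1 - z) / (2 * t) =
     (reg x - supc z) + dot (regD x) k + dot k k / (2 * t).
    have -> : x1 - z = (x - z) + k by rewrite -x1E addrAC.
    rewrite /reg /regD -/z dotZl; move: (x - z) => a.
    rewrite dotDl !dotDr (dotC k a); field; rewrite gt_eqF//.
  rewrite E in h3.
  have h4 : s ^+ 2 * (dot k k / (2 * t)) <= s ^+ 2 * (c * dot k k).
    have -> : s ^+ 2 * (c * dot k k) = c * (s * (s * dot k k)) by ring.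
    have e1 : s * (1 - s) * dot k k / (2 * t) = s * (dot k k / (2 * t)) - s ^+ 2 * (dot k k / (2 * t)) by ring.
    rewrite e1 in h1; lra.
  rewrite ler_pM2l ?exprn_gt0// mulrC ler_pM2r// in h4.
  by move: ct; rewrite ltNge h4.
have yE : y = x + t *: regD x.
  have xx1 : x = x1 by rewrite -x1E k0 addr0.
  have : y = 2 *: x - z by rewrite {1}xx1 /x1 scalerA mulfV// scale1r addrC addKr.
  by rewrite zE => ->; apply/rowP => i; rewrite !mxE; ring.
rewrite -yE; split; first exact: supc_ptD.
have : x1 = x by rewrite -x1E k0 addr0.
rewrite {1}/reg -/z {1}/supc -/y => _.
have -> : z - y = - (2 * t) *: regD x by rewrite yE zE; apply/rowP => i; rewrite !mxE; ring.
have -> : x - z = t *: regD x by rewrite zE; apply/rowP => i; rewrite !mxE; ring.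
rewrite !dotZl !dotZr; field; rewrite gt_eqF//.
Qed.

End regularisation.

(** * Traces and the maximal operator *)

Section trace.
Context {R : realType} {n : nat}.
Implicit Types (A S X : 'M[R]_n) (h e : 'rV[R]_n).

Lemma mxtrace_rank1 S h : \tr (h^T *m h *m S) = qf S h.
Proof. by rewrite -mulmxA mxtrace_mulC /qf -trace_mx11. Qed.

Lemma qf_rank1 e h : qf (e^T *m e) h = dot h e ^+ 2.
Proof.
rewrite qfE mulmxA [h *m _]mx11_scalar mul_scalar_mx mulmx_trE dotZl (dotC e).
by rewrite expr2.
Qed.

(** Completing squares one variable at a time writes a positive semidefinite
    matrix as a sum of rank one matrices [r^T *m r]. *)
Lemma mxtrace_psd_ge0 A S : A^T = A -> (forall h, 0 <= qf A h) -> (forall h, 0 <= qf S h) ->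
  0 <= \tr (A *m S).
Proof.
move=> + + S0; suff H k : forall A, A^T = A -> (forall h, 0 <= qf A h) ->
    (forall i j : 'I_n, (k <= i)%N -> A i j = 0) -> 0 <= \tr (A *m S).
  by move=> sA A0; apply: (H n) => // i j; rewrite leqNgt ltn_ord.
elim: k => [|k IH] {}A sA A0 Az.
  have -> : A = 0 by apply/matrixP => i j; rewrite Az// mxE.
  by rewrite mul0mx mxtrace0.
have As i j : A i j = A j i by rewrite -{1}sA mxE.
have [kn|nk] := ltnP k n; last first.
  by apply: IH => // i j ki; move: (ltn_ord i); rewrite ltnNge (leq_trans nk).
pose i := Ordinal kn; pose e : 'rV[R]_n := delta_mx 0 i.
pose r := row i A.
have hAe h : dot (h *m A) e = dot h r.
  rewrite dot_delta mxE; apply: eq_bigr => j _; rewrite !mxE As//.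
have qe : qf A e = A i i.
  rewrite qfE dot_delta mxE (bigD1 i)//= big1 ?addr0 => [|j ji]; first by rewrite mxE !eqxx mul1r.
  by rewrite mxE (negbTE ji) andbF mul0r.
have qline h (s : R) : qf A (h + s *: e) = qf A h + 2 * s * dot h r + s ^+ 2 * A i i.
  by rewrite qf_add// dotZr hAe qf_scale qe; ring.
have Aii : 0 <= A i i by rewrite -qe.
have [Ai0|Ai0] := eqVneq (A i i) 0.
  apply: IH => // j l; rewrite leq_eqVlt => /orP[/eqP kj|kj]; last exact: Az.
  have -> : j = i by apply: val_inj; rewrite /= kj.
  have rl : dot (delta_mx 0 l) r = A i l by rewrite dotC dot_delta mxE.
  apply/eqP/negPn/negP => Ail.
  have := A0 (delta_mx 0 l + (- (qf A (delta_mx 0 l) + 1) / (2 * A i l)) *: e).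
  rewrite qline rl Ai0 mulr0 addr0.
  have -> : 2 * (- (qf A (delta_mx 0 l) + 1) / (2 * A i l)) * A i l = - (qf A (delta_mx 0 l) + 1).
    by field; rewrite Ail.
  by rewrite opprD addrA subrr sub0r oppr_ge0 leNgt ltr01.
have Ap : 0 < A i i by rewrite lt_neqAle eq_sym Ai0.
pose A' := A - (A i i)^-1 *: (r^T *m r).
have E : A = A' + (A i i)^-1 *: (r^T *m r) by rewrite subrK.
have -> : \tr (A *m S) = \tr (A' *m S) + (A i i)^-1 * qf S r.
  by rewrite {1}E mulmxDl mxtraceD -scalemxAl mxtraceZ mxtrace_rank1.
rewrite addr_ge0//; last by rewrite mulr_ge0// invr_ge0.
apply: IH.
- by rewrite linearB/= sA linearZ/= trmx_mul trmxK.
- move=> h; have := A0 (h + (- dot h r / A i i) *: e); rewrite qline.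
  have -> : qf A' h = qf A h - (A i i)^-1 * dot h r ^+ 2.
    have EA : qf A h = qf A' h + (A i i)^-1 * dot h r ^+ 2.
      by rewrite -qf_rank1 -qfZ -qfD -E.
    by rewrite EA addrK.
  have -> : qf A h + 2 * (- dot h r / A i i) * dot h r + (- dot h r / A i i) ^+ 2 * A i i =
    qf A h - (A i i)^-1 * dot h r ^+ 2 by field.
  by [].
- move=> j l; rewrite leq_eqVlt => /orP[/eqP kj|kj].
    have -> : j = i by apply: val_inj; rewrite /= kj.
    rewrite !mxE big_ord1 !mxE; field; exact: Ai0.
  by rewrite !mxE big_ord1 !mxE (Az j)// (As i j) (Az j)// mul0r mulr0 subrr.
Qed.

Lemma sqr_dot_unit_le e h : dot e e = 1 -> dot h e ^+ 2 <= dot h h.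
Proof.
move=> e1; have := dotxx_ge0 (h - dot h e *: e).
by rewrite dot_distE !dotZr dotZl e1; lra.
Qed.

(** For [T = a - S], which is positive, [tr (A T) >= lambda tr T >= lambda qf T e]
    whenever [lambda <= A]: a single very negative direction of [S] makes the maximal
    operator negative. *)
Lemma pucci_sup_le (lambda Lambda a b : R) e S : 0 < lambda -> lambda <= Lambda ->
  0 <= a -> dot e e = 1 -> (forall k, qf S k <= a * dot k k) -> qf S e <= a - b ->
  pucci_sup lambda Lambda S <= a * (n%:R * Lambda) - b * lambda.
Proof.
move=> l0 lL a0 e1 Sle Se; rewrite /pucci_sup; apply: ge_sup.
  exists (\tr (lambda%:M *m S)), lambda%:M => //; split; first by rewrite /symmx tr_scalar_mx.
    by move=> v; exact: lexx.
  by move=> v; rewrite -/(qf _ _) -/(qf _ _) !qf_scalar ler_wpM2r// dotxx_ge0.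
move=> _ [A [sA lA AL] <-].
have qA0 h : lambda * dot h h <= qf A h by have := lA h; rewrite -/(qf _ _) -/(qf _ _) qf_scalar.
have qAL h : qf A h <= Lambda * dot h h by have := AL h; rewrite -/(qf _ _) -/(qf _ _) qf_scalar.
pose T : 'M[R]_n := a%:M - S.
have T0 h : 0 <= qf T h by rewrite qfB qf_scalar subr_ge0.
have trT : b <= \tr T.
  have : 0 <= \tr ((1%:M - e^T *m e) *m T).
    apply: mxtrace_psd_ge0 => // [|h]; first by rewrite linearB/= tr_scalar_mx trmx_mul trmxK.
    by rewrite qfB qf_scalar qf_rank1 mul1r subr_ge0 sqr_dot_unit_le.
  rewrite mulmxBl mul1mx raddfB/= mxtrace_rank1 qfB qf_scalar e1; lra.
have trAT : lambda * \tr T <= \tr (A *m T).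
  rewrite -subr_ge0 -mxtraceZ -mul_scalar_mx -raddfB/= -mulmxBl.
  apply: mxtrace_psd_ge0 => // [|h]; first by rewrite linearB/= tr_scalar_mx sA.
  by rewrite qfB qf_scalar subr_ge0.
have E : \tr (A *m S) = a * \tr A - \tr (A *m T).
  by rewrite /T mulmxBr raddfB/= mul_mx_scalar mxtraceZ; ring.
have trA : \tr A <= n%:R * Lambda.
  rewrite /mxtrace -[n in leRHS]card_ord mulr_natl -sumr_const; apply: ler_sum => i _.
  have := qAL (delta_mx 0 i); rewrite dot_delta !mxE !eqxx mulr1 qfE dot_delta mxE.
  rewrite (bigD1 i)//= big1 ?addr0 => [|j ji]; first by rewrite mxE !eqxx mul1r.
  by rewrite mxE (negbTE ji) andbF mul0r.
have h1 : a * \tr A <= a * (n%:R * Lambda) by rewrite ler_wpM2l.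
have h2 : b * lambda <= lambda * \tr T by rewrite mulrC ler_pM2l.
rewrite E; lra.
Qed.

End trace.

(** * Second order conditions at almost every contact point *)

Section expanding.
Context {R : realType} {n : nat}.
Local Notation mu := (lebesgue_rV R n).
Variable T : 'rV[R]_n -> 'rV[R]_n.

(** On a small cell the map [T], restricted to points at which it expands
    distances at a uniform rate, has a Lipschitz inverse. *)
Lemma expanding_preimage_negligible (N : set 'rV[R]_n) : (0 < n)%N -> mu.-negligible N ->
  mu.-negligible [set x | N (T x) /\ exists c : R, exists2 r : R, 0 < r &
     forall h, `|h| < r -> `|h| <= c * `|T (x + h) - T x| ].
Proof.
move=> n0 N0.
pose E (m : nat) := [set x | N (T x) /\
   forall h, `|h| < m.+1%:R^-1 -> `|h| <= m%:R * `|T (x + h) - T x|].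
pose G (q : nat * 'rV[int]_n) := E q.1 `&` dcell q.1.+1 q.2.
apply: (@negligibleS _ _ _ _ (\bigcup_q G q)); last first.
  apply: negligible_countable_bigcup => -[m z].
  have inj x y : G (m, z) x -> G (m, z) y -> `|x - y| <= m%:R * `|T x - T y|.
    move=> [[_ Ex] zx] [_ zy].
    have : `|y - x| < 2 ^- m.+1.
      apply/cubeP; first by rewrite invr_gt0 exprn_gt0.
      by apply: dcell_sub_cube_pt; rewrite /dcell /= zx zy.
    have h2 : (2 : R) ^- m.+1 <= m.+1%:R^-1.
      by rewrite lef_pV2 ?posrE ?exprn_gt0// -natrX ler_nat ltnW// ltn_expl.
    move=> /lt_le_trans/(_ h2)/Ex; rewrite subrKC.
    by rewrite distrC [`|T y - _|]distrC.
  pose psi y := if pselect (exists2 x, G (m, z) x & T x = y) is left H then s2val (cid2 H) else 0.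
  have psiK x : G (m, z) x -> psi (T x) = x.
    move=> Gx; rewrite /psi; case: pselect => [H|[]]; last by exists x.
    case: cid2 => x' /= Gx' Tx'; apply/eqP; rewrite -subr_eq0 -normr_le0.
    by apply: le_trans (inj _ _ Gx' Gx) _; rewrite Tx' subrr normr0 mulr0.
  have TG0 : mu.-negligible (T @` G (m, z)).
    by apply: negligibleS N0 => _ [x [[Nx _] _] <-].
  apply: (negligibleS _ (@lipschitz_negligible R n _ psi m%:R n0 _ TG0)).
    by move=> x Gx; exists (T x); [exists x|exact: psiK].
  by move=> _ _ [x Gx <-] [y Gy <-]; rewrite !psiK//; exact: inj.
move=> x [Nx [c [r r0 hr]]].
pose m := maxn (Num.truncn r^-1) (Num.truncn `|c|).+1.
exists (m, dyad m.+1 x) => //; split => //; split => //= h hm.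
have hr' : `|h| < r.
  apply: lt_trans hm _; rewrite -(@ltf_pV2 _ r) ?posrE ?invr_gt0// invrK.
  by apply: lt_le_trans (truncnS_gt _) _; rewrite ler_nat ltnS leq_maxl.
apply: le_trans (hr h hr') _; rewrite ler_wpM2r//.
apply: le_trans (ler_norm c) _; apply/ltW/(lt_le_trans (truncnS_gt _)).
by rewrite ler_nat leq_maxr.
Qed.

End expanding.

Section visc_quad.
Context {R : realType} {n : nat}.
Variables (F : 'M[R]_n -> R) (q : R) (f : 'rV[R]_n -> R) (O : set 'rV[R]_n).

(** Only second order expansions at single points are ever used as tests. *)
Definition quad_subsolution (u : 'rV[R]_n -> R) := forall y p (X : 'M[R]_n), O y -> X^T = X ->
  (exists2 r : R, 0 < r & forall k, `|k| < r -> u (y + k) <= u y + dot p k + qf X k / 2) ->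
  f y <= enorm p `^ q * F X.

Lemma enormE (p : 'rV[R]_n) : enorm p = Num.sqrt (dot p p).
Proof. by []. Qed.

(** The source of the uniformity in [q]: a factor that is at least one makes a negative
    number smaller, whatever the exponent. *)
Lemma powR_mul_lb (p : 'rV[R]_n) (c a : R) : 0 <= q -> 1 <= dot p p ->
  c <= enorm p `^ q * a -> c <= 0 -> c <= a.
Proof.
move=> q0 p1 h c0; have [a0|a0] := leP 0 a; first exact: le_trans c0 a0.
apply: le_trans h _; rewrite -[leRHS]mul1r; apply: ler_wnM2r; first exact: ltW.
have {1}-> : 1 = 1 `^ q :> R by rewrite powR1.
apply: ge0_ler_powR => //; rewrite ?nnegrE//; first exact: sqrtr_ge0.
by rewrite enormE -[leLHS]sqrtr1 ler_wsqrtr.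
Qed.

End visc_quad.

Section good_points.
Context {R : realType} {n : nat}.
Local Notation mu := (lebesgue_rV R n).
Variables (lambda Lambda : R) (F : 'M[R]_n -> R) (q : R) (f : 'rV[R]_n -> R).
Variables (O D : set 'rV[R]_n) (u : 'rV[R]_n -> R) (t K : R).
Hypotheses (l0 : 0 < lambda) (lL : lambda <= Lambda).
Hypothesis Fell : forall M N, M^T = M -> N^T = N -> F M - F N <= pucci_sup lambda Lambda (M - N).
Hypotheses (q0 : 0 <= q) (K0 : 0 <= K) (n0 : (0 < n)%N).
Hypotheses (D0 : D !=set0) (cD : compact D) (uc : {within D, continuous u}) (t0 : 0 < t).
Hypotheses (oO : open O) (OD : O `<=` D).
Hypothesis usub : quad_subsolution F q f O u.
Hypothesis fK : mu.-negligible [set x | O x /\ f x < - K].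

Let w := reg D0 cD uc t0.
Let Dw := regD D0 cD uc t0.
Let T x := x + t *: Dw x.

(** Moving by [h] at [x] is paid by the touching parabola at [T x]; choosing [h]
    as a linear function [k *m H] of the displacement [k] gives a quadratic test
    function. *)
Let transfer x (X H : 'M[R]_n) (eta : R) : 0 < eta -> peano w x (Dw x) X ->
  O (T x) -> w x = u (T x) - t / 2 * dot (Dw x) (Dw x) ->
  exists2 r : R, 0 < r & forall k, `|k| < r ->
    u (T x + k) <= u (T x) + dot (Dw x) k +
      (qf X (k *m H) / 2 + eta * dot (k *m H) (k *m H) + dot (k *m H - k) (k *m H - k) / (2 * t)).
Proof.
move=> eta0 pX OT wx.
have [r r0 hr] := pX eta eta0.
have /nbhs_ballP[r' /= r'0 Br'] : nbhs (T x) O by exact: open_nbhs_nbhs.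
pose M := (\sum_i \sum_j `|H j i|) + 1; have M0 : 0 < M.
  by rewrite /M ltr_wpDl// sumr_ge0// => i _; rewrite sumr_ge0.
have kH (k : 'rV[R]_n) : `|k *m H| <= M * `|k|.
  apply: norm_rV_le; first by rewrite mulr_ge0// ltW.
  move=> i; rewrite mxE; apply: (le_trans (ler_norm_sum _ _ _)).
  apply: (@le_trans _ _ (\sum_j `|H j i| * `|k|)).
    by apply: ler_sum => j _; rewrite normrM mulrC ler_wpM2l// coord_le_norm.
  rewrite -mulr_suml ler_wpM2r// /M [in leRHS](bigD1 i)//= -addrA lerDl addr_ge0//.
  by rewrite sumr_ge0// => l _; rewrite sumr_ge0.
exists (Num.min r' (r / M)); first by rewrite lt_min r'0 divr_gt0.
move=> k; rewrite lt_min => /andP[kr' kr].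
set h := k *m H.
have hrr : `|h| < r by apply: le_lt_trans (kH k) _; rewrite mulrC -ltr_pdivlMr.
have := hr h hrr; rewrite ler_norml => /andP[_ h1].
have DTk : D (T x + k).
  apply: OD; apply: Br'; rewrite -ball_normE /=.
  have -> : T x - (T x + k) = - k by apply/rowP => i; rewrite !mxE; ring.
  by rewrite normrN.
have h2 : u (T x + k) - dot (x + h - (T x + k)) (x + h - (T x + k)) / (2 * t) <= w (x + h).
  exact: reg_ge.
have E : dot (x + h - (T x + k)) (x + h - (T x + k)) / (2 * t) =
   dot (h - k) (h - k) / (2 * t) - dot (Dw x) h + dot (Dw x) k + t / 2 * dot (Dw x) (Dw x).
  have -> : x + h - (T x + k) = (h - k) - t *: Dw x by rewrite /T; apply/rowP => i; rewrite !mxE; ring.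
  rewrite [in LHS]dot_distE (dotZr t (h - k)) (dotZl t (Dw x)) (dotZr t (Dw x)) (dotC _ (Dw x)).
  by rewrite (dotBr (Dw x) h k); field; rewrite gt_eqF.
rewrite E in h2; lra.
Qed.

Let small (h : 'rV[R]_n) (r : R) : 0 < r -> exists2 s : R, 0 < s & `|s *: h| < r.
Proof.
move=> r0; have nh : 0 < `|h| + 1 by rewrite ltr_wpDl.
exists (r / (`|h| + 1)); first by rewrite divr_gt0.
rewrite norm_rVZ gtr0_norm ?divr_gt0// mulrAC ltr_pdivrMr// ltr_pM2l//.
by rewrite ltrDl.
Qed.

Let peano_psd x (X : 'M[R]_n) h : peano w x (Dw x) X -> 0 <= dot h h + t * qf X h.
Proof.
move=> pX; apply/ler_addgt0Pr => e e0.
have hh := dotxx_ge0 h.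
pose e' := e / (2 * t * dot h h + 1).
have d0 : 0 < 2 * t * dot h h + 1 by rewrite ltr_wpDl// mulr_ge0// mulr_ge0// ltW.
have e'0 : 0 < e' by rewrite divr_gt0.
have [r r0 hr] := pX e' e'0.
have [s s0 sh] := small h r0.
have := hr _ sh; rewrite ler_norml => /andP[_].
have := reg_lower D0 cD uc t0 x (s *: h); rewrite -/w -/Dw.
rewrite (dotZr s (Dw x)) (dotZl s h) (dotZr s h) qf_scale => h1 h2.
have h3 : 0 <= s ^+ 2 * (qf X h / 2 + dot h h / (2 * t) + e' * dot h h).
  have -> : s ^+ 2 * (qf X h / 2 + dot h h / (2 * t) + e' * dot h h) =
    s ^+ 2 * qf X h / 2 + s * (s * dot h h) / (2 * t) + e' * (s * (s * dot h h)) by ring.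
  lra.
rewrite pmulr_rge0 ?exprn_gt0// in h3.
have h4 : 0 <= 2 * t * (qf X h / 2 + dot h h / (2 * t) + e' * dot h h).
  by rewrite mulr_ge0// mulr_ge0// ltW.
have E : 2 * t * (qf X h / 2 + dot h h / (2 * t) + e' * dot h h) =
  dot h h + t * qf X h + e' * (2 * t * dot h h) by field; rewrite gt_eqF.
rewrite E in h4; apply: le_trans h4 _; rewrite lerD2l /e' mulrAC ler_pdivrMr//.
by rewrite ler_pM2l// lerDl.
Qed.

Let peano_expanding x (X : 'M[R]_n) (c : R) : peano w x (Dw x) X -> 0 < c ->
  (forall h, c * dot h h <= dot h h + t * qf X h) ->
  exists c' : R, exists2 r : R, 0 < r & forall h, `|h| < r -> `|h| <= c' * `|T (x + h) - T x|.
Proof.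
move=> pX c0 cX; have ct : 0 < c / (4 * t) by rewrite divr_gt0// mulr_gt0.
have [r r0 hr] := pX _ ct; exists (4 * n%:R / c), r => // h hh.
have := hr h hh; rewrite ler_norml => /andP[h1 _].
have := reg_lower D0 cD uc t0 (x + h) (- h); rewrite -/w -/Dw addrK.
rewrite (dotNr (Dw (x + h))) (dotNl h) (dotNr h) opprK => h2.
have TE : dot (T (x + h) - T x) h = dot h h + t * dot (Dw (x + h)) h - t * dot (Dw x) h.
  have -> : T (x + h) - T x = h + t *: Dw (x + h) - t *: Dw x.
    by rewrite /T; apply/rowP => i; rewrite !mxE; ring.
  by rewrite dotBl (dotDl h) (dotZl t (Dw (x + h))) (dotZl t (Dw x)).
have key : c / 4 * dot h h <= dot (T (x + h) - T x) h.
  have h3 : t * (qf X h / 2 - c / (4 * t) * dot h h - dot h h / (2 * t)) <=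
     t * (dot (Dw (x + h)) h - dot (Dw x) h) by rewrite ler_pM2l//; lra.
  have E : t * (qf X h / 2 - c / (4 * t) * dot h h - dot h h / (2 * t)) =
     t * qf X h / 2 - c / 4 * dot h h - dot h h / 2 by field; rewrite gt_eqF.
  rewrite E in h3; rewrite TE; have := cX h; lra.
have [->|hn0] := eqVneq h 0; first by rewrite normr0 mulr_ge0// divr_ge0 ?mulr_ge0// ltW.
have nh : 0 < `|h| by rewrite normr_gt0.
have h4 : c / 4 * `|h| ^+ 2 <= n%:R * `|T (x + h) - T x| * `|h|.
  apply: (@le_trans _ _ (c / 4 * dot h h)).
    by rewrite ler_wpM2l ?normsq_le_dotxx// divr_ge0// ltW.
  by apply: le_trans key _; apply: le_trans (ler_norm _) _; exact: dot_le_normM.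
rewrite expr2 mulrA ler_pM2r// in h4.
have -> : 4 * n%:R / c * `|T (x + h) - T x| = (n%:R * `|T (x + h) - T x|) / (c / 4).
  by field; rewrite gt_eqF.
by rewrite ler_pdivlMr ?divr_gt0// mulrC.
Qed.

(** If [1 + t X] degenerates then [u] is touched from above at [T x] by
    quadratic polynomials whose Hessian is bounded above and arbitrarily negative in one
    direction; this is where the finiteness of [f] at the point [T x] enters. *)
Let nondegenerate x (X : 'M[R]_n) : X^T = X -> peano w x (Dw x) X -> O (T x) ->
  w x = u (T x) - t / 2 * dot (Dw x) (Dw x) -> 1 <= dot (Dw x) (Dw x) ->
  exists2 c : R, 0 < c & forall h, c * dot h h <= dot h h + t * qf X h.
Proof.
move=> sX pX OT wx p1; apply: contrapT => nc.
pose MB := 1 + t * \sum_i \sum_j `|X i j|.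
have MB0 : 0 <= MB.
  by rewrite addr_ge0// mulr_ge0 ?(ltW t0)// sumr_ge0// => i _; rewrite sumr_ge0.
have qBM h : dot h h + t * qf X h <= MB * dot h h.
  have /ler_normlP[_] := qf_bound X h.
  by move=> /(ler_wpM2l (ltW t0)); rewrite /MB mulrDl mul1r lerD2l -mulrA.
pose a := (2 * MB + 2) / t + 1.
have a0 : 0 <= a by rewrite addr_ge0// divr_ge0 ?(ltW t0)// addr_ge0// mulr_ge0.
have L0 : 0 <= Lambda := le_trans (ltW l0) lL.
pose c1 := `|F 0| + a * (n%:R * Lambda) + `|f (T x)| + 1.
have c10 : 0 <= c1 by rewrite !addr_ge0// !mulr_ge0.
pose s := 1 + t * c1 / (2 * lambda).
have s1 : 1 <= s by rewrite lerDl divr_ge0 ?mulr_ge0 ?(ltW t0) ?(ltW l0).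
have s0 : 0 < s by lra.
have [e e1 qe] : exists2 e : 'rV[R]_n, dot e e = 1 & s ^+ 2 * (dot e e + t * qf X e) <= 1.
  have [h hc] : exists h, dot h h + t * qf X h < s ^- 2 * dot h h.
    apply: contrapT => nh; apply: nc; exists (s ^- 2); first by rewrite invr_gt0 exprn_gt0.
    by move=> h; rewrite leNgt; apply/negP => hh; apply: nh; exists h.
  have hh : 0 < dot h h.
    rewrite lt_neqAle dotxx_ge0 andbT eq_sym; apply/eqP => h0.
    by have := peano_psd h pX; rewrite leNgt (lt_le_trans hc)// h0 mulr0.
  pose g := (Num.sqrt (dot h h))^-1.
  have g2 : g ^+ 2 = (dot h h)^-1 by rewrite exprVn sqr_sqrtr// ltW.
  have gE : dot (g *: h) (g *: h) = 1.
    by rewrite dotZl dotZr mulrA -expr2 g2 mulVf// gt_eqF.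
  exists (g *: h) => //; rewrite gE qf_scale g2.
  have -> : s ^+ 2 * (1 + t * ((dot h h)^-1 * qf X h)) =
     (s ^+ 2 / dot h h) * (dot h h + t * qf X h) by field; rewrite gt_eqF.
  apply: (@le_trans _ _ ((s ^+ 2 / dot h h) * (s ^- 2 * dot h h))).
    by rewrite ler_wpM2l ?(ltW hc)// divr_ge0 ?(ltW hh)// sqr_ge0.
  by rewrite le_eqVlt; apply/orP; left; apply/eqP; field; rewrite !gt_eqF.
(* [H] stretches by [1 + s] the direction [e], in which [1 + t X] is at most [s ^- 2]: the test
   function then has Hessian at most of order [- s / t] along [e]. *)
pose H : 'M[R]_n := 1%:M + s *: (e^T *m e).
have kH k : k *m H = k + (s * dot k e) *: e.
  rewrite mulmxDr mulmx1 -scalemxAr mulmxA [k *m _]mx11_scalar mulmx_trE.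
  by rewrite mul_scalar_mx scalerA.
pose eta := (4 * (1 + s ^+ 2))^-1.
have s2 : 0 < 1 + s ^+ 2 by rewrite ltr_pwDl// sqr_ge0.
have eta0 : 0 < eta by rewrite invr_gt0 mulr_gt0.
have [r r0 hr] := @transfer x X H eta eta0 pX OT wx.
pose Z := H *m X *m H^T + (2 * eta) *: (H *m H^T) + t^-1 *: ((H - 1%:M) *m (H - 1%:M)^T).
have sHX : (H *m X *m H^T)^T = H *m X *m H^T by rewrite !trmx_mul trmxK sX mulmxA.
have sMM (M : 'M[R]_n) : (M *m M^T)^T = M *m M^T by rewrite trmx_mul trmxK.
have sZ : Z^T = Z.
  rewrite /Z [LHS]linearD/= [X in X + _]linearD/= [X in _ + X + _]linearZ/= [X in _ + X]linearZ/=.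
  by rewrite sHX !sMM.
have qHH (M : 'M[R]_n) k : qf (M *m M^T) k = dot (k *m M) (k *m M).
  by rewrite -mulmx_trE /qf !mulmxA trmx_mul mulmxA.
have qZ k : qf Z k = qf X (k *m H) + 2 * eta * dot (k *m H) (k *m H) +
    dot (k *m H - k) (k *m H - k) / t.
  rewrite /Z !qfD !qfZ !qHH mulmxBr mulmx1 [_ / t]mulrC; congr (_ + _ + _).
  by rewrite /qf trmx_mul !mulmxA.
have fZ : f (T x) <= enorm (Dw x) `^ q * F Z.
  apply: usub => //; exists r => // k kr; apply: le_trans (hr k kr) _.
  by rewrite lerD2l qZ le_eqVlt; apply/orP; left; apply/eqP; field; rewrite gt_eqF.
have cs k : dot k e ^+ 2 <= dot k k by exact: sqr_dot_unit_le.
have Zle k : qf Z k <= a * dot k k - (2 * s / t) * dot k e ^+ 2.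
  rewrite qZ kH; set d := dot k e.
  have E1 : dot (k + (s * d) *: e - k) (k + (s * d) *: e - k) = s ^+ 2 * d ^+ 2.
    rewrite addrC addKr dotZl dotZr e1; ring.
  have hh : dot (k + (s * d) *: e) (k + (s * d) *: e) = dot k k + 2 * s * d ^+ 2 + s ^+ 2 * d ^+ 2.
    rewrite !dotDl !dotDr !dotZl !dotZr e1 (dotC e k) -/d; ring.
  have qh : qf X (k + (s * d) *: e) = qf X k + 2 * (s * d) * dot (k *m X) e + (s * d) ^+ 2 * qf X e.
    by rewrite qf_add// dotZr qf_scale; ring.
  have par : (dot k k + 2 * s * d ^+ 2 + s ^+ 2 * d ^+ 2) + t * qf X (k + (s * d) *: e) <=
     2 * (dot k k + t * qf X k) + 2 * d ^+ 2 * (s ^+ 2 * (1 + t * qf X e)).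
    have := peano_psd (k - (s * d) *: e) pX.
    have -> : dot (k - (s * d) *: e) (k - (s * d) *: e) = dot k k - 2 * s * d ^+ 2 + s ^+ 2 * d ^+ 2.
      rewrite dot_distE !dotZl !dotZr e1 -/d; ring.
    have -> : qf X (k - (s * d) *: e) = qf X k - 2 * (s * d) * dot (k *m X) e + (s * d) ^+ 2 * qf X e.
      by rewrite -scaleNr qf_add// dotZr qf_scale; ring.
    rewrite qh; lra.
  have d2 : 0 <= d ^+ 2 by rewrite sqr_ge0.
  have dk : d ^+ 2 <= dot k k by exact: cs.
  rewrite e1 in qe.
  have h1 : d ^+ 2 * (s ^+ 2 * (1 + t * qf X e)) <= d ^+ 2 by rewrite -[leRHS]mulr1 ler_wpM2l.
  have h2 := qBM k.
  have h3 : dot (k + (s * d) *: e) (k + (s * d) *: e) <= 2 * (1 + s ^+ 2) * dot k k.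
    rewrite hh; have h4 : s ^+ 2 * d ^+ 2 <= s ^+ 2 * dot k k by rewrite ler_wpM2l// sqr_ge0.
    have h5 : 2 * s * d ^+ 2 <= (1 + s ^+ 2) * d ^+ 2.
      rewrite ler_wpM2r//; have := sqr_ge0 (s - 1); rewrite sqrrB1; lra.
    lra.
  have h6 : 2 * eta * dot (k + (s * d) *: e) (k + (s * d) *: e) <= dot k k.
    apply: (@le_trans _ _ (2 * eta * (2 * (1 + s ^+ 2) * dot k k))).
      by rewrite ler_wpM2l// mulr_ge0// ltW.
    by rewrite le_eqVlt /eta; apply/orP; left; apply/eqP; field; rewrite gt_eqF.
  have h7 : t * (qf X (k + (s * d) *: e) + s ^+ 2 * d ^+ 2 / t) <=
      t * ((2 * MB + 2) / t * dot k k - 2 * s / t * d ^+ 2).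
    have -> : t * (qf X (k + (s * d) *: e) + s ^+ 2 * d ^+ 2 / t) =
       t * qf X (k + (s * d) *: e) + s ^+ 2 * d ^+ 2 by field; rewrite gt_eqF.
    have -> : t * ((2 * MB + 2) / t * dot k k - 2 * s / t * d ^+ 2) =
       (2 * MB + 2) * dot k k - 2 * s * d ^+ 2 by field; rewrite gt_eqF.
    have := dotxx_ge0 k; lra.
  rewrite ler_pM2l// in h7.
  rewrite E1 /a; lra.
have b0 : 0 <= 2 * s / t by rewrite divr_ge0 ?mulr_ge0// ltW.
have Za k : qf Z k <= a * dot k k.
  by apply: (le_trans (Zle k)); rewrite gerBl mulr_ge0 ?sqr_ge0.
have Ze : qf Z e <= a - 2 * s / t by have := Zle e; rewrite e1 expr1n !mulr1.
have := pucci_sup_le l0 lL a0 e1 Za Ze.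
have := Fell sZ (trmx0 _ _ _); rewrite subr0 => h1 h2.
have E : 2 * s / t * lambda = 2 * lambda / t + c1 by rewrite /s; field; rewrite !gt_eqF.
have FZ : F Z <= - (`|f (T x)| + 1).
  have := le_trans h1 h2; rewrite E /c1; have := ler_norm (F 0).
  have : 0 <= 2 * lambda / t by rewrite divr_ge0 ?mulr_ge0// ltW.
  lra.
have h3 : - `|f (T x)| <= F Z.
  apply: (powR_mul_lb q0 p1 _ _); last by rewrite oppr_le0.
  by apply: le_trans fZ; rewrite lerNl -normrN ler_norm.
by have := le_trans h3 FZ; rewrite lerN2 gerDl ler10.
Qed.

(** Almost every point where [reg u] is touched from above by a not too open
    parabola yields a second order test function for [u] at a point where [f]
    satisfies its almost everywhere bound. *)
Lemma good_points : exists Z, mu.-negligible Z /\ forall x, ~ Z x ->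
  forall c r : R, c < (2 * t)^-1 -> 0 < r ->
  (forall h, `|h| < r -> w (x + h) <= w x + dot (Dw x) h + c * dot h h) ->
  O (x + t *: Dw x) -> 1 <= dot (Dw x) (Dw x) ->
  exists X : 'M[R]_n, [/\ X^T = X, peano w x (Dw x) X &
    forall eta : R, 0 < eta -> - K <= F (X + eta%:M)].
Proof.
pose Z1 := [set x | ~ exists2 X : 'M[R]_n, X^T = X & peano w x (Dw x) X].
pose Z2 := [set x | [set x | O x /\ f x < - K] (T x) /\ exists c : R, exists2 r : R, 0 < r &
     forall h, `|h| < r -> `|h| <= c * `|T (x + h) - T x| ].
exists (Z1 `|` Z2); split.
  apply: negligibleU_rV; last exact: expanding_preimage_negligible.
  by apply: (@c11_peano_ae R n w Dw (2 * t)^-1); [rewrite invr_ge0 mulr_ge0// ltW|exact: reg_c11].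
move=> x /not_orP[nZ1 nZ2] c r ct r0 touch OT p1.
have [X sX pX] := contrapT nZ1.
have [DT wx] := reg_contact ct r0 touch.
have [c0 c00 cX] := nondegenerate sX pX OT wx p1.
have fT : - K <= f (T x).
  rewrite leNgt; apply/negP => fT; apply: nZ2; split => //.
  exact: peano_expanding pX c00 cX.
exists X; split => // eta eta0.
have eta2 : 0 < eta / 2 by rewrite divr_gt0.
have [r' r'0 hr] := @transfer x X 1%:M (eta / 2) eta2 pX OT wx.
apply: (powR_mul_lb q0 p1 _ _); last by rewrite oppr_le0.
apply: le_trans fT _; apply: usub => //; first by rewrite linearD/= sX tr_scalar_mx.
exists r' => // k kr; apply: le_trans (hr k kr) _.
rewrite !mulmx1 subrr dot0l mul0r addr0 qfD qf_scalar.
by rewrite lerD2l; lra.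
Qed.

End good_points.

(** * The theorem on sums *)

Section double_null.
Context {R : realType} {n : nat}.
Local Notation mu := (lebesgue_rV R n).
Implicit Types (z : 'rV[R]_(n + n)) (a b x y : 'rV[R]_n).

Let fst_ z : 'rV[R]_n := @lsubmx R 1 n n z.
Let snd_ z : 'rV[R]_n := @rsubmx R 1 n n z.

Let norm_row a b (c : R) : `|a| <= c -> `|b| <= c -> `|row_mx a b| <= c.
Proof.
move=> ac bc; apply: norm_rV_le; first exact: (le_trans (normr_ge0 _) ac).
by move=> i; rewrite mxE; case: fintype.split => j; apply: (le_trans (coord_le_norm _ _)).
Qed.

Let fst_le z : `|fst_ z| <= `|z|.
Proof. by apply: norm_rV_le => // i; rewrite mxE coord_le_norm. Qed.

Let snd_le z : `|snd_ z| <= `|z|.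
Proof. by apply: norm_rV_le => // i; rewrite mxE coord_le_norm. Qed.

Let fstB z z' : fst_ (z - z') = fst_ z - fst_ z'.
Proof. by apply/rowP => i; rewrite !mxE. Qed.

Let sndB z z' : snd_ (z - z') = snd_ z - snd_ z'.
Proof. by apply/rowP => i; rewrite !mxE. Qed.

Let rowB a b a' b' : row_mx a b - row_mx a' b' = row_mx (a - a') (b - b').
Proof. by rewrite opp_row_mx add_row_mx. Qed.

Variables (Z1 Z2 : set 'rV[R]_n).
Hypotheses (n0 : (0 < n)%N) (Z10 : mu.-negligible Z1) (Z20 : mu.-negligible Z2).

Let nn0 : (0 < n + n)%N. Proof. by rewrite addn_gt0 n0. Qed.

Let bad_negligible : (lebesgue_rV R (n + n)).-negligible [set z | Z1 (fst_ z) \/ Z2 (snd_ z)].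
Proof.
have h1 := negligible_addrow n Z10; have h2 := negligible_addrow n Z20.
pose sw z : 'rV[R]_(n + n) := row_mx (snd_ z) (fst_ z).
have h3 : (lebesgue_rV R (n + n)).-negligible (sw @` [set x | Z1 (@rsubmx R 1 n n x)]).
  apply: (@lipschitz_negligible R (n + n) _ sw 1) => // x y _ _.
  by rewrite mul1r rowB -sndB -fstB; apply: norm_row; [exact: snd_le|exact: fst_le].
apply: negligibleS (negligibleU_rV h3 h2) => z [z1|z2]; [left|by right].
exists (row_mx (snd_ z) (fst_ z)); first by rewrite /= row_mxKr.
by rewrite /sw /fst_ /snd_ row_mxKl row_mxKr hsubmxK.
Qed.

(** A Lipschitz map of [R^n * R^n] sends null sets to null sets, hence cannot map
    a set of pairs having one bad entry onto a neighbourhood of the origin. *)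
Lemma avoid_null_pair (s1 s2 : 'rV[R]_n -> 'rV[R]_n -> 'rV[R]_n) (L sigma : R)
    (A : 'rV[R]_n -> 'rV[R]_n -> Prop) : 0 < sigma -> 0 <= L ->
  (forall x y x' y', `|s1 x y - s1 x' y'| <= L * (`|x - x'| + `|y - y'|)) ->
  (forall x y x' y', `|s2 x y - s2 x' y'| <= L * (`|x - x'| + `|y - y'|)) ->
  (forall a b, `|a| < sigma -> `|b| < sigma -> exists x y, [/\ A x y, s1 x y = a & s2 x y = b]) ->
  exists x y, [/\ A x y, ~ Z1 x & ~ Z2 y].
Proof.
move=> s0 L0 s1L s2L onto; apply: contrapT => none.
apply: (@cube_nonnegligible R (n + n) 0 sigma s0).
pose S z : 'rV[R]_(n + n) := row_mx (s1 (fst_ z) (snd_ z)) (s2 (fst_ z) (snd_ z)).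
have SL z z' : `|S z - S z'| <= (2 * L) * `|z - z'|.
  rewrite rowB; have h : L * (`|fst_ z - fst_ z'| + `|snd_ z - snd_ z'|) <= (2 * L) * `|z - z'|.
    have -> : 2 * L * `|z - z'| = L * (2 * `|z - z'|) by ring.
    rewrite ler_wpM2l// -fstB -sndB.
    have := fst_le (z - z'); have := snd_le (z - z'); lra.
  by apply: norm_row; apply: le_trans h.
apply: (negligibleS _ (@lipschitz_negligible R (n + n) _ S (2 * L) nn0 _ bad_negligible)); last first.
  by move=> z z' _ _; exact: SL.
move=> z /(cubeP _ _ s0); rewrite subr0 => zs.
have [x [y [Axy s1x s2y]]] := onto _ _ (le_lt_trans (fst_le z) zs) (le_lt_trans (snd_le z) zs).
exists (row_mx x y); last by rewrite /S /fst_ /snd_ row_mxKl row_mxKr s1x s2y hsubmxK.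
rewrite /= /fst_ /snd_ row_mxKl row_mxKr; apply: contrapT => /not_orP[n1 n2].
by apply: none; exists x, y.
Qed.

End double_null.

Section sums.
Context {R : realType} {n : nat}.
Local Notation mu := (lebesgue_rV R n).
Implicit Types (x y h k : 'rV[R]_n).

(** Balls of the Euclidean norm, in which the strictness of the maximum is measured; the
    topology is the one of the max norm. *)
Definition cball (c : 'rV[R]_n) (rho : R) : set 'rV[R]_n := [set x | dot (c - x) (c - x) <= rho ^+ 2].
Definition oball (c : 'rV[R]_n) (rho : R) : set 'rV[R]_n := [set x | dot (c - x) (c - x) < rho ^+ 2].

Lemma cball_norm c rho x : 0 <= rho -> cball c rho x -> `|c - x| <= rho.
Proof.
move=> r0 cx; rewrite -(@ler_pXn2r _ 2) ?nnegrE//.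
exact: le_trans (normsq_le_dotxx _) cx.
Qed.

Lemma cball_compact c rho : 0 <= rho -> compact (cball c rho).
Proof.
move=> r0; apply: bounded_closed_compact.
  exists (`|c| + rho); split; first exact: num_real.
  move=> s hs z /= Bz; rewrite ltW// (le_lt_trans _ hs)// -(subKr c z) (le_trans (ler_normB _ _))//.
  by rewrite lerD2l; exact: cball_norm.
rewrite (_ : cball c rho = (fun x => dot (c - x) (c - x)) @^-1` [set s | s <= rho ^+ 2])//.
by apply: (closed_comp _ (@closed_le R (rho ^+ 2))) => z _; exact: continuous_dist.
Qed.

Lemma oball_open c rho : open (oball c rho).
Proof.
rewrite (_ : oball c rho = (fun x => dot (c - x) (c - x)) @^-1` [set s | s < rho ^+ 2])//.
by apply: (open_comp (D := [set s | s < rho ^+ 2])) => [z _|]; [exact: continuous_dist|exact: open_lt].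
Qed.

Lemma first_order_eq0 (a : 'rV[R]_n) (C r : R) : 0 < r ->
  (forall h, `|h| < r -> dot a h <= C * dot h h) -> a = 0.
Proof.
move=> r0 H; apply: dotxx_eq0; apply/eqP; rewrite eq_le dotxx_ge0 andbT leNgt; apply/negP => aa.
have na : 0 < `|a| + 1 by rewrite ltr_wpDl.
have nC : 0 < `|C| + 1 by rewrite ltr_wpDl.
pose s := Num.min (r / (`|a| + 1)) (`|C| + 1)^-1.
have s0 : 0 < s by rewrite lt_min divr_gt0//= invr_gt0.
have sa : `|s *: a| < r.
  rewrite norm_rVZ gtr0_norm//.
  have : s <= r / (`|a| + 1) by rewrite ge_min lexx.
  rewrite ler_pdivlMr// => /(lt_le_trans _); apply.
  by rewrite ltr_pM2l// ltrDl.
have := H _ sa; rewrite dotZl !dotZr.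
have -> : C * (s * (s * dot a a)) = (C * s) * (s * dot a a) by ring.
rewrite -[X in X <= _]mul1r ler_pM2r ?mulr_gt0//; apply/negP; rewrite -ltNge.
apply: (@le_lt_trans _ _ (`|C| * s)); first by rewrite ler_wpM2r ?ler_norm// ltW.
have : (`|C| + 1) * s <= 1.
  rewrite mulrC -ler_pdivlMr// mul1r ge_min lexx orbT//.
lra.
Qed.

Lemma max_pair_attained (G : 'rV[R]_n -> 'rV[R]_n -> R) (D1 D2 : set 'rV[R]_n) :
  D1 !=set0 -> D2 !=set0 -> compact D1 -> compact D2 ->
  (forall x y, exists C : R, forall h k, `|h| <= 1 -> `|k| <= 1 ->
     `|G (x + h) (y + k) - G x y| <= C * (`|h| + `|k|)) ->
  exists x y, [/\ D1 x, D2 y & forall x' y', D1 x' -> D2 y' -> G x' y' <= G x y].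
Proof.
move=> [a D1a] [b D2b] c1 c2 GL.
pose g (p : 'rV[R]_n * 'rV[R]_n) : R := G p.1 p.2.
have cg : continuous g.
  move=> p; have [C hC] := GL p.1 p.2.
  apply: (@locally_lipschitz_continuous R _ g (2 * `|C|) p) => p'.
  have -> : `|p - p'| = Num.max `|p.1 - p'.1| `|p.2 - p'.2| by [].
  rewrite ge_max.
  move=> /andP[h1 h2]; rewrite distrC in h1; rewrite distrC in h2.
  have := hC (p'.1 - p.1) (p'.2 - p.2) h1 h2; rewrite !subrKC -/(g p) -/(g p') distrC.
  move=> /le_trans; apply.
  set M := Num.max _ _.
  have m1 : `|p'.1 - p.1| <= M by rewrite /M distrC le_max lexx.
  have m2 : `|p'.2 - p.2| <= M by rewrite /M [`|p'.2 - _|]distrC le_max lexx orbT.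
  apply: (@le_trans _ _ (`|C| * (`|p'.1 - p.1| + `|p'.2 - p.2|))).
    by rewrite ler_wpM2r ?ler_norm// addr_ge0.
  by rewrite [2 * _]mulrC -mulrA ler_wpM2l//; lra.
have D0 : (D1 `*` D2) !=set0 by exists (a, b).
have cD := compact_setX c1 c2.
have [[x y] + hmax] := compact_EVT_max D0 cD (continuous_subspaceT cg).
move=> /set_mem[/= Dx Dy]; exists x, y; split => // x' y' Dx' Dy'.
by have := hmax (x', y'); apply; apply/mem_set.
Qed.

End sums.

Section theorem_on_sums.
Context {R : realType} {n : nat}.
Local Notation mu := (lebesgue_rV R n).
Implicit Types (x y h k : 'rV[R]_n).
Variables (lambda Lambda q K : R) (F1 F2 : 'M[R]_n -> R) (f1 f2 u1 u2 : 'rV[R]_n -> R).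
Variables (c1 c2 : 'rV[R]_n) (rho : R).
Hypotheses (l0 : 0 < lambda) (lL : lambda <= Lambda) (q0 : 0 <= q) (K0 : 0 <= K) (n0 : (0 < n)%N).
Hypothesis F1ell : forall M N, M^T = M -> N^T = N -> F1 M - F1 N <= pucci_sup lambda Lambda (M - N).
Hypothesis F2ell : forall M N, M^T = M -> N^T = N -> F2 M - F2 N <= pucci_sup lambda Lambda (M - N).
Hypothesis rho0 : 0 < rho.
Let D1 := cball c1 rho.
Let D2 := cball c2 rho.
Hypotheses (u1c : {within D1, continuous u1}) (u2c : {within D2, continuous u2}).
Hypotheses (u1b : forall x, D1 x -> `|u1 x| <= 1) (u2b : forall x, D2 x -> `|u2 x| <= 1).
Hypotheses (u1sub : quad_subsolution F1 q f1 (oball c1 rho) u1).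
Hypotheses (u2sub : quad_subsolution F2 q f2 (oball c2 rho) u2).
Hypothesis f1K : mu.-negligible [set x | oball c1 rho x /\ f1 x < - K].
Hypothesis f2K : mu.-negligible [set x | oball c2 rho x /\ f2 x < - K].

(* [P] is a quadratic polynomial on R^n * R^n with gradient (g1, g2) and with
   half Hessian form [Q]. *)
Variables (P Q : 'rV[R]_n -> 'rV[R]_n -> R) (g1 g2 : 'rV[R]_n -> 'rV[R]_n -> 'rV[R]_n) (CQ Lg : R).
Hypothesis HP : forall x y h k, P (x + h) (y + k) = P x y + dot (g1 x y) h + dot (g2 x y) k + Q h k.
Hypothesis HQ : forall h k, `|Q h k| <= CQ * (dot h h + dot k k).
Hypothesis HQ2 : forall (s : R) h k, Q (s *: h) (s *: k) = s ^+ 2 * Q h k.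
Hypotheses (CQ0 : 0 <= CQ) (Lg0 : 0 <= Lg).
Hypothesis g1L : forall x y x' y', `|g1 x y - g1 x' y'| <= Lg * (`|x - x'| + `|y - y'|).
Hypothesis g2L : forall x y x' y', `|g2 x y - g2 x' y'| <= Lg * (`|x - x'| + `|y - y'|).
Hypothesis g1_ge : forall x y, D1 x -> D2 y -> 4 <= dot (g1 x y) (g1 x y).
Hypothesis g2_ge : forall x y, D1 x -> D2 y -> 4 <= dot (g2 x y) (g2 x y).
Hypothesis strict_max : forall x y, D1 x -> D2 y ->
  u1 x + u2 y - P x y <= u1 c1 + u2 c2 - P c1 c2 - dot (c1 - x) (c1 - x) - dot (c2 - y) (c2 - y).

Let D10 : D1 !=set0. Proof. by exists c1; rewrite /D1 /cball /= dot_dist0 sqr_ge0. Qed.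
Let D20 : D2 !=set0. Proof. by exists c2; rewrite /D2 /cball /= dot_dist0 sqr_ge0. Qed.
Let cD1 : compact D1. Proof. exact/cball_compact/ltW. Qed.
Let cD2 : compact D2. Proof. exact/cball_compact/ltW. Qed.

Let N : R := n%:R.
Let N0 : 0 <= N. Proof. by rewrite /N. Qed.
Let G0 := `|g1 c1 c2| + `|g2 c1 c2| + Lg * (2 * rho).
Let G00 : 0 <= G0.
Proof. by rewrite !addr_ge0// mulr_ge0// mulr_ge0// ltW. Qed.

Let gbound x y : D1 x -> D2 y -> `|g1 x y| <= G0 /\ `|g2 x y| <= G0.
Proof.
move=> /(cball_norm (ltW rho0)) xr /(cball_norm (ltW rho0)) yr.
have b : Lg * (`|c1 - x| + `|c2 - y|) <= Lg * (2 * rho) by rewrite ler_wpM2l//; lra.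
have t1 := g1L c1 c2 x y; have t2 := g2L c1 c2 x y.
have h1 : `|g1 x y| <= `|g1 c1 c2| + `|g1 c1 c2 - g1 x y|.
  by rewrite -[X in `|X| <= _](subKr (g1 c1 c2)) (le_trans (ler_normB _ _)).
have h2 : `|g2 x y| <= `|g2 c1 c2| + `|g2 c1 c2 - g2 x y|.
  by rewrite -[X in `|X| <= _](subKr (g2 c1 c2)) (le_trans (ler_normB _ _)).
have := normr_ge0 (g1 c1 c2); have := normr_ge0 (g2 c1 c2); rewrite /G0; split; lra.
Qed.

(* As [|u1|, |u2| <= 1], a point and the one selected by its sup-convolution, of parameter
   [2 * t], are at distance at most [th]; [sg] bounds the linear perturbations. *)
Let th := Num.min (Num.min (rho / 16%:R) 1)
  (Num.min (rho ^+ 2 / (64%:R * (2 * N * G0 + 2 * CQ + 1))) (CQ + 1)^-1).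
Let den0 : 0 < 2 * N * G0 + 2 * CQ + 1.
Proof. by rewrite ltr_wpDl// addr_ge0// ?mulr_ge0// mulr_ge0. Qed.
Let th0 : 0 < th.
Proof.
rewrite !lt_min ltr01 invr_gt0 !divr_gt0 ?mulr_gt0 ?exprn_gt0//=.
by rewrite ltr_wpDl.
Qed.
Let th_rho : th <= rho / 16%:R. Proof. by rewrite !ge_min lexx. Qed.
Let th_1 : th <= 1. Proof. by rewrite !ge_min lexx orbT. Qed.
Let th_P : (2 * N * G0 + 2 * CQ) * th <= rho ^+ 2 / 64%:R.
Proof.
have : th <= rho ^+ 2 / (64%:R * (2 * N * G0 + 2 * CQ + 1)) by rewrite !ge_min lexx !orbT.
rewrite ler_pdivlMr ?mulr_gt0// => h.
rewrite ler_pdivlMr//; apply: le_trans h.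
have := th0; move: (2 * N * G0 + 2 * CQ) => a ta; lra.
Qed.
Let th_C : CQ * th < 1.
Proof.
have : th <= (CQ + 1)^-1 by rewrite !ge_min lexx !orbT.
rewrite -[X in _ <= X]mul1r ler_pdivlMr ?ltr_wpDl//; have := th0; lra.
Qed.

Let t := th ^+ 2 / 8%:R.
Let t0 : 0 < t. Proof. by rewrite divr_gt0// exprn_gt0. Qed.
Let CQt : CQ < (2 * t)^-1.
Proof.
rewrite -[X in _ < X]mul1r ltr_pdivlMr ?mulr_gt0// /t.
have h : CQ * th * th <= CQ * th by rewrite ler_piMr// mulr_ge0// ltW.
have := th_C; rewrite expr2; lra.
Qed.

Let sg := Num.min 1 (rho / 128%:R) / (N + 1).
Let N1 : 0 < N + 1. Proof. by rewrite ltr_wpDl. Qed.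
Let sg0 : 0 < sg. Proof. by rewrite divr_gt0// lt_min ltr01 divr_gt0. Qed.
Let sg1 : N * sg ^+ 2 <= 1.
Proof.
have a : (N + 1) * sg <= 1 by rewrite /sg mulrC divfK ?gt_eqF// ge_min lexx.
have sl : sg <= 1 by have := mulr_ge0 N0 (ltW sg0); lra.
have : N * sg * sg <= N * sg by rewrite ler_piMr// mulr_ge0// ltW.
rewrite expr2; have := sg0; lra.
Qed.
Let sg2 : 2 * N * sg * rho <= rho ^+ 2 / 64%:R.
Proof.
have a : (N + 1) * sg <= rho / 128%:R by rewrite /sg mulrC divfK ?gt_eqF// ge_min lexx orbT.
have : N * sg <= rho / 128%:R by have := sg0; lra.
move=> /(ler_wpM2r (ltW rho0)) h; rewrite expr2; lra.
Qed.

Let w1 := reg D10 cD1 u1c t0.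
Let w2 := reg D20 cD2 u2c t0.
Let p1 := regD D10 cD1 u1c t0.
Let p2 := regD D20 cD2 u2c t0.

Let r0 := rho / (2 * (N + 1)).
Let r00 : 0 < r0. Proof. by rewrite divr_gt0// mulr_gt0. Qed.

Let smallh h : `|h| < r0 -> dot h h <= rho ^+ 2 / 4%:R.
Proof.
move=> hr; apply: le_trans (dotxx_le_normsq h) _; rewrite -/N.
have h2 : `|h| ^+ 2 <= r0 ^+ 2 by rewrite ler_pXn2r ?nnegrE// ltW.
apply: (@le_trans _ _ ((N + 1) ^+ 2 * r0 ^+ 2)).
  apply: ler_pM => //.
  by rewrite sqrrD1; have := sqr_ge0 N; have := N0; lra.
by rewrite /r0 le_eqVlt; apply/orP; left; apply/eqP; field; rewrite gt_eqF.
Qed.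

Let near_center (c x h : 'rV[R]_n) : dot (c - x) (c - x) <= rho ^+ 2 / 4%:R ->
  `|h| < r0 -> cball c rho (x + h).
Proof.
move=> cx /smallh hh; rewrite /cball /=.
have -> : c - (x + h) = (c - x) + (- h) by rewrite opprD addrA.
apply: le_trans (dot_double _ _) _; rewrite dotNl dotNr opprK; lra.
Qed.

(** At a maximum of the perturbed function the points selected by the two
    sup-convolutions are within [th] of [(x, y)]; strictness of the maximum at [(c1, c2)]
    keeps them, hence [(x, y)], away from the boundary. *)
Let perturbed_max a b : `|a| < sg -> `|b| < sg -> exists x y,
  [/\ dot (c1 - x) (c1 - x) <= rho ^+ 2 / 8%:R, dot (c2 - y) (c2 - y) <= rho ^+ 2 / 8%:R &
   forall x' y', D1 x' -> D2 y' ->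
     w1 x' + w2 y' - P x' y' - dot a x' - dot b y' <= w1 x + w2 y - P x y - dot a x - dot b y].
Proof.
move=> asg bsg.
have i2t : 0 <= (2 * t)^-1 by rewrite invr_ge0 mulr_ge0// (ltW t0).
pose G x y := w1 x + w2 y - P x y - dot a x - dot b y.
have wL (w : 'rV[R]_n -> R) (p : 'rV[R]_n -> 'rV[R]_n) x h :
    (forall x h, `|w (x + h) - w x - dot (p x) h| <= (2 * t)^-1 * dot h h) -> `|h| <= 1 ->
    `|w (x + h) - w x| <= (N * `|p x| + (2 * t)^-1 * N) * `|h|.
  move=> wp h1; rewrite -(subrK (dot (p x) h) (w (x + h) - w x)).
  apply: (le_trans (ler_normD _ _)); rewrite mulrDl [X in _ <= X]addrC; apply: lerD; last exact: dot_le_normM.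
  apply: (le_trans (wp x h)); rewrite -mulrA ler_wpM2l//.
  apply: le_trans (dotxx_le_normsq h) _; rewrite -/N ler_wpM2l// expr2.
  by rewrite ler_piMr.
have hN h : `|h| <= 1 -> dot h h <= N * `|h|.
  move=> h1; apply: le_trans (dotxx_le_normsq h) _; rewrite -/N ler_wpM2l// expr2.
  by rewrite ler_piMr.
have GL x y : exists C : R, forall h k, `|h| <= 1 -> `|k| <= 1 ->
     `|G (x + h) (y + k) - G x y| <= C * (`|h| + `|k|).
  pose Ca := N * `|p1 x| + (2 * t)^-1 * N; pose Cb := N * `|p2 y| + (2 * t)^-1 * N.
  have Ca0 : 0 <= Ca by rewrite addr_ge0// mulr_ge0.
  have Cb0 : 0 <= Cb by rewrite addr_ge0// mulr_ge0.
  pose C := Ca + Cb + N * `|g1 x y| + N * `|g2 x y| + CQ * N + N * `|a| + N * `|b|.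
  exists C => h k h1 k1.
  have b1 := wL w1 p1 x h (reg_c11 D10 cD1 u1c t0) h1; rewrite -/Ca in b1.
  have b2 := wL w2 p2 y k (reg_c11 D20 cD2 u2c t0) k1; rewrite -/Cb in b2.
  have b3 := dot_le_normM (g1 x y) h; have b4 := dot_le_normM (g2 x y) k; rewrite -/N in b3 b4.
  have b5 := HQ h k; have b5' : CQ * (dot h h + dot k k) <= CQ * N * (`|h| + `|k|).
    by rewrite -mulrA ler_wpM2l// mulrDr lerD// hN.
  have b6 := dot_le_normM a h; have b7 := dot_le_normM b k; rewrite -/N in b6 b7.
  have -> : G (x + h) (y + k) - G x y = (w1 (x + h) - w1 x) + (w2 (y + k) - w2 y)
    - dot (g1 x y) h - dot (g2 x y) k - Q h k - dot a h - dot b k.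
    by rewrite /G HP (dotDr a) (dotDr b); ring.
  have tri (r1 r2 r3 r4 r5 r6 r7 : R) :
      `|r1 + r2 - r3 - r4 - r5 - r6 - r7| <= `|r1| + `|r2| + `|r3| + `|r4| + `|r5| + `|r6| + `|r7|.
    do 5! (apply: (le_trans (ler_normB _ _)); rewrite lerD2r).
    exact: ler_normD.
  apply: (le_trans (tri _ _ _ _ _ _ _)).
  have nh := normr_ge0 h; have nk := normr_ge0 k.
  have : 0 <= Ca * `|k| by rewrite mulr_ge0.
  have : 0 <= Cb * `|h| by rewrite mulr_ge0.
  have : 0 <= N * `|g1 x y| * `|k| by rewrite !mulr_ge0.
  have : 0 <= N * `|g2 x y| * `|h| by rewrite !mulr_ge0.
  have : 0 <= N * `|a| * `|k| by rewrite !mulr_ge0.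
  have : 0 <= N * `|b| * `|h| by rewrite !mulr_ge0.
  rewrite /C; lra.
have [x [y [Dx Dy xymax]]] := max_pair_attained D10 D20 cD1 cD2 GL.
exists x, y; rewrite -!/(G _ _).
suff [hx hy] : dot (c1 - x) (c1 - x) <= rho ^+ 2 / 8%:R /\ dot (c2 - y) (c2 - y) <= rho ^+ 2 / 8%:R.
  by split.
pose x' := supc_pt t D10 cD1 u1c x; pose y' := supc_pt t D20 cD2 u2c y.
have Dx' : D1 x' by exact: supc_ptD.
have Dy' : D2 y' by exact: supc_ptD.
have Dc1 : D1 c1 by rewrite /D1 /cball /= dot_dist0 sqr_ge0.
have Dc2 : D2 c2 by rewrite /D2 /cball /= dot_dist0 sqr_ge0.
have close (D : set 'rV[R]_n) (D0 : D !=set0) (cD : compact D) (v : 'rV[R]_n -> R)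
    (vc : {within D, continuous v}) z : (forall z, D z -> `|v z| <= 1) -> D z ->
    dot (z - supc_pt t D0 cD vc z) (z - supc_pt t D0 cD vc z) <= th ^+ 2 /\
    reg D0 cD vc t0 z <= v (supc_pt t D0 cD vc z).
  move=> vb Dz; set z' := supc_pt _ _ _ _ _.
  have Dz' : D z' by exact: supc_ptD.
  have h1 := supc_ge t D0 cD vc z Dz; rewrite dot_dist0 mul0r subr0 /supc -/z' in h1.
  have /ler_normlP[_ h2] := vb _ Dz'; have /ler_normlP[h3 _] := vb _ Dz.
  have h4 : dot (z - z') (z - z') / (4 * t) <= 2 by lra.
  rewrite ler_pdivrMr ?mulr_gt0// in h4; split; first by move: h4; rewrite /t; lra.
  apply: le_trans (reg_le_supc D0 cD vc t0 z) _; rewrite /supc -/z'.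
  by rewrite gerDl oppr_le0 divr_ge0 ?dotxx_ge0// mulr_ge0// ltW.
have [xx' w1x] := close _ D10 cD1 u1 u1c x u1b Dx; rewrite -/x' -/w1 in xx' w1x.
have [yy' w2y] := close _ D20 cD2 u2 u2c y u2b Dy; rewrite -/y' -/w2 in yy' w2y.
have low1 := reg_ge D10 cD1 u1c t0 c1 Dc1; rewrite dot_dist0 mul0r subr0 -/w1 in low1.
have low2 := reg_ge D20 cD2 u2c t0 c2 Dc2; rewrite dot_dist0 mul0r subr0 -/w2 in low2.
have Pd : P x' y' - P x y <= rho ^+ 2 / 64%:R.
  have [gb1 gb2] := gbound Dx Dy.
  have nth z z' : dot (z - z') (z - z') <= th ^+ 2 -> `|z' - z| <= th.
    move=> zz; rewrite distrC -(@ler_pXn2r _ 2) ?nnegrE ?(ltW th0)//.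
    exact: le_trans (normsq_le_dotxx _) zz.
  have d1 : dot (g1 x y) (x' - x) <= N * G0 * th.
    apply: le_trans (ler_norm _) _; apply: le_trans (dot_le_normM _ _) _; rewrite -/N -!mulrA.
    by rewrite ler_wpM2l// ler_pM// nth.
  have d2 : dot (g2 x y) (y' - y) <= N * G0 * th.
    apply: le_trans (ler_norm _) _; apply: le_trans (dot_le_normM _ _) _; rewrite -/N -!mulrA.
    by rewrite ler_wpM2l// ler_pM// nth.
  have d3 : Q (x' - x) (y' - y) <= 2 * CQ * th.
    apply: le_trans (ler_norm _) _; apply: le_trans (HQ _ _) _.
    rewrite -(opprB x x') -(opprB y y') !dotNl !dotNr !opprK [2 * CQ]mulrC -mulrA ler_wpM2l//.
    have : th ^+ 2 <= th by rewrite expr2 ler_piMr// ltW.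
    lra.
  have := HP x y (x' - x) (y' - y); rewrite !subrKC => ->.
  have := th_P; lra.
have lin (c v z : 'rV[R]_n) : `|v| < sg -> cball c rho z -> dot v (c - z) <= N * sg * rho.
  move=> vs /(cball_norm (ltW rho0)) cz.
  apply: le_trans (ler_norm _) _; apply: le_trans (dot_le_normM _ _) _; rewrite -/N.
  by rewrite -(mulrA N sg) -(mulrA N `|v|); apply: ler_wpM2l => //; apply: ler_pM => //; exact: ltW.
have la := lin _ _ _ asg Dx; have lb := lin _ _ _ bsg Dy.
rewrite dotBr in la; rewrite dotBr in lb.
have mx := xymax c1 c2 Dc1 Dc2; rewrite /G in mx.
have sm := strict_max Dx' Dy'.
have sum : dot (c1 - x') (c1 - x') + dot (c2 - y') (c2 - y') <= rho ^+ 2 / 32%:R.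
  have := sg2; lra.
have th2 : th ^+ 2 <= rho ^+ 2 / 256%:R.
  have : th ^+ 2 <= (rho / 16%:R) ^+ 2 by rewrite ler_pXn2r ?nnegrE ?(ltW th0)// divr_ge0// ltW.
  by rewrite expr_div_n -natrX.
have tri (c z z' : 'rV[R]_n) : dot (c - z) (c - z) <= 2 * dot (c - z') (c - z') + 2 * dot (z - z') (z - z').
  have -> : c - z = (c - z') + - (z - z') by apply/rowP => i; rewrite !mxE; ring.
  by apply: le_trans (dot_double _ _) _; rewrite dotNl dotNr opprK.
have := dotxx_ge0 (c1 - x'); have := dotxx_ge0 (c2 - y').
have := tri c1 x x'; have := tri c2 y y'; split; lra.
Qed.

Let contact_inside (c x p g a : 'rV[R]_n) (u : 'rV[R]_n -> R) (D0 : cball c rho !=set0)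
    (cD : compact (cball c rho)) (uc : {within cball c rho, continuous u}) (s : R) :
  (forall z, cball c rho z -> `|u z| <= 1) -> p = regD D0 cD uc t0 x ->
  dot (c - x) (c - x) <= rho ^+ 2 / 8%:R -> 0 < s -> 4 <= dot g g -> `|a| < sg -> p = g + a ->
  (forall h, `|h| < s -> reg D0 cD uc t0 (x + h) <= reg D0 cD uc t0 x + dot p h + CQ * dot h h) ->
  oball c rho (x + t *: p) /\ 1 <= dot p p.
Proof.
move=> ub pE cx s0 gg asg pga touch.
have rho2 : 0 < rho ^+ 2 by rewrite exprn_gt0.
have [Dx' wx] : cball c rho (x + t *: p) /\ reg D0 cD uc t0 x = u (x + t *: p) - t / 2 * dot p p.
  by rewrite pE in touch *; exact: reg_contact CQt s0 touch.
have Dx : cball c rho x by rewrite /cball /=; lra.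
have /ler_normlP[_ h1] := ub _ Dx'; have /ler_normlP[h2 _] := ub _ Dx.
have h3 := reg_ge D0 cD uc t0 x Dx; rewrite dot_dist0 mul0r subr0 in h3.
have h4 : t / 2 * dot p p <= 2 by lra.
have h5 : t ^+ 2 * dot p p <= 4 * t.
  have -> : t ^+ 2 * dot p p = 2 * t * (t / 2 * dot p p) by field.
  have -> : 4 * t = 2 * t * 2 by ring.
  by rewrite ler_pM2l// mulr_gt0.
have h6 : 4 * t <= rho ^+ 2 / 512%:R.
  have : th ^+ 2 <= (rho / 16%:R) ^+ 2 by rewrite ler_pXn2r ?nnegrE ?(ltW th0)// divr_ge0// ltW.
  rewrite expr_div_n -natrX /t => h; lra.
split.
  have -> : oball c rho (x + t *: p) = (dot (c - x + - (t *: p)) (c - x + - (t *: p)) < rho ^+ 2) :> Prop.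
    by rewrite /oball /= opprD addrA.
  apply: le_lt_trans (dot_double _ _) _; rewrite dotNl dotNr opprK (dotZl t p) (dotZr t p) (mulrA t t) -(expr2 t).
  by move: rho2 cx h5 h6; move: (t ^+ 2 * _) => r1; move: (4 * t) => r2; lra.
have aa : dot a a <= 1.
  apply: le_trans (dotxx_le_normsq a) _; rewrite -/N; apply: le_trans sg1.
  by rewrite ler_wpM2l// ler_pXn2r ?nnegrE// ltW.
have gE : g = p + - a by rewrite pga addrK.
rewrite gE in gg.
have := le_trans gg (dot_double _ _); rewrite dotNl dotNr opprK; lra.
Qed.

(** The points at which the regularised sum is touched from above by a quadratic
    polynomial with the Hessian of [P], close enough to the centres and with gradients of length at least one. *)
Let touching x y := [/\ oball c1 rho (x + t *: p1 x), oball c2 rho (y + t *: p2 y),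
  1 <= dot (p1 x) (p1 x), 1 <= dot (p2 y) (p2 y) &
  forall h k, `|h| < r0 -> `|k| < r0 ->
    w1 (x + h) + w2 (y + k) <= w1 x + w2 y + dot (p1 x) h + dot (p2 y) k + Q h k].

(** Every small linear perturbation [(a, b)] is the defect of gradients at some touching
    point, so the set of touching points is not null. *)
Let touching_onto a b : `|a| < sg -> `|b| < sg ->
  exists x y, [/\ touching x y, p1 x - g1 x y = a & p2 y - g2 x y = b].
Proof.
move=> asg bsg; have [x [y [cx cy xymax]]] := perturbed_max asg bsg.
exists x, y.
have rho2 : 0 < rho ^+ 2 by rewrite exprn_gt0.
have cx4 : dot (c1 - x) (c1 - x) <= rho ^+ 2 / 4%:R by lra.
have cy4 : dot (c2 - y) (c2 - y) <= rho ^+ 2 / 4%:R by lra.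
have touch h k : `|h| < r0 -> `|k| < r0 ->
    w1 (x + h) + w2 (y + k) <= w1 x + w2 y + dot (g1 x y + a) h + dot (g2 x y + b) k + Q h k.
  move=> hr kr; have := xymax _ _ (near_center cx4 hr) (near_center cy4 kr).
  rewrite HP !dotDl (dotDr a) (dotDr b); lra.
have Q0r h : Q h 0 <= CQ * dot h h.
  by have := HQ h 0; rewrite dot0l addr0; apply: le_trans; exact: ler_norm.
have Q0l k : Q 0 k <= CQ * dot k k.
  by have := HQ 0 k; rewrite dot0l add0r; apply: le_trans; exact: ler_norm.
have E1 : p1 x = g1 x y + a.
  apply/subr0_eq; apply: (@first_order_eq0 _ _ _ ((2 * t)^-1 + CQ) r0 r00) => h hr.
  have := touch h 0 hr; rewrite normr0 => /(_ r00); rewrite addr0 dot0r addr0 => h1.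
  have := reg_c11 D10 cD1 u1c t0 x h; rewrite -/w1 -/p1 => /ler_normlP[h2 _].
  have h3 := Q0r h; rewrite dotBl mulrDl; move: ((2 * t)^-1 * _) h2 => r h2; lra.
have E2 : p2 y = g2 x y + b.
  apply/subr0_eq; apply: (@first_order_eq0 _ _ _ ((2 * t)^-1 + CQ) r0 r00) => h hr.
  have := touch 0 h; rewrite normr0 => /(_ r00 hr); rewrite addr0 dot0r addr0 => h1.
  have := reg_c11 D20 cD2 u2c t0 y h; rewrite -/w2 -/p2 => /ler_normlP[h2 _].
  have h3 := Q0l h; rewrite dotBl mulrDl; move: ((2 * t)^-1 * _) h2 => r h2; lra.
have Dx : D1 x by rewrite /D1 /cball /=; lra.
have Dy : D2 y by rewrite /D2 /cball /=; lra.
rewrite -E1 -E2 in touch.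
have touch1 h : `|h| < r0 -> w1 (x + h) <= w1 x + dot (p1 x) h + CQ * dot h h.
  move=> hr; have := touch h 0 hr; rewrite normr0 => /(_ r00).
  rewrite addr0 dot0r addr0; have := Q0r h; lra.
have touch2 h : `|h| < r0 -> w2 (y + h) <= w2 y + dot (p2 y) h + CQ * dot h h.
  move=> hr; have := touch 0 h; rewrite normr0 => /(_ r00 hr).
  rewrite addr0 dot0r addr0; have := Q0l h; lra.
have [in1 pp1] := contact_inside u1b (erefl (p1 x)) cx r00 (g1_ge Dx Dy) asg E1 touch1.
have [in2 pp2] := contact_inside u2b (erefl (p2 y)) cy r00 (g2_ge Dx Dy) bsg E2 touch2.
by split; [split|rewrite E1 addrC addKr|rewrite E2 addrC addKr].
Qed.

(** The form of the theorem on sums needed here: at an approximate maximum point of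
    [u1 x + u2 y - P x y] the two second order expansions exist, are dominated by the
    Hessian of [P], and satisfy the two inequalities. *)
Lemma theorem_on_sums : exists X Y : 'M[R]_n, [/\ X^T = X, Y^T = Y,
  forall h k, qf X h + qf Y k <= 2 * Q h k,
  forall eta : R, 0 < eta -> - K <= F1 (X + eta%:M) &
  forall eta : R, 0 < eta -> - K <= F2 (Y + eta%:M)].
Proof.
have od1 : oball c1 rho `<=` D1 by move=> x; exact: ltW.
have od2 : oball c2 rho `<=` D2 by move=> x; exact: ltW.
have [Z1 [Z10 good1]] := good_points l0 lL F1ell q0 K0 n0 D10 cD1 u1c t0 (@oball_open _ _ _ _) od1 u1sub f1K.
have [Z2 [Z20 good2]] := good_points l0 lL F2ell q0 K0 n0 D20 cD2 u2c t0 (@oball_open _ _ _ _) od2 u2sub f2K.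
have [x [y [[in1 in2 pp1 pp2 touch] nZ1 nZ2]]] : exists x y, [/\ touching x y, ~ Z1 x & ~ Z2 y].
  pose Lp := `|(2 * t)^-1| * (5 * n + 1)%:R.
  have Lp0 : 0 <= Lp by rewrite mulr_ge0.
  apply: (@avoid_null_pair R n Z1 Z2 n0 Z10 Z20 (fun x y => p1 x - g1 x y)
    (fun x y => p2 y - g2 x y) (Lp + Lg) sg touching sg0).
  - by rewrite addr_ge0.
  - move=> x y x' y'.
    have h1 := c11_lipschitz (reg_c11 D10 cD1 u1c t0) x x'; rewrite -/p1 -/Lp in h1.
    have h2 := g1L x y x' y'.
    have -> : p1 x - g1 x y - (p1 x' - g1 x' y') = (p1 x - p1 x') - (g1 x y - g1 x' y').
      by rewrite (opprD (p1 x')) (opprD (g1 x y)) addrACA.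
    apply: (le_trans (ler_normB _ _)).
    have : 0 <= Lp * `|y - y'| by rewrite mulr_ge0.
    lra.
  - move=> x y x' y'.
    have h1 := c11_lipschitz (reg_c11 D20 cD2 u2c t0) y y'; rewrite -/p2 -/Lp in h1.
    have h2 := g2L x y x' y'.
    have -> : p2 y - g2 x y - (p2 y' - g2 x' y') = (p2 y - p2 y') - (g2 x y - g2 x' y').
      by rewrite (opprD (p2 y')) (opprD (g2 x y)) addrACA.
    apply: (le_trans (ler_normB _ _)).
    have : 0 <= Lp * `|x - x'| by rewrite mulr_ge0.
    lra.
  - exact: touching_onto.
have Q0r h : Q h 0 <= CQ * dot h h.
  by have := HQ h 0; rewrite dot0l addr0; apply: le_trans; exact: ler_norm.
have Q0l k : Q 0 k <= CQ * dot k k.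
  by have := HQ 0 k; rewrite dot0l add0r; apply: le_trans; exact: ler_norm.
have touch1 h : `|h| < r0 -> w1 (x + h) <= w1 x + dot (p1 x) h + CQ * dot h h.
  move=> hr; have := touch h 0 hr; rewrite normr0 => /(_ r00).
  rewrite addr0 dot0r addr0; have := Q0r h; lra.
have touch2 h : `|h| < r0 -> w2 (y + h) <= w2 y + dot (p2 y) h + CQ * dot h h.
  move=> hr; have := touch 0 h; rewrite normr0 => /(_ r00 hr).
  rewrite addr0 dot0r addr0; have := Q0l h; lra.
have [X [sX pX FX]] := good1 x nZ1 CQ r0 CQt r00 touch1 in1 pp1.
have [Y [sY pY FY]] := good2 y nZ2 CQ r0 CQt r00 touch2 in2 pp2.
exists X, Y; split => // h k.
(* Both expansions are compared along the ray through (h, k). *)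
apply/ler_addgt0Pr => e e0.
pose E := dot h h + dot k k + 1.
have E0 : 0 < E by rewrite ltr_wpDl// addr_ge0// dotxx_ge0.
have e'0 : 0 < e / (4 * E) by rewrite divr_gt0// mulr_gt0.
have [r1 r10 hr1] := pX _ e'0; have [r2 r20 hr2] := pY _ e'0.
pose s := Num.min r0 (Num.min r1 r2) / (`|h| + `|k| + 1).
have nhk : 0 < `|h| + `|k| + 1 by rewrite ltr_wpDl// addr_ge0.
have m0 : 0 < Num.min r0 (Num.min r1 r2) by rewrite !lt_min r00 r10 r20.
have s0 : 0 < s by rewrite divr_gt0.
have sm (v : 'rV[R]_n) : `|v| <= `|h| + `|k| -> [/\ `|s *: v| < r0, `|s *: v| < r1 & `|s *: v| < r2].
  move=> vhk; have : `|s *: v| < Num.min r0 (Num.min r1 r2).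
    rewrite norm_rVZ ger0_norm ?(ltW s0)// /s mulrAC ltr_pdivrMr// ltr_pM2l//; lra.
  by rewrite !lt_min => /and3P[].
have [h1 h2 _] : [/\ `|s *: h| < r0, `|s *: h| < r1 & `|s *: h| < r2] by apply: sm; rewrite lerDl.
have [k1 _ k2] : [/\ `|s *: k| < r0, `|s *: k| < r1 & `|s *: k| < r2] by apply: sm; rewrite lerDr.
have a1 := touch _ _ h1 k1; rewrite HQ2 in a1.
have /ler_normlP[a2 _] := hr1 _ h2; have /ler_normlP[a3 _] := hr2 _ k2.
rewrite -/w1 -/p1 qf_scale !(dotZl s h) !(dotZr s) in a2.
rewrite -/w2 -/p2 qf_scale !(dotZl s k) !(dotZr s) in a3.
rewrite !(dotZr s) in a1.
have a4 : e / (4 * E) * (dot h h + dot k k) <= e / 2.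
  rewrite mulrAC ler_pdivrMr ?mulr_gt0// /E.
  have h0 : 0 <= dot h h + dot k k by rewrite addr_ge0 ?dotxx_ge0.
  have := mulr_ge0 (ltW e0) h0; rewrite !mulrDr; lra.
have s2 : 0 < s ^+ 2 by rewrite exprn_gt0.
rewrite -(ler_pM2l s2).
have s3 : s ^+ 2 * (e / (4 * E) * (dot h h + dot k k)) <= s ^+ 2 * (e / 2) by rewrite ler_pM2l.
have ssd r : s * (s * r) = s ^+ 2 * r by rewrite mulrA expr2.
rewrite !ssd in a2 a3.
move: (e / (4 * E)) a2 a3 s3 => e' a2 a3 s3.
rewrite mulrCA mulrDr in s3; move: (s ^+ 2 * dot h h) (s ^+ 2 * dot k k) a2 a3 s3 => d1 d2 a2 a3 s3.
rewrite !mulrDr in s3 *; lra.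
Qed.

End theorem_on_sums.

(** * Doubling of variables *)

Section model_function.
Context {R : realType} {n : nat}.
Variables (e : 'rV[R]_n) (L M d : R) (x0 a b : 'rV[R]_n).
Hypotheses (e1 : dot e e = 1) (L0 : 0 <= L) (M0 : 0 <= M) (d0 : 0 < d).
Implicit Types (x y z h k : 'rV[R]_n).

(** [quadr] equals the concave modulus [|z| - |z|^2] at [z = d *: e], has there the same second
    derivative [-2] along [e], and doubles the curvature of [|z|] across [e] so as to lie
    above the modulus nearby. *)
Definition quadr z : R := dot z e - dot z e ^+ 2 + d^-1 * (dot z z - dot z e ^+ 2).
Definition quadr_grad z : 'rV[R]_n :=
  (1 - 2 * dot z e) *: e + (2 * d^-1) *: (z - dot z e *: e).
Definition quadr_form z : R := - dot z e ^+ 2 + d^-1 * (dot z z - dot z e ^+ 2).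

(** The test function of the doubling argument and its derivatives; the last two
    terms make the maximum at [(a, b)] strict. *)
Definition model x y : R := L * quadr (x - y) + M * dot (x0 - x) (x0 - x)
  + dot (a - x) (a - x) + dot (b - y) (b - y).
Definition model_g1 x y : 'rV[R]_n :=
  L *: quadr_grad (x - y) + (2 * M) *: (x - x0) + 2 *: (x - a).
Definition model_g2 x y : 'rV[R]_n := - (L *: quadr_grad (x - y)) + 2 *: (y - b).
Definition model_form h k : R := L * quadr_form (h - k) + (M + 1) * dot h h + dot k k.

Lemma quadrD z h : quadr (z + h) = quadr z + dot (quadr_grad z) h + quadr_form h.
Proof.
rewrite /quadr /quadr_grad /quadr_form !dotDl !dotDr !dotZl dotBl !dotZl (dotC h z) (dotC e h).
ring.
Qed.

Lemma quadr_grad_dot z : dot (quadr_grad z) e = 1 - 2 * dot z e.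
Proof.
rewrite /quadr_grad (dotDl (_ *: e)) dotZl e1 mulr1 dotZl (dotBl z) dotZl e1.
by rewrite mulr1 subrr mulr0 addr0.
Qed.

Lemma modelD x y h k : model (x + h) (y + k) =
  model x y + dot (model_g1 x y) h + dot (model_g2 x y) k + model_form h k.
Proof.
rewrite /model /model_g1 /model_g2 /model_form.
have -> : x + h - (y + k) = (x - y) + (h - k) by rewrite opprD addrACA.
rewrite quadrD; move: (quadr_grad (x - y)) => g.
have E (c v w : 'rV[R]_n) : dot (c - (v + w)) (c - (v + w)) =
   dot (c - v) (c - v) + 2 * dot (v - c) w + dot w w.
  by rewrite !dot_distE dotBl !dotDr !dotDl (dotC w v); ring.
rewrite !E (dotDl (_ + _)) (dotDl (L *: g)) (dotDl (- (L *: g))) dotNl !dotZl (dotBr g); ring.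
Qed.

Lemma model_formZ (s : R) h k : model_form (s *: h) (s *: k) = s ^+ 2 * model_form h k.
Proof.
rewrite /model_form /quadr_form -scalerBr.
move: (h - k) => v; rewrite !dotZl !dotZr; ring.
Qed.

Lemma model_form_le h k :
  `|model_form h k| <= (2 * L * (1 + d^-1) + M + 1) * (dot h h + dot k k).
Proof.
have di : 0 < d^-1 by rewrite invr_gt0.
have h0 := dotxx_ge0 h; have k0 := dotxx_ge0 k.
have q1 : `|quadr_form (h - k)| <= (1 + d^-1) * (2 * (dot h h + dot k k)).
  have z1 := sqr_dot_unit_le (h - k) e1; have z0 := sqr_ge0 (dot (h - k) e).
  have z2 := dot_double h (- k); rewrite dotNl dotNr opprK in z2.
  rewrite /quadr_form; move: (dot (h - k) e ^+ 2) (dot (h - k) (h - k)) z0 z1 z2 => r1 r2 z0 z1 z2.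
  have p1 : 0 <= d^-1 * (r2 - r1) by rewrite mulr_ge0 ?(ltW di)// subr_ge0.
  have p2 : d^-1 * (r2 - r1) <= d^-1 * (2 * (dot h h + dot k k)) by rewrite ler_pM2l//; lra.
  have p3 : 0 <= d^-1 * (2 * (dot h h + dot k k)) by rewrite mulr_ge0 ?(ltW di)//; lra.
  by rewrite ler_norml mulrDl mul1r; apply/andP; split; lra.
rewrite /model_form; apply: (le_trans (ler_normD _ _)); rewrite (ger0_norm k0).
apply: (le_trans (lerD (ler_normD _ _) (lexx _))).
rewrite !normrM (ger0_norm L0) (ger0_norm h0) (ger0_norm (addr_ge0 M0 ler01)).
have := ler_wpM2l L0 q1.
have -> : L * ((1 + d^-1) * (2 * (dot h h + dot k k))) = 2 * L * (1 + d^-1) * (dot h h + dot k k) by ring.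
have : 0 <= M * dot k k by rewrite mulr_ge0.
move: (2 * L * (1 + d^-1)) => A; move: (quadr_form _) => g; lra.
Qed.

Let e_norm : `|e| <= 1.
Proof. by rewrite -(@ler_pXn2r _ 2) ?nnegrE// expr1n -e1 normsq_le_dotxx. Qed.

Lemma dot_unit_le z : `|dot z e| <= n%:R * `|z|.
Proof. by apply: (le_trans (dot_le_normM _ _)); rewrite ler_piMr// mulr_ge0. Qed.

Let qg_lip z z' : `|quadr_grad z - quadr_grad z'| <= (2 * n%:R + 2 * d^-1 * (1 + n%:R)) * `|z - z'|.
Proof.
have di : 0 < d^-1 by rewrite invr_gt0.
have -> : quadr_grad z - quadr_grad z' =
    (- 2 * dot (z - z') e) *: e + (2 * d^-1) *: ((z - z') - dot (z - z') e *: e).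
  rewrite dotBl /quadr_grad; move: (dot z e) (dot z' e) => r r'.
  by apply/rowP => i; rewrite !mxE; ring.
have := dot_unit_le (z - z'); move: (z - z') => v dv.
have b1 : `|dot v e *: e| <= n%:R * `|v|.
  by rewrite norm_rVZ (le_trans _ dv)// ler_piMr.
apply: (le_trans (ler_normD _ _)); rewrite [X in _ <= X]mulrDl; apply: lerD.
  rewrite norm_rVZ normrM normrN (ger0_norm (ler0n R 2)).
  rewrite -[X in X <= _]mulrA -[X in _ <= X]mulrA ler_wpM2l// (le_trans _ dv)//.
  by rewrite ler_piMr.
rewrite norm_rVZ ger0_norm ?mulr_ge0 ?(ltW di)// -mulrA ler_wpM2l ?mulr_ge0 ?(ltW di)//.
apply: (le_trans (ler_normB _ _)); rewrite mulrDl mul1r lerD2l//.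
Qed.

Definition model_lip : R := L * (2 * n%:R + 2 * d^-1 * (1 + n%:R)) + 2 * M + 2.

Lemma model_lip_ge0 : 0 <= model_lip.
Proof.
have di : 0 < d^-1 by rewrite invr_gt0.
by rewrite !addr_ge0// mulr_ge0// ?addr_ge0// !mulr_ge0// ?(ltW di)// addr_ge0.
Qed.

Let Lqg_lip x y x' y' : `|L *: quadr_grad (x - y) - L *: quadr_grad (x' - y')| <=
  L * (2 * n%:R + 2 * d^-1 * (1 + n%:R)) * (`|x - x'| + `|y - y'|).
Proof.
rewrite -scalerBr norm_rVZ ger0_norm// -mulrA ler_wpM2l//.
apply: (le_trans (qg_lip _ _)); rewrite ler_wpM2l//.
  by rewrite addr_ge0// !mulr_ge0 ?invr_ge0 ?(ltW d0)// addr_ge0.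
have -> : x - y - (x' - y') = (x - x') - (y - y') by rewrite (opprD x') addrACA (opprD y).
exact: ler_normB.
Qed.

Lemma model_g1_lip x y x' y' :
  `|model_g1 x y - model_g1 x' y'| <= model_lip * (`|x - x'| + `|y - y'|).
Proof.
have -> : model_g1 x y - model_g1 x' y' =
    (L *: quadr_grad (x - y) - L *: quadr_grad (x' - y')) + (2 * M + 2) *: (x - x').
  rewrite /model_g1; move: (L *: quadr_grad (x - y)) (L *: quadr_grad _) => v w.
  by apply/rowP => i; rewrite !mxE; ring.
apply: (le_trans (ler_normD _ _)); apply: (le_trans (lerD (Lqg_lip _ _ _ _) (lexx _))).
rewrite norm_rVZ ger0_norm ?addr_ge0 ?mulr_ge0// /model_lip -[X in _ <= X * _]addrA [X in _ <= X]mulrDl.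
by rewrite lerD2l ler_wpM2l ?addr_ge0 ?mulr_ge0// lerDl.
Qed.

Lemma model_g2_lip x y x' y' :
  `|model_g2 x y - model_g2 x' y'| <= model_lip * (`|x - x'| + `|y - y'|).
Proof.
have -> : model_g2 x y - model_g2 x' y' =
    - (L *: quadr_grad (x - y) - L *: quadr_grad (x' - y')) + 2 *: (y - y').
  rewrite /model_g2; move: (L *: quadr_grad (x - y)) (L *: quadr_grad _) => v w.
  by apply/rowP => i; rewrite !mxE; ring.
apply: (le_trans (ler_normD _ _)); rewrite normrN.
apply: (le_trans (lerD (Lqg_lip _ _ _ _) (lexx _))).
rewrite norm_rVZ ger0_norm// /model_lip -[X in _ <= X * _]addrA [X in _ <= X]mulrDl.
rewrite lerD2l; apply: (@le_trans _ _ (2 * (`|x - x'| + `|y - y'|))).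
  by rewrite ler_wpM2l// lerDr.
by rewrite ler_wpM2r ?addr_ge0// lerDr mulr_ge0.
Qed.

(** Concavity: [quadr] dominates the modulus in the cone around [e], since
    [|z| <= (z.e) + (|z|^2 - (z.e)^2) / (2 z.e)] there. *)
Lemma modulus_le_quadr z : d / 2 <= dot z e ->
  Num.sqrt (dot z z) - dot z z <= quadr z.
Proof.
move=> ze; have di : 0 < d^-1 by rewrite invr_gt0.
have ze0 : 0 < dot z e by apply: lt_le_trans ze; rewrite divr_gt0.
have b0 : 0 <= dot z z - dot z e ^+ 2 by rewrite subr_ge0 sqr_dot_unit_le.
have s1 : Num.sqrt (dot z z) <= dot z e + d^-1 * (dot z z - dot z e ^+ 2).
  rewrite -[X in _ <= X]gtr0_norm ?ltr_wpDr ?mulr_ge0 ?(ltW di)// -sqrtr_sqr ler_wsqrtr//.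
  rewrite sqrrD; have := sqr_ge0 (d^-1 * (dot z z - dot z e ^+ 2)).
  have : dot z z - dot z e ^+ 2 <= dot z e * (d^-1 * (dot z z - dot z e ^+ 2)) *+ 2.
    have h : d / 2 * (d^-1 * (dot z z - dot z e ^+ 2)) <= dot z e * (d^-1 * (dot z z - dot z e ^+ 2)).
      by rewrite ler_wpM2r// mulr_ge0// ltW.
    have E : d / 2 * (d^-1 * (dot z z - dot z e ^+ 2)) = (dot z z - dot z e ^+ 2) / 2.
      by field; rewrite gt_eqF.
    rewrite E in h; lra.
  lra.
rewrite /quadr; lra.
Qed.

Lemma quadr_center z : z = d *: e -> quadr z = d - d ^+ 2 /\ dot z z = d ^+ 2.
Proof.
move=> ->; rewrite /quadr !dotZl !dotZr e1 !mulr1 -expr2 subrr mulr0 addr0.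
by split.
Qed.

End model_function.

Section within_product.
Context {R : realType} {n : nat}.
Implicit Types (D E : set 'rV[R]_n) (u : 'rV[R]_n -> R).

Lemma within_continuous_fst D E u : {within D, continuous u} ->
  {within D `*` E, continuous (fun p => u p.1)}.
Proof.
move=> /subspace_continuousP uc; apply/subspace_continuousP => -[a b] [/= Da Eb].
apply: (cvg_comp fst u _ (uc a Da)) => P DP.
have H : nbhs (a, b) [set p | D p.1 -> P p.1] by exact: (@cvg_fst _ _ (nbhs a) (nbhs b) _ _ DP).
by apply: (@filterS _ (nbhs (a, b)) _ _ _ _ H) => -[x y] /= h [Dx _]; exact: h.
Qed.

Lemma within_continuous_snd D E u : {within E, continuous u} ->
  {within D `*` E, continuous (fun p => u p.2)}.
Proof.
move=> /subspace_continuousP uc; apply/subspace_continuousP => -[a b] [/= Da Eb].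
apply: (cvg_comp snd u _ (uc b Eb)) => P EP.
have H : nbhs (a, b) [set p | E p.2 -> P p.2] by exact: (@cvg_snd _ _ (nbhs a) (nbhs b) _ _ EP).
by apply: (@filterS _ (nbhs (a, b)) _ _ _ _ H) => -[x y] /= h [_ Ey]; exact: h.
Qed.

End within_product.

Lemma ler_norm_sqr (R : realType) (r c : R) : 0 <= c -> r ^+ 2 <= c ^+ 2 -> `|r| <= c.
Proof.
by move=> c0 h; rewrite -(@ler_pXn2r _ 2)// ?nnegrE// real_normK ?num_real.
Qed.

Lemma sqr_ge4 (R : realType) (r : R) : 2 <= r \/ r <= - 2 -> 4 <= r ^+ 2.
Proof. by move=> [h|h]; nra. Qed.

Section ishii_lions.
Context {R : realType} {n : nat}.
Local Notation mu := (lebesgue_rV R n).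
Implicit Types (x y h k : 'rV[R]_n).
Variables (lambda Lambda q K : R) (F : 'M[R]_n -> R) (f u : 'rV[R]_n -> R).
Hypotheses (l0 : 0 < lambda) (lL : lambda <= Lambda) (q0 : 0 <= q) (K0 : 0 <= K) (n0 : (0 < n)%N).
Hypothesis Fell : forall M N, M^T = M -> N^T = N -> F M - F N <= pucci_sup lambda Lambda (M - N).
Let B : set 'rV[R]_n := [set x | dot x x < 1].
Hypothesis uc : forall x, B x -> {for x, continuous u}.
Hypothesis ub : forall x, B x -> `|u x| <= 1.
Hypothesis usub : quad_subsolution F q f B u.
Hypothesis usup : quad_subsolution (fun M => - F (- M)) q (fun x => - f x) B (fun x => - u x).
Hypothesis fK : mu.-negligible [set x | B x /\ f x < - K].
Hypothesis fK' : mu.-negligible [set x | B x /\ - f x < - K].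

(** With the penalisation [128 |x - x0|^2] a positive maximum of the doubled function is
    reached within [1/8] of [x0].  The Hessian of the model is at most [2 (128 + 2)], to which
    [2] is added by the perturbation [eta = 1] of the two matrices, and [- 8 L] appears in the
    joining direction; [134] makes the two points closer than [1/8] and the gradients of
    length at least [2]. *)
Definition lip_bound : R := 134%:R + (262%:R * (n%:R * Lambda) + 2 * K) / lambda.
Local Notation L := lip_bound.

Let La0 : 0 <= Lambda. Proof. exact: le_trans (ltW l0) lL. Qed.

Let c0 : 0 <= 262%:R * (n%:R * Lambda) + 2 * K.
Proof. exact: (addr_ge0 (mulr_ge0 (ler0n _ _) (mulr_ge0 (ler0n _ _) La0)) (mulr_ge0 (ler0n _ _) K0)). Qed.

Let L134 : 134%:R <= L.
Proof. by rewrite lerDl; exact: divr_ge0 c0 (ltW l0). Qed.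

Let L0 : 0 <= L. Proof. exact: le_trans (ler0n _ _) L134. Qed.

Let L_large : 262%:R * (n%:R * Lambda) + 2 * K < 8%:R * L * lambda.
Proof.
have -> : 8%:R * L * lambda = 8%:R * 134%:R * lambda + 8%:R * (262%:R * (n%:R * Lambda) + 2 * K).
  by rewrite /lip_bound; field; rewrite gt_eqF.
move: (262%:R * _ + _) c0 => c c_ge0; have := l0; lra.
Qed.

Let F'ell M N : M^T = M -> N^T = N -> - F (- M) - - F (- N) <= pucci_sup lambda Lambda (M - N).
Proof.
move=> sM sN; have := @Fell (- N) (- M).
rewrite opprK [- N + M]addrC => H; rewrite opprK addrC; apply: H.
  by rewrite linearN/= sN.
by rewrite linearN/= sM.
Qed.

Section doubling.
Variable x0 : 'rV[R]_n.
Hypothesis x0_half : dot x0 x0 < 4%:R^-1.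
Let D := cball x0 4%:R^-1.

(** The concave modulus [s - s^2] in place of [s] creates the negative second derivative. *)
Let Phi x y : R := u x - u y
  - L * (Num.sqrt (dot (x - y) (x - y)) - dot (x - y) (x - y)) - 128%:R * dot (x0 - x) (x0 - x).

Let DB : D `<=` B.
Proof.
move=> x; rewrite /D /cball /B /= => h.
have -> : x = x0 + - (x0 - x) by rewrite opprB subrKC.
apply: le_lt_trans (dot_double _ _) _; rewrite dotNl dotNr opprK.
have E : (4%:R^-1 : R) ^+ 2 = 16%:R^-1 by rewrite exprVn -natrX.
rewrite E in h; have := x0_half; lra.
Qed.

Let ucD : {within D, continuous u}.
Proof. by apply: continuous_in_subspaceT => x /set_mem Dx; apply: uc; exact: DB. Qed.

Let Phi_attained : exists x y, [/\ D x, D y & forall x' y', D x' -> D y' -> Phi x' y' <= Phi x y].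
Proof.
have q4 : (0 : R) <= 4%:R^-1 by rewrite invr_ge0.
have Dx0 : D x0 by rewrite /D /cball /= dot_dist0 sqr_ge0.
have D2 : (D `*` D) !=set0 by exists (x0, x0).
have c2 : compact (D `*` D) by apply: compact_setX; exact: cball_compact.
have ct0 : continuous (fun p : 'rV[R]_n * 'rV[R]_n => p.1 - p.2).
  by move=> p; exact: (@continuousB _ _ _ fst snd p cvg_fst cvg_snd).
have ct1 : continuous (fun p : 'rV[R]_n * 'rV[R]_n => dot (p.1 - p.2) (p.1 - p.2)).
  by move=> p; exact: (continuous_comp (ct0 p) (@continuous_dotxx _ _ (p.1 - p.2))).
have ct2 : continuous (fun p : 'rV[R]_n * 'rV[R]_n =>
    Num.sqrt (dot (p.1 - p.2) (p.1 - p.2)) - dot (p.1 - p.2) (p.1 - p.2)).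
  by move=> p; exact: (continuousB (continuous_comp (ct1 p) (@sqrt_continuous _ _)) (ct1 p)).
have ct3 : continuous (fun p : 'rV[R]_n * 'rV[R]_n => dot (x0 - p.1) (x0 - p.1)).
  by move=> p; exact: (@continuous_comp _ _ _ fst _ p cvg_fst (@continuous_dist _ _ x0 p.1)).
have ct4 : continuous (fun p : 'rV[R]_n * 'rV[R]_n =>
    L * (Num.sqrt (dot (p.1 - p.2) (p.1 - p.2)) - dot (p.1 - p.2) (p.1 - p.2))
    + 128%:R * dot (x0 - p.1) (x0 - p.1)).
  move=> p.
  have c1 := continuousM (@cst_continuous _ _ L p) (ct2 p).
  have c3 := continuousM (@cst_continuous _ _ (128%:R : R) p) (ct3 p).
  exact: (continuousD c1 c3).
have cP : {within D `*` D, continuous (fun p => Phi p.1 p.2)}.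
  have -> : (fun p : 'rV[R]_n * 'rV[R]_n => Phi p.1 p.2) = (fun p => (u p.1 - u p.2) -
    (L * (Num.sqrt (dot (p.1 - p.2) (p.1 - p.2)) - dot (p.1 - p.2) (p.1 - p.2))
     + 128%:R * dot (x0 - p.1) (x0 - p.1))).
    by apply/funext => p; rewrite /Phi; lra.
  apply: within_continuousB; last exact: ct4.
  move=> p; apply: continuousB; [exact: (within_continuous_fst ucD)|exact: (within_continuous_snd ucD)].
have [[a b] /set_mem[/= Da Db] ab] := compact_EVT_max D2 c2 cP.
by exists a, b; split => // x y Dx Dy; exact: (ab (x, y) (mem_set _)).
Qed.

(** At a positive maximum the second order conditions give, in the direction joining
    the two points, a concavity of order [L] that ellipticity cannot compensate. *)
Lemma doubling_le0 x y : D x -> D y -> Phi x y <= 0.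
Proof.
have [a [b [Da Db abmax]]] := Phi_attained.
move=> Dx Dy; apply: le_trans (abmax _ _ Dx Dy) _; rewrite leNgt; apply/negP => Phi0.
have L134' := L134.
pose d := Num.sqrt (dot (a - b) (a - b)).
have dd : dot (a - b) (a - b) = d ^+ 2 by rewrite sqr_sqrtr ?dotxx_ge0.
have d00 : 0 <= d by rewrite sqrtr_ge0.
have E16 : (4%:R^-1 : R) ^+ 2 = 16%:R^-1 by rewrite exprVn -natrX.
have ha : dot (x0 - a) (x0 - a) <= 16%:R^-1 by rewrite -E16.
have hb : dot (x0 - b) (x0 - b) <= 16%:R^-1 by rewrite -E16.
have d_half : d <= 2^-1.
  rewrite -[X in _ <= X]ger0_norm ?invr_ge0// -(ger0_norm d00) -!sqrtr_sqr ler_wsqrtr// -dd.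
  have -> : a - b = (x0 - b) + - (x0 - a) by rewrite opprB [RHS]addrC addrA subrK.
  apply: le_trans (dot_double _ _) _; rewrite dotNl dotNr opprK exprVn -natrX; lra.
have /ler_normlP[_ ua] := ub (DB Da); have /ler_normlP[ub' _] := ub (DB Db).
have Phi0' : 0 < u a - u b - L * (d - d ^+ 2) - 128%:R * dot (x0 - a) (x0 - a).
  by move: Phi0; rewrite /Phi -/d dd.
have a0 := dotxx_ge0 (x0 - a).
have dd2 : d / 2 <= d - d ^+ 2.
  by have := ler_wpM2l d00 d_half; rewrite expr2; lra.
have Ld : L * (d / 2) <= L * (d - d ^+ 2) by rewrite ler_wpM2l.
have Ld' : 134%:R * (d / 2) <= L * (d / 2) by rewrite ler_wpM2r// divr_ge0.
have d8 : d < 8%:R^-1 by lra.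
have a64 : dot (x0 - a) (x0 - a) < 64%:R^-1.
  have : 0 <= 134%:R * (d / 2) by rewrite mulr_ge0// divr_ge0.
  lra.
have d0 : 0 < d.
  rewrite lt_neqAle d00 andbT; apply/negP => /eqP dE.
  have ab : a = b by apply/subr0_eq/dotxx_eq0; rewrite dd -dE expr0n.
  move: Phi0'; rewrite -dE ab subrr expr0n subr0 mulr0.
  have := dotxx_ge0 (x0 - b); lra.
have b16 : dot (x0 - b) (x0 - b) < 16%:R^-1.
  have -> : x0 - b = (x0 - a) + (a - b) by rewrite addrA subrK.
  apply: le_lt_trans (dot_double _ _) _; rewrite dd.
  have : d ^+ 2 < 8%:R^-1 ^+ 2 by rewrite ltr_pXn2r// nnegrE// invr_ge0.
  rewrite exprVn -natrX; lra.
pose e := d^-1 *: (a - b).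
have e1 : dot e e = 1.
  by rewrite dotZl dotZr dd; field; rewrite gt_eqF.
have abE : a - b = d *: e by rewrite scalerA divff ?gt_eqF// scale1r.
have Oa : oball x0 4%:R^-1 a by rewrite /oball /= E16; lra.
have Ob : oball x0 4%:R^-1 b by rewrite /oball /= E16; lra.
have /nbhs_normP[r1 /= r10 hr1] : nbhs a (oball x0 4%:R^-1).
  by apply: open_nbhs_nbhs; split=> //; exact: oball_open.
have /nbhs_normP[r2 /= r20 hr2] : nbhs b (oball x0 4%:R^-1).
  by apply: open_nbhs_nbhs; split=> //; exact: oball_open.
have nn : 0 < 8%:R * (n%:R + 1) :> R by rewrite mulr_gt0// ltr_wpDl.
pose rho := Num.min (Num.min (r1 / 2) (r2 / 2)) (d / (8%:R * (n%:R + 1))).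
have rho0 : 0 < rho by rewrite !lt_min !divr_gt0.
have rho1 : rho < r1.
  by apply: (@le_lt_trans _ _ (r1 / 2)); [rewrite !ge_min lexx|lra].
have rho2 : rho < r2.
  by apply: (@le_lt_trans _ _ (r2 / 2)); [rewrite !ge_min lexx !orbT|lra].
have rhod : n%:R * rho <= d / 8%:R.
  have : rho <= d / (8%:R * (n%:R + 1)) by rewrite !ge_min lexx !orbT.
  rewrite ler_pdivlMr// => h; have := rho0; lra.
have aD x' : cball a rho x' -> D x'.
  by move=> /(cball_norm (ltW rho0)) h; apply: ltW; apply: hr1; exact: le_lt_trans rho1.
have bD x' : cball b rho x' -> D x'.
  by move=> /(cball_norm (ltW rho0)) h; apply: ltW; apply: hr2; exact: le_lt_trans rho2.
have oc c : oball c rho `<=` cball c rho by move=> ?; exact: ltW.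
have near_e (c x' : 'rV[R]_n) : cball c rho x' -> `|dot (c - x') e| <= d / 8%:R.
  move=> /(cball_norm (ltW rho0)) h; apply: (le_trans (dot_unit_le e1 _)).
  by apply: le_trans rhod; rewrite ler_wpM2l.
have cone x' y' : cball a rho x' -> cball b rho y' ->
    dot (x' - y') e <= 5%:R * d / 4%:R /\ 3%:R * d / 4%:R <= dot (x' - y') e.
  move=> /near_e + /near_e; rewrite !ler_norml => /andP[h1 h2] /andP[h3 h4].
  have -> : x' - y' = (a - b) - ((a - x') - (b - y')).
    by apply/rowP => i; rewrite !mxE; ring.
  rewrite abE (dotBl (d *: e)) (dotBl (a - x')) (dotZl d e) e1; split; lra.
pose P := model e L 128%:R d x0 a b.
have far x' y' : cball a rho x' -> cball b rho y' ->
    2 <= dot (quadr_grad e d (x' - y')) e * L - 65%:R.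
  move=> ax by_; have [h1 h2] := cone x' y' ax by_.
  rewrite quadr_grad_dot//.
  have : (1 - 2 * dot (x' - y') e) * 134%:R <= (1 - 2 * dot (x' - y') e) * L by rewrite ler_wpM2l//; lra.
  lra.
have far1 x' y' : cball a rho x' -> cball b rho y' ->
    4 <= dot (model_g1 e L 128%:R d x0 a x' y') (model_g1 e L 128%:R d x0 a x' y').
  move=> ax by_; apply: le_trans (sqr_dot_unit_le _ e1); apply: sqr_ge4; left.
  have h := far x' y' ax by_.
  have := near_e _ _ ax; rewrite ler_norml => /andP[h1 h2].
  have : `|dot (x0 - x') e| <= 4%:R^-1.
    apply: ler_norm_sqr; first by rewrite invr_ge0.
    by apply: le_trans (sqr_dot_unit_le _ e1) _; exact: aD.
  rewrite ler_norml => /andP[h3 h4].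
  rewrite /model_g1; move: (quadr_grad _ _ _) h => g h.
  rewrite (dotDl (_ + _)) (dotDl (L *: g)) !dotZl -(opprB x0 x') -(opprB a x') !dotNl.
  rewrite [L * _]mulrC; lra.
have far2 x' y' : cball a rho x' -> cball b rho y' ->
    4 <= dot (model_g2 e L d b x' y') (model_g2 e L d b x' y').
  move=> ax by_; apply: le_trans (sqr_dot_unit_le _ e1); apply: sqr_ge4; right.
  have h := far x' y' ax by_.
  have := near_e _ _ by_; rewrite ler_norml => /andP[h1 h2].
  rewrite /model_g2; move: (quadr_grad _ _ _) h => g h.
  rewrite (dotDl (- _)) dotNl !dotZl -(opprB b y') !dotNl.
  rewrite [L * _]mulrC; lra.
have strict x' y' : cball a rho x' -> cball b rho y' ->
    u x' + - u y' - P x' y' <=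
    u a + - u b - P a b - dot (a - x') (a - x') - dot (b - y') (b - y').
  move=> ax by_; have [h1 h2] := cone x' y' ax by_.
  have h3 := abmax _ _ (aD _ ax) (bD _ by_).
  have h4 : Num.sqrt (dot (x' - y') (x' - y')) - dot (x' - y') (x' - y') <= quadr e d (x' - y').
    by apply: modulus_le_quadr => //; lra.
  have h5 := ler_wpM2l L0 h4.
  have [h6 _] := quadr_center e1 abE.
  rewrite /Phi -/d dd in h3; rewrite /P /model h6 !dot_dist0; lra.
have sub1 : quad_subsolution F q f (oball a rho) u.
  by move=> y' p X Oy; apply: usub; exact/DB/aD/oc.
have sub2 : quad_subsolution (fun M => - F (- M)) q (fun x => - f x) (oball b rho) (fun x => - u x).
  by move=> y' p X Oy; apply: usup; exact/DB/bD/oc.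
have neg1 : mu.-negligible [set x | oball a rho x /\ f x < - K].
  by apply: negligibleS fK => x' [/= /oc/aD/DB].
have neg2 : mu.-negligible [set x | oball b rho x /\ - f x < - K].
  by apply: negligibleS fK' => x' [/= /oc/bD/DB].
have uca : {within cball a rho, continuous u}.
  by apply: continuous_in_subspaceT => z /set_mem /aD /DB; exact: uc.
have ucb : {within cball b rho, continuous (fun x => - u x)}.
  by apply: continuous_in_subspaceT => z /set_mem /bD /DB /uc; exact: continuousN.
have bd1 z : cball a rho z -> `|u z| <= 1 by move=> /aD/DB; exact: ub.
have bd2 z : cball b rho z -> `|- u z| <= 1 by rewrite normrN => /bD/DB; exact: ub.
have CQ0 : 0 <= 2 * L * (1 + d^-1) + 128%:R + 1.
  have di : 0 <= d^-1 by rewrite invr_ge0.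
  exact: (addr_ge0 (addr_ge0 (mulr_ge0 (mulr_ge0 (ler0n R 2) L0) (addr_ge0 ler01 di)) (ler0n R 128)) ler01).
have M0 : 0 <= 128%:R :> R := ler0n R 128.
have [X [Y [sX sY XY FX FY]]] := theorem_on_sums l0 lL q0 K0 n0 Fell F'ell rho0
  uca ucb bd1 bd2 sub1 sub2 neg1 neg2 (modelD e L 128%:R d x0 a b)
  (model_form_le e1 L0 M0 d0) (model_formZ e L 128%:R d) CQ0
  (model_lip_ge0 L0 M0 d0) (model_g1_lip x0 a e1 L0 M0 d0) (model_g2_lip b e1 L0 M0 d0)
  far1 far2 strict.
pose S := (X + 1%:M) - - (Y + 1%:M).
have qS k : qf S k = qf X k + qf Y k + 2 * dot k k.
  by rewrite /S opprK !qfD !qf_scalar; ring.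
have Sle k : qf S k <= 262%:R * dot k k.
  have := XY k k; rewrite qS /model_form /quadr_form subrr !dot0l expr0n/=; lra.
(* The increments [e] and [- e] differ by [2 e], where [quadr_form] is [- 4]. *)
have Se : qf S e <= 262%:R - 8%:R * L.
  have := XY e (- e); rewrite qS /model_form /quadr_form opprK !dotDl !dotDr dotNl dotNr e1.
  have -> : qf Y (- e) = qf Y e by rewrite -scaleN1r qf_scale sqrrN expr1n mul1r.
  have -> : 1 + 1 + (1 + 1) - (1 + 1) ^+ 2 = 0 :> R by ring.
  rewrite mulr0; lra.
have sX1 : (X + 1%:M)^T = X + 1%:M by rewrite linearD/= sX tr_scalar_mx.
have sY1 : (- (Y + 1%:M))^T = - (Y + 1%:M) by rewrite linearN/= linearD/= sY tr_scalar_mx.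
have h1 := pucci_sup_le l0 lL (ler0n R 262) e1 Sle Se.
have h2 := Fell sX1 sY1.
have h3 := FX 1 ltr01; have h4 := FY 1 ltr01.
have := L_large; lra.
Qed.

End doubling.

(** Points at distance more than [1/4] are handled by the bound on [u]. *)
Lemma lipschitz_half_ball x y : dot x x < 4%:R^-1 -> dot y y < 4%:R^-1 ->
  `|u x - u y| <= L * Num.sqrt (dot (x - y) (x - y)).
Proof.
have main x' y' : dot x' x' < 4%:R^-1 -> dot y' y' < 4%:R^-1 ->
    u x' - u y' <= L * Num.sqrt (dot (x' - y') (x' - y')).
  move=> x4 y4; set s := Num.sqrt _.
  have s0 : 0 <= s by rewrite sqrtr_ge0.
  have [ly|ly] := lerP (dot (x' - y') (x' - y')) (4%:R^-1 ^+ 2).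
    have Dx : cball x' 4%:R^-1 x' by rewrite /cball /= dot_dist0 sqr_ge0.
    have := doubling_le0 x4 Dx ly; rewrite dot_dist0 mulr0 subr0 -/s.
    have : L * (s - dot (x' - y') (x' - y')) <= L * s.
      by rewrite ler_wpM2l// gerBl dotxx_ge0.
    lra.
  have s4 : 4%:R^-1 <= s.
    rewrite -[X in X <= _]ger0_norm ?invr_ge0// -sqrtr_sqr ler_wsqrtr//; exact: ltW.
  have : 134%:R * 4%:R^-1 <= L * s by apply: ler_pM => //; rewrite invr_ge0.
  have Bx : B x' by rewrite /B /=; lra.
  have By : B y' by rewrite /B /=; lra.
  have /ler_normlP[_ h1] := ub Bx; have /ler_normlP[h2 _] := ub By; lra.
move=> x4 y4; rewrite ler_norml; apply/andP; split; last exact: main.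
rewrite lerNl opprB; have := main y x y4 x4.
by rewrite -(opprB x y) dotNl dotNr opprK.
Qed.

End ishii_lions.

(** * Quadratic test functions and essential bounds *)

Section quadratic_tests.
Context {R : realType} {n : nat}.
Implicit Types (x y v p h : 'rV[R]_n) (u g : 'rV[R]_n -> R).

(** Quadratic functions are differentiated along lines, on which they are exact
    polynomials of degree two. *)
Lemma derive_quadratic_line g x v (a b : R) :
  (forall s : R, g (x + s *: v) = g x + s * a + s ^+ 2 * b) ->
  derivable g x v /\ 'D_v g x = a.
Proof.
move=> gE.
have cv : (fun s : R => s^-1 *: ((g \o shift x) (s *: v) - g x)) @ 0^' --> a.
  have c1 : (fun s : R => a + s * b) @ 0^' --> a.
    apply: (@cvg_trans _ ((fun s : R => a + s * b) @ (0 : R))).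
      by move=> P h; exact: (@cvg_within _ (nbhs (0 : R)) _ _ _ h).
    have aE : a = a + 0 * b by rewrite mul0r addr0.
    rewrite [in X in _ `=>` X]aE.
    exact: (continuousD (@cst_continuous _ _ a (0 : R))
      (continuousM (@cvg_id _ (nbhs (0 : R))) (@cst_continuous _ _ b (0 : R)))).
  apply: cvg_trans c1; apply: near_eq_cvg; near=> s.
  have s0 : s != 0 by near: s; exact: nbhs_dnbhs_neq.
  rewrite /= [s *: v + x]addrC gE /GRing.scale /=; field; exact: s0.
by split; [apply: cvgP cv|exact/norm_cvg_lim].
Unshelve. all: by end_near.
Qed.

Definition quad_test y p (X : 'M[R]_n) x := dot p (x - y) + qf X (x - y) / 2.

Let shiftE x y (s : R) v : x + s *: v - y = (x - y) + s *: v.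
Proof. by rewrite addrAC. Qed.

Lemma quad_test_line y p X x v (s : R) : X^T = X ->
  quad_test y p X (x + s *: v) = quad_test y p X x
    + s * (dot p v + dot ((x - y) *m X) v) + s ^+ 2 * (qf X v / 2).
Proof.
move=> sX; rewrite /quad_test shiftE qf_add// qf_scale !dotDr !dotZr; by field.
Qed.

Lemma dot_mulmx_line y (X : 'M[R]_n) x v w (s : R) :
  dot ((x + s *: v - y) *m X) w = dot ((x - y) *m X) w + s * dot (v *m X) w + s ^+ 2 * 0.
Proof. by rewrite shiftE mulmxDl -scalemxAl dotDl dotZl mulr0 addr0. Qed.

Let continuous_sub_coord y (j : 'I_n) : continuous (fun x => (x - y) 0 j).
Proof.
move=> x; have -> : (fun x => (x - y) 0 j) = (fun x : 'rV[R]_n => x 0 j - y 0 j).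
  by apply/funext => z; rewrite !mxE.
exact: (continuousB (@continuous_coord _ _ j x) (@cst_continuous _ _ (y 0 j) x)).
Qed.

Let continuous_mulmx_coord y (X : 'M[R]_n) (j : 'I_n) : continuous (fun x => ((x - y) *m X) 0 j).
Proof.
have -> : (fun x => ((x - y) *m X) 0 j) = (fun x => \sum_k (x - y) 0 k * X k j).
  by apply/funext => z; rewrite mxE.
apply: continuous_bigsum => k x.
exact: (continuousM (@continuous_sub_coord y k x) (@cst_continuous _ _ (X k j) x)).
Qed.

Lemma continuous_dot_mulmx y (X : 'M[R]_n) (w : 'rV[R]_n) : continuous (fun x => dot ((x - y) *m X) w).
Proof.
apply: continuous_bigsum => k x.
exact: (continuousM (@continuous_mulmx_coord y X k x) (@cst_continuous _ _ (w 0 k) x)).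
Qed.

Lemma continuous_quad_test y p X : continuous (quad_test y p X).
Proof.
have c1 : continuous (fun x => dot p (x - y)).
  apply: continuous_bigsum => k x.
  exact: (continuousM (@cst_continuous _ _ (p 0 k) x) (@continuous_sub_coord y k x)).
have c2 : continuous (fun x => qf X (x - y)).
  have -> : (fun x => qf X (x - y)) = (fun x => dot ((x - y) *m X) (x - y)).
    by apply/funext => x; rewrite qfE.
  apply: continuous_bigsum => k x.
  exact: (continuousM (@continuous_mulmx_coord y X k x) (@continuous_sub_coord y k x)).
by move=> x; exact: (continuousD (c1 x) (continuousM (c2 x) (@cst_continuous _ _ (2^-1 : R) x))).
Qed.

Lemma derive_quad_test y p X v : X^T = X ->
  (forall x, derivable (quad_test y p X) x v) /\
  forall x, 'D_v (quad_test y p X) x = dot p v + dot ((x - y) *m X) v.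
Proof.
move=> sX.
have H x := derive_quadratic_line (fun s => @quad_test_line y p X x v s sX).
by split=> x; case: (H x).
Qed.

Lemma derive_dot_mulmx y p (X : 'M[R]_n) v w :
  (forall x, derivable (fun x => dot p w + dot ((x - y) *m X) w) x v) /\
  forall x, 'D_v (fun x => dot p w + dot ((x - y) *m X) w) x = dot (v *m X) w.
Proof.
have H x : derivable (fun x => dot p w + dot ((x - y) *m X) w) x v /\
   'D_v (fun x => dot p w + dot ((x - y) *m X) w) x = dot (v *m X) w.
  apply: (@derive_quadratic_line _ _ _ _ 0) => s.
  by rewrite dot_mulmx_line !mulr0 !addr0 addrA.
by split=> x; case: (H x).
Qed.

Lemma quad_test_C2 U y p X : X^T = X -> C_ 2 U (quad_test y p X).
Proof.
move=> sX; split=> [x _|i]; first exact: continuous_quad_test.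
have [d1 E1] := derive_quad_test y p (evec i) sX; split=> //.
rewrite (funext E1); split=> [x _|j].
  exact: (continuousD (@cst_continuous _ _ _ x) (@continuous_dot_mulmx y X (evec i) x)).
have [d2 E2] := derive_dot_mulmx y p X (evec j) (evec i); split=> //.
by rewrite (funext E2); split=> // x _; exact: cst_continuous.
Qed.

Lemma grad_quad_test y p X : X^T = X -> grad (quad_test y p X) y = p.
Proof.
move=> sX; apply/rowP => i; rewrite mxE (derive_quad_test y p (evec i) sX).2.
by rewrite subrr mul0mx dot0l addr0 /evec dot_delta.
Qed.

Lemma hessian_quad_test y p X : X^T = X -> hessian (quad_test y p X) y = X.
Proof.
move=> sX; apply/matrixP => i j; rewrite mxE.
rewrite (funext (derive_quad_test y p (evec j) sX).2 : 'D_(evec j) (quad_test y p X) = _).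
rewrite (derive_dot_mulmx y p X (evec i) (evec j)).2 /evec dot_delta mxE.
rewrite (bigD1 i)//= big1 ?addr0 => [|k ki]; first by rewrite mxE !eqxx mul1r.
by rewrite mxE (negbTE ki) andbF mul0r.
Qed.

Lemma visc_sub_quad (F : 'M[R]_n -> R) q f U u :
  visc_subsolution F q f U u -> quad_subsolution F q f U u.
Proof.
move=> usub y p X Uy sX [r r0 touch].
have := usub (quad_test y p X) y Uy (quad_test_C2 _ _ _ sX).
rewrite /degenerate_op grad_quad_test// hessian_quad_test//; apply.
apply/nbhs_normP; exists r => //= x; rewrite /ball_ /= => xr.
have := touch (x - y); rewrite distrC subrKC => /(_ xr).
by rewrite /quad_test subrr dot0r [qf _ 0]qfE mul0mx dot0l; lra.
Qed.

(** A supersolution is the opposite of a subsolution for [M |-> - F (- M)], which satisfies the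
    same ellipticity bounds; this lets the two points of the doubling argument be treated
    alike. *)
Lemma visc_super_quad (F : 'M[R]_n -> R) q f U u : visc_supersolution F q f U u ->
  quad_subsolution (fun M => - F (- M)) q (fun x => - f x) U (fun x => - u x).
Proof.
move=> usup y p X Uy sX [r r0 touch].
have sX' : (- X)^T = - X by rewrite linearN/= sX.
have := usup (quad_test y (- p) (- X)) y Uy (quad_test_C2 _ _ _ sX').
rewrite /degenerate_op grad_quad_test// hessian_quad_test// => H.
have -> : enorm p = enorm (- p) by rewrite !enormE dotNl dotNr opprK.
rewrite mulrN lerN2; apply: H.
apply/nbhs_normP; exists r => //= x; rewrite /ball_ /= => xr.
have := touch (x - y); rewrite distrC subrKC => /(_ xr).
by rewrite /quad_test subrr dot0r [qf _ 0]qfE mul0mx dot0l qfN dotNl; lra.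
Qed.

End quadratic_tests.

Section essential_bound.
Context {R : realType} {n : nat}.
Local Notation mu := (lebesgue_rV R n).
Implicit Types (U : set 'rV[R]_n) (h : 'rV[R]_n -> R).

Lemma eballE (r : R) (x : 'rV[R]_n) : 0 < r -> eball r x = (dot x x < r ^+ 2) :> Prop.
Proof.
move=> r0; rewrite /eball /= enormE -[in LHS](gtr0_norm r0) -sqrtr_sqr ltr_sqrt//.
by rewrite exprn_gt0.
Qed.

Lemma Linfty_normE U h : Linfty_norm U h = ess_sup mu (abse \o (EFin \o (h \_ U))).
Proof. by rewrite /Linfty_norm unlock /= lebesgue_rVT_gt0. Qed.

Lemma Linfty_norm_negligible U h (K : R) : Linfty_norm U h = K%:E ->
  mu.-negligible [set x | U x /\ K < `|h x|].
Proof.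
move=> hK; have := ess_sup_ge mu (abse \o (EFin \o (h \_ U))).
rewrite -Linfty_normE hK; apply: negligibleS => x [Ux Kh] /=.
by rewrite lee_fin patchE mem_set//; apply/negP; rewrite -ltNge.
Qed.

Lemma Linfty_norm_ge0 U h (K : R) : Linfty_norm U h = K%:E -> 0 <= K.
Proof.
rewrite Linfty_normE => hK; rewrite -lee_fin -hK.
by apply: ess_sup_gee; [exact: lebesgue_rVT_gt0|apply: aeW => x; rewrite abse_ge0].
Qed.

Lemma Linfty_norm_le U h (C : R) : 0 <= C -> mu.-negligible [set x | U x /\ ~ `|h x| <= C] ->
  (Linfty_norm U h <= C%:E)%E.
Proof.
move=> C0 hC; rewrite Linfty_normE; apply/ess_supP.
apply: negligibleS hC => x /= /negP; rewrite lee_fin patchE.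
case: (boolP (x \in U)) => [/set_mem Ux|_]; first by move=> /negP.
by rewrite normr0 C0.
Qed.

End essential_bound.

(** * Weak gradients of Lipschitz functions *)

Section mcshane.
Context {R : realType} {n : nat}.
Implicit Types (x y : 'rV[R]_n) (U : set 'rV[R]_n) (u : 'rV[R]_n -> R).

(** A Lipschitz function on a subset is the restriction of the lower envelope of
    the cones [u y + L * |x - y|]. *)
Lemma lipschitz_extension U u (L : R) : 0 <= L ->
  (forall x y, U x -> U y -> `|u x - u y| <= L * `|x - y|) ->
  exists2 v : 'rV[R]_n -> R, (forall x y, `|v x - v y| <= L * `|x - y|) &
    forall x, U x -> v x = u x.
Proof.
move=> L0 uL; have [[y0 Uy0]|noU] := pselect (U !=set0); last first.
  by exists (fun=> 0) => [x y|x Ux]; [rewrite subrr normr0 mulr_ge0|case: noU; exists x].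
pose S x := [set u y + L * `|x - y| | y in U].
have lb x y : U y -> u y0 - L * `|x - y0| <= u y + L * `|x - y|.
  move=> Uy; have /ler_normlP[_ h1] := uL _ _ Uy0 Uy.
  have : L * `|y0 - y| <= L * (`|x - y0| + `|x - y|).
    by rewrite ler_wpM2l// [`|x - y0|]distrC (le_trans _ (ler_normD _ _))// subrKA.
  lra.
have Slb x : has_lbound (S x) by exists (u y0 - L * `|x - y0|) => _ [y Uy <-]; exact: lb.
have S0 x : S x !=set0 by exists (u y0 + L * `|x - y0|), y0.
have half x y : inf (S x) <= inf (S y) + L * `|x - y|.
  rewrite -lerBlDr; apply: lb_le_inf => // _ [z Uz <-].
  rewrite lerBlDr; apply: (@le_trans _ _ (u z + L * `|x - z|)).
    by apply: ge_inf => //; exists z.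
  have : L * `|x - z| <= L * (`|x - y| + `|y - z|).
    by rewrite ler_wpM2l// (le_trans _ (ler_normD _ _))// subrKA.
  lra.
exists (fun x => inf (S x)) => [x y|x Ux].
  rewrite ler_norml; apply/andP; split; last by rewrite lerBlDl; exact: half.
  by rewrite lerNl opprB lerBlDl distrC; exact: half.
apply/eqP; rewrite eq_le; apply/andP; split.
  apply: ge_inf => //; exists x => //.
  by rewrite subrr normr0 mulr0 addr0.
apply: lb_le_inf => // _ [y Uy <-].
by have /ler_normlP[_ h1] := uL _ _ Ux Uy; lra.
Qed.

End mcshane.

Section directional_sequences.
Context {R : realType} {n : nat}.
Implicit Types (x v : 'rV[R]_n) (f g : 'rV[R]_n -> R).

Definition dseq f v (k : nat) x : R := k.+1%:R * (f (x + k.+1%:R^-1 *: v) - f x).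

Let kV (k : nat) : 0 < k.+1%:R^-1 :> R. Proof. by rewrite invr_gt0. Qed.

Lemma ddir_dseq f x v d : ddir f x v d -> dseq f v ^~ x @ \oo --> d.
Proof.
move=> fd; apply/cvgrPdist_le => e e0; have [r r0 fr] := fd e e0.
near=> k.
have kr : k.+1%:R^-1 < r.
  have : `|(0 : R) - harmonic k| < r.
    by near: k; move/cvgrPdist_lt : (@cvg_harmonic R); exact.
  by rewrite sub0r normrN ger0_norm ?(ltW (kV k)).
have := fr k.+1%:R^-1; rewrite (gtr0_norm (kV k)) => /(_ kr) h.
have -> : d - dseq f v k x = - k.+1%:R * (f (x + k.+1%:R^-1 *: v) - f x - d * k.+1%:R^-1).
  by rewrite /dseq; field; rewrite addrC natr1 pnatr_eq0.
rewrite normrM normrN (ger0_norm (ler0n R k.+1)).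
have := ler_wpM2l (ler0n R k.+1) h; rewrite mulrCA mulfV ?mulr1// pnatr_eq0//.
Unshelve. all: by end_near.
Qed.

Lemma derivable_ddir f x v : derivable f x v -> ddir f x v ('D_v f x).
Proof.
move=> /cvgrPdist_le fd e e0.
have /nbhs_normP[r /= r0 hr] : nbhs (0 : R) (fun s => s != 0 ->
    `|'D_v f x - s^-1 *: ((f \o shift x) (s *: v) - f x)| <= e) by exact: fd.
exists r => // s sr; have [->|s0] := eqVneq s 0.
  by rewrite scale0r addr0 subrr mulr0 subr0 normr0 mulr0.
have := hr s; rewrite /ball_ /= sub0r normrN => /(_ sr s0).
rewrite /= [s *: v + x]addrC /GRing.scale /= => h.
have -> : f (x + s *: v) - f x - 'D_v f x * s = - s * ('D_v f x - s^-1 * (f (x + s *: v) - f x)).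
  by field.
by rewrite normrM normrN mulrC ler_wpM2r.
Qed.

Lemma ddir_le_lipschitz f x v d (L : R) :
  (forall x y, `|f x - f y| <= L * `|x - y|) -> `|v| <= 1 -> 0 <= L ->
  ddir f x v d -> `|d| <= L.
Proof.
move=> fL v1 L0 fd; apply/ler_addgt0Pr => e e0; have [r r0 fr] := fd e e0.
have r2 : 0 < r / 2 by rewrite divr_gt0.
have := fr (r / 2); rewrite (gtr0_norm r2) => H; have h : r / 2 < r by lra.
move/H : h => {}H; have := fL (x + (r / 2) *: v) x.
rewrite [x + _]addrC addrK norm_rVZ (gtr0_norm r2) => h.
have h' : L * (r / 2 * `|v|) <= L * (r / 2) by rewrite ler_wpM2l// ler_piMr// ltW.
rewrite -(ler_pM2r r2) mulrDl -(gtr0_norm r2) -normrM (gtr0_norm r2).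
rewrite [x + _]addrC in H.
move: (f (r / 2 *: v + x) - f x) (d * (r / 2)) H h => a b H h.
have : `|b| <= `|a| + `|a - b|.
  by rewrite -[X in `|X| <= _](subKr a) (le_trans (ler_normB _ _)).
lra.
Qed.

(** The mean value inequality along a line, where the derivative is only assumed
    to be bounded. *)
Lemma derivable_line_lipschitz f v (C : R) :
  (forall x, derivable f x v) -> (forall x, `|'D_v f x| <= C) ->
  forall x (s : R), 0 <= s -> `|f (x + s *: v) - f x| <= C * s.
Proof.
move=> fd fC x s s0; pose h (t : R) := f (x + t *: v).
have hd (t : R) : is_derive t 1 h ('D_v f (x + t *: v)).
  have E (k : R) : (h \o shift t) (k *: (1 : R)) - h t =
      (f \o shift (x + t *: v)) (k *: v) - f (x + t *: v).
    have k1 : k *: (1 : R) = k by rewrite /GRing.scale /= mulr1.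
    by rewrite /h /= k1 scalerDl addrCA.
  have Eq : (fun k : R => k^-1 *: ((h \o shift t) (k *: (1 : R)) - h t)) =
      (fun k => k^-1 *: ((f \o shift (x + t *: v)) (k *: v) - f (x + t *: v))).
    by apply/funext => k; rewrite E.
  by apply: DeriveDef; [rewrite /derivable Eq; exact: fd|rewrite /derive Eq].
have [|t _] := @MVT_segment R h (fun t => 'D_v f (x + t *: v)) 0 s s0 (fun t _ => hd t).
  apply: derivable_within_continuous => t _; exact: ex_derive.
rewrite /h scale0r addr0 subr0 => ->.
by rewrite normrM (ger0_norm s0) ler_wpM2r.
Qed.

End directional_sequences.

Section integration.
Context {R : realType} {n : nat}.
Local Notation mu := (lebesgue_rV R n).
Implicit Types (W : set 'rV[R]_n) (f : 'rV[R]_n -> R).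

Lemma integrable_supported W f (c : R) : measurable W -> (mu W < +oo)%E ->
  measurable_fun setT f -> (forall x, `|f x| <= c) -> (forall x, ~ W x -> f x = 0) ->
  mu.-integrable setT (EFin \o f).
Proof.
move=> mW Woo mf fc f0.
have -> : EFin \o f = (EFin \o f) \_ W.
  apply/funext => x; rewrite patchE; case: ifPn => // /negP nW.
  by rewrite /= f0// => Wx; apply: nW; exact: mem_set.
apply/(integrable_mkcond _ mW); apply: measurable_bounded_integrable => //.
  exact: measurable_funS mf.
exists c; split; first exact: num_real.
by move=> M cM x _; apply: (le_trans (fc x)); exact: ltW.
Qed.

Lemma integral_translate f (a : 'rV[R]_n) : measurable_fun setT f ->
  mu.-integrable setT (EFin \o (fun x => f (x + a))) ->
  (\int[mu]_x (f (x + a))%:E = \int[mu]_x (f x)%:E)%E.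
Proof.
move=> mf fi; have mt := @measurable_translate R n a.
have mf' : measurable_fun setT (EFin \o f) by exact/measurable_EFinP.
have := @integral_pushforward _ _ _ _ R _ mt mu setT (EFin \o f) mf' fi measurableT.
rewrite preimage_setT => <-.
apply: eq_measure_integral => A mA _; exact: lebesgue_rV_translate.
Qed.

End integration.

Section weak_derivative.
Context {R : realType} {n : nat}.
Local Notation mu := (lebesgue_rV R n).
Implicit Types (x y : 'rV[R]_n) (U : set 'rV[R]_n).
Variables (u : 'rV[R]_n -> R) (L : R).
Hypotheses (L0 : 0 <= L) (uL : forall x y, `|u x - u y| <= L * `|x - y|).

Let cu : continuous u. Proof. exact: (lipschitz_continuous uL). Qed.

(** An everywhere defined Borel representative of the directional derivative, as a
    pointwise limit of difference quotients cut off on a null Borel set. *)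
Lemma measurable_ddir (e : 'rV[R]_n) : e != 0 -> `|e| <= 1 -> exists G : 'rV[R]_n -> R,
  [/\ measurable_fun setT G, forall x, `|G x| <= L &
   mu.-negligible [set x | ~ ddir u x e (G x)]].
Proof.
move=> e0 e1; have [A [mA A0 ZA]] := ddir_ae uL e0.
have /choice[G HG] x : exists d : R, (A x /\ d = 0) \/ (~ A x /\ ddir u x e d).
  have [Ax|nAx] := pselect (A x); first by exists 0; left.
  have [d xd] : exists d, ddir u x e d by apply: contrapT => /ZA.
  by exists d; right.
exists G; split.
- apply: (@measurable_fun_cvg _ _ _ _ (fun k x => \1_(~` A) x * dseq u e k x)).
    move=> k; apply: measurable_funM; first exact/measurable_indic/measurableC.
    apply: measurable_funM => //; apply: measurable_funB; last exact: continuous_measurable_rV.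
    apply: (measurableT_comp (continuous_measurable_rV cu)); exact: measurable_translate.
  move=> x _; case: (HG x) => -[Ax xd].
    have -> : (fun k => \1_(~` A) x * dseq u e k x) = fun=> G x.
      by apply/funext => k; rewrite xd indicE memNset ?mul0r//= => /(_ Ax).
    exact: cvg_cst.
  have -> : (fun k => \1_(~` A) x * dseq u e k x) = dseq u e ^~ x.
    by apply/funext => k; rewrite indicE mem_set ?mul1r.
  exact: ddir_dseq.
- move=> x; case: (HG x) => -[_]; first by move=> ->; rewrite normr0.
  exact: ddir_le_lipschitz.
- by exists A; split => // x /= nx; apply: contrapT => nAx; case: (HG x) => -[].
Qed.

Section integration_by_parts.
Variables (U : set 'rV[R]_n) (psi : 'rV[R]_n -> R) (i : 'I_n) (G : 'rV[R]_n -> R).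
Hypotheses (U1 : forall x, U x -> `|x| < 1) (psiT : test_function U psi).
Hypotheses (mG : measurable_fun setT G) (GL : forall x, `|G x| <= L).
Let e : 'rV[R]_n := evec i.
Hypothesis GE : mu.-negligible [set x | ~ ddir u x e (G x)].

Let e1 : `|e| <= 1.
Proof. by apply: norm_rV_le => // j; rewrite mxE eqxx; case: (j == i); rewrite ?normr1 ?normr0. Qed.

Let cpsi : continuous psi.
Proof. by case: psiT => /(_ 0%N) [c _] _ x; apply: c; exact: mem_set. Qed.

Let dpsi : forall x, derivable psi x e.
Proof. by case: psiT => /(_ 1%N) [_ /(_ i) [d _]] _ x; exact: d. Qed.

Let cdpsi : continuous ('D_e psi).
Proof. by case: psiT => /(_ 1%N) [_ /(_ i) [_ [c _]]] _ x; apply: c; exact: mem_set. Qed.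

Let dpsi0 (K : set 'rV[R]_n) x : compact K -> (forall x, ~ K x -> psi x = 0) -> ~ K x -> 'D_e psi x = 0.
Proof.
move=> cK psi0 nK; rewrite (@near_eq_derive _ _ _ psi (cst 0)) ?derive_cst//.
have oK : open (~` K) by apply: closed_openC; apply: compact_closed => //; exact: norm_hausdorff.
by apply: filterS (open_nbhs_nbhs (conj oK nK)) => y; exact: psi0.
Qed.

Let bounded_supported (K : set 'rV[R]_n) (f : 'rV[R]_n -> R) : compact K -> continuous f ->
  (forall x, ~ K x -> f x = 0) -> exists2 c : R, 0 <= c & forall x, `|f x| <= c.
Proof.
move=> cK cf f0; have [K0|noK] := pselect (K !=set0); last first.
  by exists 0 => // x; rewrite f0 ?normr0// => Kx; apply: noK; exists x.
have cn : {within K, continuous (fun x => `|f x|)}.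
  apply: continuous_subspaceT => x; exact: (continuous_comp (cf x) (@norm_continuous _ _ (f x))).
have [y _ ymax] := compact_EVT_max K0 cK cn.
exists `|f y| => // x; have [Kx|nK] := pselect (K x); first by apply: ymax; exact: mem_set.
by rewrite f0// normr0.
Qed.

Let W : set 'rV[R]_n := cube 0 2.

Let W_shift (s : R) x : 0 <= s <= 1 -> U (x + s *: e) -> W x.
Proof.
move=> /andP[s0 s1] /U1 h j; rewrite [(0 : 'rV_n) 0 j]mxE subr0.
have -> : x 0 j = (x + s *: e) 0 j - (s *: e) 0 j by rewrite !mxE; ring.
apply: (le_lt_trans (ler_normB _ _)).
have h1 := coord_le_norm (x + s *: e) j; have h2 := coord_le_norm (s *: e) j.
have h3 : `|s *: e| <= 1 by rewrite norm_rVZ (ger0_norm s0) mulr_ile1.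
lra.
Qed.

Let W_norm x : W x -> `|x| <= 2.
Proof. by move=> Wx; apply: norm_rV_le => // j; have := Wx j; rewrite [(0 : 'rV_n) 0 j]mxE subr0 => /ltW. Qed.

Let mW : measurable W. Proof. exact: measurable_cube. Qed.
Let Woo : (mu W < +oo)%E. Proof. by rewrite lebesgue_rV_cube// ltry. Qed.

Let inv_itv (k : nat) : 0 <= (k.+1%:R^-1 : R) <= 1.
Proof. by rewrite invr_ge0 ler0n/= invf_le1// ler1n. Qed.

(** Translation invariance makes the difference quotients of [u * psi] integrate to
    zero; their limit is [u * 'D_e psi + G * psi]. *)
Lemma lipschitz_ibp : \int[mu]_(x in U) (u x * 'D_e psi x) = - \int[mu]_(x in U) (G x * psi x).
Proof.
case: psiT => _ [K [cK KU psi0]].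
have [Mp Mp0 psiM] := bounded_supported cK cpsi psi0.
have dpsi0' x : ~ K x -> 'D_e psi x = 0 by exact: dpsi0.
have [Md Md0 dpsiM] := bounded_supported cK cdpsi dpsi0'.
have KW x : K x -> W x.
  by move=> Kx; apply: (@W_shift 0); [rewrite lexx ler01|rewrite scale0r addr0; exact: KU].
pose v : 'rV[R]_n -> R := fun x => u x * psi x.
have cv : continuous v by move=> x; exact: (continuousM (@cu x) (@cpsi x)).
have mv : measurable_fun setT v by exact: continuous_measurable_rV.
pose Mu := `|u 0| + 3%:R * L.
have Mu0 : 0 <= Mu by rewrite addr_ge0 ?mulr_ge0.
have uM x : `|x| <= 3%:R -> `|u x| <= Mu.
  move=> x3; have := uL x 0; rewrite subr0 => h.
  have : L * `|x| <= L * 3%:R by rewrite ler_wpM2l.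
  have : `|u x| <= `|u x - u 0| + `|u 0| by rewrite -[X in `|X| <= _](subrK (u 0)) ler_normD.
  rewrite /Mu; lra.
have K3 x : K x -> `|x| <= 3%:R by move=> /KW/W_norm; lra.
pose f1 x := u x * 'D_e psi x; pose f2 x := G x * psi x.
have i1 : mu.-integrable setT (EFin \o f1).
  apply: (@integrable_supported R n W f1 (Mu * Md)) => //.
  - apply: continuous_measurable_rV => x; exact: (continuousM (@cu x) (@cdpsi x)).
  - move=> x; have [Kx|nK] := pselect (K x); first by rewrite normrM ler_pM// uM// K3.
    by rewrite /f1 dpsi0'// mulr0 normr0 mulr_ge0.
  - by move=> x nW; rewrite /f1 dpsi0' ?mulr0// => /KW.
have i2 : mu.-integrable setT (EFin \o f2).
  apply: (@integrable_supported R n W f2 (L * Mp)) => //.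
  - by apply: measurable_funM => //; exact: continuous_measurable_rV.
  - by move=> x; rewrite normrM ler_pM.
  - by move=> x nW; rewrite /f2 psi0 ?mulr0// => /KW.
have toT (f : 'rV[R]_n -> R) : (forall x, ~ K x -> f x = 0) ->
    \int[mu]_(x in U) f x = \int[mu]_x f x.
  move=> f0; rewrite Rintegral_mkcond; apply: eq_Rintegral => x _; rewrite patchE.
  by case: ifPn => // /negP nU; rewrite f0// => /KU Ux; apply: nU; exact: mem_set.
rewrite (toT f1) => [|x nK]; last by rewrite /f1 dpsi0' ?mulr0.
rewrite (toT f2) => [|x nK]; last by rewrite /f2 psi0 ?mulr0.
apply/eqP; rewrite -subr_eq0 opprK -RintegralD//; apply/eqP.
suff F0 : (\int[mu]_x (f1 x + f2 x)%:E = 0)%E by rewrite /Rintegral F0.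
have vM x : `|v x| <= Mu * Mp.
  have [Kx|nK] := pselect (K x); first by rewrite normrM ler_pM// uM// K3.
  by rewrite /v psi0// mulr0 normr0 mulr_ge0.
have v0 (s : R) x : 0 <= s <= 1 -> ~ W x -> v (x + s *: e) = 0.
  by move=> s01 nW; rewrite /v psi0 ?mulr0// => /KU; apply: contra_not nW => /(W_shift s01).
have iv0 : mu.-integrable setT (EFin \o v).
  apply: (integrable_supported mW Woo mv vM) => x nW.
  by have := @v0 0 x _ nW; rewrite scale0r addr0; apply; rewrite lexx ler01.
have iv k : mu.-integrable setT (EFin \o (fun x => v (x + k.+1%:R^-1 *: e))).
  apply: (@integrable_supported R n W _ (Mu * Mp)) => //.
    by apply: (measurableT_comp mv); exact: measurable_translate.
  by move=> x nW; apply: v0 => //; exact: inv_itv.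
have zero k : (\int[mu]_x (dseq v e k x)%:E = 0)%E.
  have -> : (fun x => (dseq v e k x)%:E) =
     (fun x => k.+1%:R%:E * ((v (x + k.+1%:R^-1 *: e))%:E - (v x)%:E))%E by [].
  have iB := integrableB measurableT (iv k) iv0.
  rewrite (integralZl measurableT iB) (integralB measurableT (iv k) iv0).
  by rewrite integral_translate// subee ?mule0// integrable_fin_num.
pose c := Mu * Md + Mp * L.
have c0 : 0 <= c by rewrite addr_ge0 ?mulr_ge0.
have dvE k x : dseq v e k x = u (x + k.+1%:R^-1 *: e) * dseq psi e k x + psi x * dseq u e k x.
  by rewrite /dseq /v; ring.
have kK k : k.+1%:R * k.+1%:R^-1 = 1 :> R by rewrite mulfV// pnatr_eq0.
have dv_le k x : `|dseq v e k x| <= c * \1_W x.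
  have /andP[s0 s1] := inv_itv k.
  have [Wx|nW] := pselect (W x); last first.
    rewrite /dseq v0//; have := @v0 0 x _ nW; rewrite scale0r addr0 => ->.
      by rewrite subrr mulr0 normr0 mulr_ge0.
    by rewrite lexx ler01.
  rewrite indicE mem_set// mulr1 dvE.
  apply: (le_trans (ler_normD _ _)); rewrite (normrM (u _)) (normrM (psi x)); apply: lerD; apply: ler_pM => //.
  - apply: uM; apply: (le_trans (ler_normD _ _)); have := W_norm Wx.
    have : `|k.+1%:R^-1 *: e| <= 1 by rewrite norm_rVZ (ger0_norm s0) mulr_ile1.
    lra.
  - have h := derivable_line_lipschitz dpsi dpsiM x s0.
    rewrite /dseq normrM (ger0_norm (ler0n R k.+1)).
    by have := ler_wpM2l (ler0n R k.+1) h; rewrite mulrCA kK mulr1.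
  - have h := uL (x + k.+1%:R^-1 *: e) x; rewrite [x + _]addrC addrK in h.
    have h' : `|k.+1%:R^-1 *: e| <= k.+1%:R^-1 by rewrite norm_rVZ (ger0_norm s0) ler_piMr.
    have h2 := le_trans h (ler_wpM2l L0 h').
    rewrite /dseq normrM (ger0_norm (ler0n R k.+1)) [x + _]addrC.
    by have := ler_wpM2l (ler0n R k.+1) h2; rewrite mulrCA kK mulr1.
have conv x : ddir u x e (G x) -> dseq v e ^~ x @ \oo --> f1 x + f2 x.
  move=> ux; have c1 := ddir_dseq (derivable_ddir (dpsi (x := x))); have c2 := ddir_dseq ux.
  have c3 : (fun k => u (x + k.+1%:R^-1 *: e)) @ \oo --> u x.
    apply/cvgrPdist_le => r r0; have rL : 0 < r / (L + 1) by rewrite divr_gt0// ltr_wpDl.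
    near=> k.
    have kr : k.+1%:R^-1 < r / (L + 1).
      have : `|(0 : R) - harmonic k| < r / (L + 1).
        by near: k; move/cvgrPdist_lt : (@cvg_harmonic R); exact.
      by rewrite sub0r normrN ger0_norm// (andP (inv_itv k)).1.
    have h := uL x (x + k.+1%:R^-1 *: e); rewrite opprD addNKr normrN norm_rVZ in h.
    apply: (le_trans h); have /andP[s0 s1] := inv_itv k; rewrite (ger0_norm s0).
    apply: (@le_trans _ _ (L * k.+1%:R^-1)).
      by rewrite ler_wpM2l// ler_piMr.
    have := kr; rewrite ltr_pdivlMr ?ltr_wpDl// => kr'.
    by apply: le_trans (ltW kr'); rewrite mulrC ler_wpM2l// lerDl.
  have -> : dseq v e ^~ x = fun k => u (x + k.+1%:R^-1 *: e) * dseq psi e k x + psi x * dseq u e k x.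
    by apply/funext => k; exact: dvE.
  rewrite /f1 /f2 [G x * _]mulrC.
  by apply: cvgD; [exact: cvgM|apply: cvgM => //; exact: cvg_cst].
have mdseq k : measurable_fun setT (EFin \o dseq v e k).
  apply/measurable_EFinP; apply: measurable_funM => //; apply: measurable_funB => //.
  by apply: (measurableT_comp mv); exact: measurable_translate.
have mf12 : measurable_fun setT (fun x => (f1 x + f2 x)%:E).
  apply/measurable_EFinP; apply: measurable_funD.
    by apply: continuous_measurable_rV => x; exact: (continuousM (@cu x) (@cdpsi x)).
  by apply: measurable_funM => //; exact: continuous_measurable_rV.
have [] := @dominated_convergence _ _ R mu setT measurableT
    (fun k => EFin \o dseq v e k) (fun x => (f1 x + f2 x)%:E) (EFin \o (fun x => c * \1_W x)) mdseq mf12.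
- apply: negligibleS GE => x /= nc xd; apply: nc => _.
  by apply/fine_cvgP; split; [exact: nearW|exact: conv].
- apply: (@integrable_supported R n W _ c) => //.
  + by apply: measurable_funM => //; exact: measurable_indic.
  + by move=> x; rewrite indicE; case: (x \in W); rewrite ?mulr1 ?mulr0 ?normr0 ?(ger0_norm c0).
  + by move=> x nW; rewrite indicE memNset ?mulr0.
- by apply: aeW => x k _; rewrite lee_fin; exact: dv_le.
move=> _ _ H; apply: (cvg_unique _ H) => //.
have -> : [sequence \int[mu]_x (EFin \o dseq v e k) x]_k%E = cst 0%E.
  by apply/funext => k; exact: zero.
exact: cvg_cst.
Unshelve. all: by end_near.
Qed.

End integration_by_parts.

Lemma lipschitz_weak_gradient U : (forall x, U x -> `|x| < 1) ->
  exists2 g, weak_gradient U u g & forall x (i : 'I_n), `|g x 0 i| <= L.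
Proof.
move=> U1.
have /choice[G HG] (i : 'I_n) : exists G : 'rV[R]_n -> R, [/\ measurable_fun setT G,
    forall x, `|G x| <= L & mu.-negligible [set x | ~ ddir u x (evec i) (G x)]].
  apply: measurable_ddir; last by apply: norm_rV_le => // j; rewrite mxE eqxx; case: (j == i);
    rewrite ?normr1 ?normr0.
  by apply/eqP => /rowP/(_ i); rewrite !mxE !eqxx => /eqP; rewrite oner_eq0.
have gE i : (fun x => (\row_j G j x : 'rV[R]_n) 0 i) = G i by apply/funext => x; rewrite mxE.
exists (fun x => \row_j G j x) => [i|x i]; last by rewrite mxE; case: (HG i).
rewrite gE; have [mG GL GE] := HG i; split.
- exact: measurable_funS mG.
- move=> K cK KU; apply: measurable_bounded_integrable.
  + by apply: measurable_closed_rV; apply: compact_closed => //; exact: norm_hausdorff.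
  + apply: (@le_lt_trans _ _ (mu (cube 0 1))); last by rewrite lebesgue_rV_cube// ltry.
    apply: le_measure; rewrite ?inE.
    * by apply: measurable_closed_rV; apply: compact_closed => //; exact: norm_hausdorff.
    * exact: measurable_cube.
    * move=> x /KU /U1 x1 j; rewrite [(0 : 'rV_n) 0 j]mxE subr0.
      exact: le_lt_trans (coord_le_norm _ _) x1.
  + exact: measurable_funS mG.
  + exists L; split; first exact: num_real.
    by move=> M LM x _; apply: (le_trans (GL x)); exact: ltW.
- move=> psi psiT; rewrite (lipschitz_ibp U1 psiT mG GL GE); congr (- _).
  by apply: eq_Rintegral => x _; rewrite mxE.
Qed.

End weak_derivative.

Lemma enorm_le_norm (R : realType) (n : nat) (x : 'rV[R]_n) : enorm x <= n%:R * `|x|.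
Proof.
have c0 : 0 <= n%:R * `|x| by rewrite mulr_ge0.
rewrite enormE -[X in _ <= X]ger0_norm// -sqrtr_sqr ler_wsqrtr// exprMn.
apply: le_trans (dotxx_le_normsq x) _; rewrite ler_wpM2r ?sqr_ge0//.
by case: n x c0 => [|m] x _; [rewrite expr0n|rewrite expr2 ler_peMr// ler1n].
Qed.

Lemma grad_Linfty_le_lipschitz (R : realType) (n : nat) (U : set 'rV[R]_n) (u : 'rV[R]_n -> R) (L : R) :
  0 <= L -> (forall x, U x -> `|x| < 1) ->
  (forall x y, U x -> U y -> `|u x - u y| <= L * enorm (x - y)) ->
  grad_Linfty_le U u (n%:R * (L * n%:R)).
Proof.
move=> L0 U1 uL; have Ln0 : 0 <= L * n%:R by rewrite mulr_ge0.
have [v vL vu] : exists2 v : 'rV[R]_n -> R, (forall x y, `|v x - v y| <= L * n%:R * `|x - y|) &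
    forall x, U x -> v x = u x.
  apply: lipschitz_extension => // x y Ux Uy; apply: (le_trans (uL _ _ Ux Uy)).
  by rewrite -mulrA ler_wpM2l// enorm_le_norm.
have [g gv gL] := lipschitz_weak_gradient Ln0 vL U1; exists g.
  move=> i; have [mg ig ibp] := gv i; split => // psi psiT; rewrite -ibp//.
  by apply: eq_Rintegral => x /set_mem Ux; rewrite vu.
apply: Linfty_norm_le; first by rewrite mulr_ge0.
rewrite (_ : [set x | _] = set0); first exact: negligible_set0.
rewrite -subset0 => x [_]; apply; rewrite ger0_norm ?sqrtr_ge0//.
apply: (le_trans (enorm_le_norm _)); rewrite ler_wpM2l//.
by apply: norm_rV_le.
Qed.

(** * The gradient bound *)

Theorem corollary6p1 (R : realType) (n : nat) (lambda Lambda K : R)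
    (lambda_gt0 : 0 < lambda) (lambda_le : lambda <= Lambda) :
  exists C : R,
    forall (F : 'M[R]_n -> R) (q : R) (f u : 'rV[R]_n -> R),
      elliptic lambda Lambda F ->
      0 <= q ->
      lebesgue_measurable (eball 1) f ->
      Linfty_norm (eball 1) f = K%:E ->
      visc_solution F q f (eball 1) u ->
      (forall x, eball 1 x -> -1 <= u x <= 1) ->
      grad_Linfty_le (eball (1 / 2)) u C.
Proof.
pose L := @lip_bound R n lambda Lambda (`|K|).
exists (n%:R * (L * n%:R)) => F q f u Fell q0 _ fK [uc usub usup] ub.
have K0 := Linfty_norm_ge0 fK.
have L0 : 0 <= L.
  rewrite addr_ge0// divr_ge0 ?(ltW lambda_gt0)// addr_ge0 ?mulr_ge0//.
  exact: le_trans (ltW lambda_gt0) lambda_le.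
have ball1 (x : 'rV[R]_n) : dot x x < 1 -> eball 1 x by rewrite eballE// expr1n.
have ball1' (x : 'rV[R]_n) : eball 1 x -> dot x x < 1 by rewrite eballE// expr1n.
have half (x : 'rV[R]_n) : eball (1 / 2) x -> dot x x < 4%:R^-1.
  by rewrite eballE ?divr_gt0// expr_div_n expr1n -natrX mul1r.
apply: grad_Linfty_le_lipschitz => // [x /half x4|x y /half x4 /half y4].
  rewrite -(@ltr_pXn2r _ 2) ?nnegrE// expr1n.
  by apply: le_lt_trans (normsq_le_dotxx x) _; lra.
have [n0|n0] := posnP n.
  have -> : x = y by apply/rowP => i; have := ltn_ord i; rewrite {2}n0.
  by rewrite subrr normr0 mulr_ge0// sqrtr_ge0.
have E (U V : set 'rV[R]_n) (h : 'rV[R]_n -> R) k : U = V -> quad_subsolution F k h U u ->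
    quad_subsolution F k h V u by move=> ->.
have BE : eball 1 = [set x : 'rV[R]_n | dot x x < 1].
  by apply/seteqP; split => z; [exact: ball1'|exact: ball1].
have neg := Linfty_norm_negligible fK.
have := @lipschitz_half_ball R n lambda Lambda q `|K| F f u lambda_gt0 lambda_le q0 (normr_ge0 K) n0.
apply => //.
- by move=> M N sM sN; have /andP[] := Fell M N sM sN.
- by move=> z /ball1 Bz; apply: uc; exact: mem_set.
- by move=> z /ball1 /ub /andP[h1 h2]; rewrite ler_norml h1 h2.
- by rewrite -BE; exact: visc_sub_quad.
- by rewrite -BE; exact: visc_super_quad.
- apply: negligibleS neg => z [/= /ball1 Bz fz]; split=> //.
  by rewrite ger0_norm in fz => //; rewrite -normrN (lt_le_trans _ (ler_norm _))//; lra.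
- apply: negligibleS neg => z [/= /ball1 Bz fz]; split=> //.
  by rewrite ger0_norm in fz => //; rewrite (lt_le_trans _ (ler_norm _))//; lra.
Qed.
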